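(* Assume the following (conjectural) property: for every ordered $\Pi$-multiset $\bar I=(I,\prec,\iota)$, $W_{\bar I}((t_i)_{i\in I})$ is a linear combination of noncommutative polynomials in the $f^+_\alpha(q^kt_i)$, $f_\alpha[0]$ ($\alpha\in\Pi$, $k\in\mathbb Z$, $i\in I$), where the coefficients have the form $Q((t_i)_{i\in I})/\prod_{i,j\in I\mid i\prec j}(t_i-q^{-(\iota(i),\iota(j))}t_j)$ with $Q$ a polynomial of degree $|I|(|I|-1)/2$. Let $V$ be a finite dimensional representation of $U'_q(\widehat{\mathfrak g})$ with singular weight vector $v$, and for an ordered $\Pi$-multiset $\bar I$ with $I=\{i_1\prec\cdots\prec i_n\}$ let $w_V^{\bar I}((t_i)_{i\in I}):=P(f_{\iota(i_1)}(t_{i_1})\cdots f_{\iota(i_n)}(t_{i_n}))v$. Then $w_V^{\bar I}((t_i)_{i\in I})$ is the Laurent expansion of a rational function on $\mathbb C^n$. There exist rational functions $$\overline w_{n_1,\dots,n_r}\big((u^{(1)}_j)_{j=1,\dots,n_1},\dots,(u^{(r)}_j)_{j=1,\dots,n_r}\big)$$ such that for all $\bar I$ $$w_V^{\bar I}((t_i)_{i\in I})=\frac{\epsilon(\sigma)\prod_{s=1}^r\prod_{i,j\in I_s\mid i\prec j}(t_i^{-1}-t_j^{-1})}{\prod_{i\in I}t_i\prod_{i,j\in I\mid i\prec j}(t_i^{-1}-q^{(\iota(i),\iota(j))}t_j^{-1})}\ \overline w_{|I_1|,\dots,|I_r|}\big((t_{j_1}^{-1})_{j_1\in I_1},\dots,(t_{j_r}^{-1})_{j_r\in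 I_r}\big),$$ where $I_s=\iota^{-1}(\alpha_s)$ and $\sigma\in\mathfrak S_n$ is the shuffle permutation $\{1,\dots,n\}\simeq I_1\sqcup\cdots\sqcup I_r\to I\simeq\{1,\dots,n\}$ (first and last bijections ordered, with $I_1\prec\cdots\prec I_r$ in the disjoint union, and the middle map the natural injection on each $I_s$). Each function $\overline w_{n_1,\dots,n_r}$ is symmetric in each group of variables $(u^{(s)}_j)_{j=1,\dots,n_s}$. Its only singularities are poles at $u^{(s)}_j\in S_s$, where each $S_s$ is a finite subset of $\mathbb C^\times$. It vanishes on the spaces $H^{st}_{(k_1,\dots,k_m),l}$, for all $s\ne t$ in $\{1,\dots,r\}$, $m=1-a_{s,t}$, distinct $k_1,\dots,k_m\in\{1,\dots,n_s\}$ and $l\in\{1,\dots,n_t\}$, where $H^{st}_{(k_1,\dots,k_m),l}\subset\oplus_{s'}\mathbb C^{n_{s'}}$ is defined by $$u^{(t)}_l=q^{-\frac{(m-1)(\alpha_s,\alpha_s)}2}u^{(s)}_{k_1}=q^{-\frac{(m-3)(\alpha_s,\alpha_s)}2}u^{(s)}_{k_2}=\cdots=q^{\frac{(m-1)(\alpha_s,\alpha_s)}2}u^{(s)}_{k_m}.$$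
   Context: Algebra. $q\in\mathbb C^\times$ is not a root of unity. $\mathfrak g$ is a simple complex Lie algebra of rank $r$ with simple roots $\Pi=\{\alpha_1,\dots,\alpha_r\}$ and highest root $\theta$; $\widehat{\mathfrak g}$ is its untwisted affine Lie algebra with simple roots $\alpha_0,\dots,\alpha_r$, Cartan matrix $(a_{i,j})_{0\le i,j\le r}$, symmetrized form $(\alpha_i,\alpha_j)=d_ia_{i,j}$ ($d_i\in\{1,2,3\}$ coprime), minimal positive imaginary root $\delta=\sum_{i=0}^rn_i\alpha_i$, $n_0=1$. $q_i=q_{\alpha_i}=q^{d_i}$, $[n]_q=\frac{q^n-q^{-n}}{q-q^{-1}}$. $U'_q(\widehat{\mathfrak g})$ (the subquotient of $U_q(\widehat{\mathfrak g})$ with trivial central element $C=k_\delta^{1/2}=1$ and without the grading element $q^d$) is generated by $e_{\pm\alpha_i},k_{\alpha_i}^{\pm1}$ ($0\le i\le r$) with $\prod k_{\alpha_i}^{n_i}=1$ and relations: the $k$'s commute, $k_{\alpha_i}e_{\pm\alpha_j}k_{\alpha_i}^{-1}=q_i^{\pm a_{ij}}e_{\pm\alpha_j}$, $[e_{\alpha_i},e_{-\alpha_j}]=\delta_{ij}\frac{k_{\alpha_i}-k_{\alpha_i}^{-1}}{q_i-q_i^{-1}}$, and the quantum Serre relations $\sum_{p+s=1-a_{ij}}(-1)^pe_{\pm\alpha_i}^{(p)}e_{\pm\alpha_j}e_{\pm\alpha_i}^{(s)}=0$ ($i\ne j$, $e^{(p)}_{\pm\alpha_i}=e_{\pm\alpha_i}^p/[p]_{q_i}!$).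 The counit $\varepsilon$ is $0$ on $e_{\pm\alpha_i}$, $1$ on the $k$'s. Currents presentation. $U'_q(\widehat{\mathfrak g})$ is also generated by $e_\alpha[n],f_\alpha[n]$ ($n\in\mathbb Z$), $k_\alpha^{\pm1}$, $h_\alpha[n]$ ($n\ne0$), $\alpha\in\Pi$, collected as $e_\alpha(z)=\sum_n e_\alpha[n]z^{-n}$, $f_\alpha(z)=\sum_nf_\alpha[n]z^{-n}$, $\psi^\pm_\alpha(z)=\sum_{n\ge0}\psi^\pm_\alpha[\pm n]z^{\mp n}=k_\alpha^{\pm1}\exp(\pm(q_\alpha-q_\alpha^{-1})\sum_{n>0}h_\alpha[\pm n]z^{\mp n})$, with relations, for $\alpha,\beta\in\Pi$, $a=(\alpha,\beta)$: $(z-q^{a}w)e_\alpha(z)e_\beta(w)=(q^az-w)e_\beta(w)e_\alpha(z)$; $(z-q^{-a}w)f_\alpha(z)f_\beta(w)=(q^{-a}z-w)f_\beta(w)f_\alpha(z)$; $\psi^\pm_\alpha(z)e_\beta(w)\psi^\pm_\alpha(z)^{-1}=\frac{q^az-w}{z-q^aw}e_\beta(w)$; $\psi^\pm_\alpha(z)f_\beta(w)\psi^\pm_\alpha(z)^{-1}=\frac{q^{-a}z-w}{z-q^{-a}w}f_\beta(w)$; all $\psi^\pm$ commute; $[e_\alpha(z),f_\beta(w)]=\frac{\delta_{\alpha,\beta}}{q_\alpha-q_\alpha^{-1}}\delta(z/w)(\psi^+_\alpha(z)-\psi^-_\alpha(w))$, $\delta(z)=\sum_{k\in\mathbb Z}z^k$;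 and the quantum Serre relations for the currents $e_{\alpha_i}(z)$ and, separately, $f_{\alpha_i}(z)$: $\sum_{p=0}^{m}(-1)^p\binom{m}{p}_{q_i}\mathrm{Sym}_{z_1,\dots,z_m}x_i(z_1)\cdots x_i(z_p)x_j(w)x_i(z_{p+1})\cdots x_i(z_m)=0$, $m=1-a_{i,j}$, $i\ne j$. The identification is: $k_{\alpha_i}\mapsto k_{\alpha_i}$, $e_{\alpha_i}\mapsto e_{\alpha_i}[0]$, $e_{-\alpha_i}\mapsto f_{\alpha_i}[0]$ ($1\le i\le r$), $k_{\alpha_0}\mapsto\prod_{i\ge1}k_{\alpha_i}^{-n_i}$, and, if $[e_{\alpha_{i_1}},[\cdots,[e_{\alpha_{i_n}},e_{\alpha_j}]\cdots]]$ is a nonzero multiple of the root vector $e_\theta\in\mathfrak g$, $e_{\alpha_0}\mapsto\mu\,S^-_{i_1}\cdots S^-_{i_n}(f_{\alpha_j}[1])k_{\alpha_0}$, $e_{-\alpha_0}\mapsto\lambda\,k_{\alpha_0}^{-1}S^+_{i_1}\cdots S^+_{i_n}(e_{\alpha_j}[-1])$, where $S_i^+(x)=e_{\alpha_i}[0]x-k_{\alpha_i}xk_{\alpha_i}^{-1}e_{\alpha_i}[0]$, $S_i^-(x)=xf_{\alpha_i}[0]-f_{\alpha_i}[0]k_{\alpha_i}xk_{\alpha_i}^{-1}$ and $\lambda,\mu\neq0$ are scalars such that the relation for $[e_{\alpha_0},e_{-\alpha_0}]$ holds. Subalgebras. $U'_q(\mathfrak h)$: generated by the $k_{\alpha_i}^{\pm1}$.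 $U'_q(\mathfrak n_\pm)$: generated by $e_{\pm\alpha_i}$, $0\le i\le r$; $U'_q(\mathfrak b_\pm)$: generated by $U'_q(\mathfrak n_\pm)$ and $U'_q(\mathfrak h)$. $U_F$: generated by $U'_q(\mathfrak h)$, $f_\alpha[n]$ ($n\in\mathbb Z$), $h_\alpha[m]$ ($m>0$). $U_f^-=U_F\cap U'_q(\mathfrak n_-)$, $U_F^+=U_F\cap U'_q(\mathfrak b_+)$. The product gives a linear isomorphism $U_f^-\otimes U_F^+\simeq U_F$, and $P:U_F\to U_F^+$ is the linear map $P(f_-f_+)=\varepsilon(f_-)f_+$ ($f_-\in U_f^-$, $f_+\in U_F^+$), applied coefficientwise to series. Weight functions. An ordered $\Pi$-multiset is a triple $\bar I=(I,\prec,\iota)$ with $(I,\prec)$ a finite totally ordered set and $\iota:I\to\Pi$. For $I=\{i_1\prec\cdots\prec i_n\}$, $W_{\bar I}((t_i)_{i\in I}):=P(f_{\iota(i_1)}(t_{i_1})\cdots f_{\iota(i_n)}(t_{i_n}))$. For $\alpha\in\Pi$, $f^+_\alpha(z):=\sum_{n>0}f_\alpha[n]z^{-n}$. Series are Laurent series in the space of $\sum A_{k_1,\dots,k_n}t_{i_1}^{k_1}\cdots t_{i_n}^{k_n}$ with $A_{k_1,\dots,k_n}=0$ whenever $k_1>a_1$, or $k_2>a_2(k_1)$, ..., or $k_n>a_n(k_1,\dots,k_{n-1})$, for some integer $a_1$ and integer valued functions $a_2,\dots,a_n$ (rational functions are expanded accordingly, i.e. in powers of $t_j/t_i$ for $i\prec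 j$). A vector $v\in V$ is a singular weight vector of weight $\{\lambda_i(z)\}_{i=1,\dots,r}$ if $e_\alpha[n]v=0$ for $\alpha\in\Pi$, $n\ge0$, and $\psi^+_{\alpha_i}(z)v=\lambda_i(z)v$ with $\lambda_i(z)\in\mathbb C[[z^{-1}]]^\times$; $V$ is a representation with singular weight vector $v$ if moreover it is generated by $v$ over $U'_q(\widehat{\mathfrak g})$. *)

(* Defs.v *)
From HB Require Import structures.
From mathcomp Require Import all_boot all_order all_algebra all_fingroup.
From mathcomp Require Import fraction mpoly complex reals.

Set Implicit Arguments.
Unset Strict Implicit.
Unset Printing Implicit Defensive.

Import GRing.Theory.
Local Open Scope ring_scope.

Section Lie.
Variables (C : fieldType) (g : vectType C) (br : g -> g -> g).

Definition is_lie_bracket : Prop :=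
  [/\ forall a x y z, br (a *: x + y) z = a *: br x z + br y z,
      forall a x y z, br z (a *: x + y) = a *: br z x + br z y,
      forall x, br x x = 0
    & forall x y z, br x (br y z) + br y (br z x) + br z (br x y) = 0].

Definition is_simple_lie : Prop :=
  (exists x y, br x y <> 0) /\
  forall I : {vspace g},
    (forall x y, y \in I -> br x y \in I) -> I = 0%VS \/ I = fullv.

Variables (r : nat) (A : 'M[int]_r) (e f h : 'I_r -> g).

(* The h i span a Cartan subalgebra, and the e i are root vectors for a base
   of the root system, with A i j = alpha_j (h i). *)
Definition is_chevalley : Prop :=
  [/\ free [seq h i | i <- enum 'I_r],
      forall i j, br (h i) (h j) = 0,
      forall i j, br (h i) (e j) = (A i j)%:~R *: e j
               /\ br (h i) (f j) = - (A i j)%:~R *: f j,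
      forall i j, br (e i) (f j) = if i == j then h i else 0
    & (forall i, A i i = 2) /\
      forall S : {vspace g},
        (forall i, e i \in S /\ f i \in S) ->
        (forall x y, x \in S -> y \in S -> br x y \in S) -> S = fullv].

(* b stands for the element \sum_j b_j alpha_j of the root lattice. *)
Definition in_root_space (b : 'I_r -> int) (x : g) : Prop :=
  forall i, br (h i) x = (\sum_j A i j * b j)%:~R *: x.

Definition is_root (b : 'I_r -> int) : Prop :=
  (exists i, b i <> 0) /\ exists2 x, x != 0 & in_root_space b x.

Definition is_highest_root (b : 'I_r -> int) : Prop :=
  is_root b /\ forall b', is_root b' -> forall i, (b' i <= b i)%O.

End Lie.

(* Node ord0 is the affine node; node lift ord0 i is the i-th finite one. *)
Record simple_lie (C : fieldType) (r : nat) := SimpleLie {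
  sl_car : vectType C;
  sl_br : sl_car -> sl_car -> sl_car;
  sl_e : 'I_r -> sl_car;
  sl_f : 'I_r -> sl_car;
  sl_h : 'I_r -> sl_car;
  sl_aff : 'M[int]_r.+1;
  sl_d : 'I_r.+1 -> nat;
  sl_n : 'I_r.+1 -> nat;
  sl_cartan : 'M[int]_r := \matrix_(i, j) sl_aff (lift ord0 i) (lift ord0 j);
  sl_theta : 'I_r -> int := fun i => (sl_n (lift ord0 i))%:Z;
  sl_lieP : is_lie_bracket sl_br;
  sl_simpleP : is_simple_lie sl_br;
  sl_chevalleyP : is_chevalley sl_br sl_cartan sl_e sl_f sl_h;
  sl_thetaP : is_highest_root sl_br sl_cartan sl_h sl_theta;
  sl_d123 : forall i, sl_d i \in [:: 1; 2; 3]%N;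
  sl_d_coprime : \big[gcdn/0%N]_i sl_d i = 1%N;
  sl_sym : forall i j, (sl_d i)%:Z * sl_aff i j = (sl_d j)%:Z * sl_aff j i;
  (* delta = \sum_i n_i alpha_i = alpha_0 + theta is isotropic; with the
     symmetry above this determines d_0, a_{0,i} and a_{i,0} *)
  sl_n0 : sl_n ord0 = 1%N;
  sl_aff00 : sl_aff ord0 ord0 = 2;
  sl_delta : forall i, \sum_j sl_aff i j * (sl_n j)%:Z = 0 }.

Definition sl_form (C : fieldType) r (g : simple_lie C r) (i j : 'I_r) : int :=
  (sl_d g (lift ord0 i))%:Z * sl_cartan g i j.

(* x exhibits U as the algebra with generators G and relations rel. *)
Definition presents (C : fieldType) (G : Type)
    (rel : forall A : algType C, (G -> A) -> Prop)
    (U : algType C) (x : G -> U) : Prop :=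
  [/\ rel U x,
      forall (A : algType C) (y : G -> A), rel A y ->
        exists phi : {lrmorphism U -> A}, forall s, phi (x s) = y s
    & forall (A : algType C) (phi psi : {lrmorphism U -> A}),
        (forall s, phi (x s) = psi (x s)) -> phi =1 psi].

Inductive subalg (C : fieldType) (U : algType C) (S : U -> Prop) : U -> Prop :=
| subalg_gen x : S x -> subalg S x
| subalg_one : subalg S 1
| subalg_lin a x y : subalg S x -> subalg S y -> subalg S (a *: x + y)
| subalg_mul x y : subalg S x -> subalg S y -> subalg S (x * y).

Section QNumbers.
Variables (C : fieldType) (q : C).
Definition qnum (n : nat) : C := (q ^+ n - q ^- n) / (q - q^-1).
Definition qfact (n : nat) : C := \prod_(1 <= i < n.+1) qnum i.
Definition qbinom (m p : nat) : C := qfact m / (qfact p * qfact (m - p)).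
End QNumbers.

(* m = 1 - a, for a nonpositive Cartan integer a *)
Definition serre_len (a : int) : nat := `|1 - a|%N.

(* In DJe and CurX the sign b = false stands for e_{alpha_i}, resp. e_alpha[n],
   and b = true for e_{-alpha_i}, resp. f_alpha[n].  In the k generators
   b = true stands for the inverse. *)
Inductive dj_gen (r : nat) :=
| DJe of bool & 'I_r.+1
| DJk of bool & 'I_r.+1.
Inductive cur_gen (r : nat) :=
| CurX of bool & 'I_r & int
| CurK of bool & 'I_r
| CurH of 'I_r & int.
Arguments DJe {r}. Arguments DJk {r}.
Arguments CurX {r}. Arguments CurK {r}. Arguments CurH {r}.

Definition sgnz (b : bool) (a : int) : int := if b then - a else a.

Section QuantumAffine.
Variables (C : fieldType) (q : C) (r : nat) (g : simple_lie C r).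

Definition qaff (i : 'I_r.+1) : C := q ^+ sl_d g i.
Definition qfin (i : 'I_r) : C := qaff (lift ord0 i).

Definition dj_rel (A : algType C) (x : dj_gen r -> A) : Prop :=
  let k i := x (DJk false i) in
  let kV i := x (DJk true i) in
  let dpow b i p : A := (qfact (qaff i) p)^-1 *: x (DJe b i) ^+ p in
  [/\ [/\ forall i, k i * kV i = 1 /\ kV i * k i = 1,
          forall i j, k i * k j = k j * k i
        & \prod_i k i ^+ sl_n g i = 1],
      forall b i j, k i * x (DJe b j) * kV i =
        qaff i ^ (sgnz b (sl_aff g i j)) *: x (DJe b j),
      forall i j, x (DJe false i) * x (DJe true j)
                  - x (DJe true j) * x (DJe false i) =
        if i == j then (qaff i - (qaff i)^-1)^-1 *: (k i - kV i) else 0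
    & forall b i j, i != j -> let m := serre_len (sl_aff g i j) in
        \sum_(p < m.+1)
           (-1) ^+ p *: (dpow b i p * x (DJe b j) * dpow b i (m - p)%N) = 0].

(* Coefficients of the m-th power of \sum_(l > 0) a_l u^l, and of its
   exponential. *)
Fixpoint pow_coef (A : algType C) (a : nat -> A) (j m : nat) : A :=
  if j is j'.+1 then \sum_(1 <= l < m.+1) a l * pow_coef a j' (m - l)%N
  else (m == 0%N)%:R.
Definition exp_coef (A : algType C) (a : nat -> A) (m : nat) : A :=
  \sum_(j < m.+1) (j`!%:R : C)^-1 *: pow_coef a j m.

(* psi false i n = psi^+_i[n] and psi true i n = psi^-_i[n]; these vanish for
   n < 0, resp. n > 0. *)
Definition psi (A : algType C) (x : cur_gen r -> A)
    (b : bool) (i : 'I_r) (n : int) : A :=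
  if sgnz b n is Posz m then
    x (CurK b i) *
    exp_coef (fun l => ((-1) ^+ b * (qfin i - (qfin i)^-1)) *:
                       x (CurH i (sgnz b l%:Z))) m
  else 0.

(* (z - c w) x(z) y(w) = (c z - w) y(w) x(z), with x(z) = \sum_n x n z^-n and
   y(w) = \sum_m y m w^-m: equality of the coefficients of z^-n w^-m. *)
Definition qcomm_rel (A : algType C) (c : C) (x y : int -> A) : Prop :=
  forall n m, x (n + 1) * y m - c *: (x n * y (m + 1)) =
              c *: (y m * x (n + 1)) - y (m + 1) * x n.

(* The coefficient of z_1^{-k_1} ... z_m^{-k_m} w^{-l} in the Serre relation. *)
Definition serre_rel (A : algType C) (qi : C) (m : nat) (x y : int -> A) :=
  forall (k : 'I_m -> int) (l : int),
    \sum_(p < m.+1) ((-1) ^+ p * qbinom qi m p) *: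
      \sum_(s : 'S_m) (\prod_(i < m | (i < p)%N) x (k (s i)) * y l *
                       \prod_(i < m | (p <= i)%N) x (k (s i))) = 0.

(* h_i[0] is not a generator: it is set to 0.  The relation for
   psi(z) x(w) psi(z)^-1 is written with its denominator cleared; since psi is
   a one-sided invertible series in z, this loses nothing. *)
Definition cur_rel (A : algType C) (x : cur_gen r -> A) : Prop :=
  [/\ forall i, [/\ x (CurH i 0) = 0, x (CurK false i) * x (CurK true i) = 1
                  & x (CurK true i) * x (CurK false i) = 1],
      (forall b b' i j n m,
        psi x b i n * psi x b' j m = psi x b' j m * psi x b i n) /\
      (forall b b' i j, qcomm_rel (q ^ (sgnz b' (sl_form g i j)))
        (psi x b i) (fun m => x (CurX b' j m))),
      forall b i j, qcomm_rel (q ^ (sgnz b (sl_form g i j)))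
        (fun n => x (CurX b i n)) (fun m => x (CurX b j m)),
      forall i j n m, x (CurX false i n) * x (CurX true j m)
                      - x (CurX true j m) * x (CurX false i n) =
        if i == j then (qfin i - (qfin i)^-1)^-1 *:
                         (psi x false i (n + m) - psi x true i (n + m))
        else 0
    & forall b i j, i != j ->
        serre_rel (qfin i) (serre_len (sl_cartan g i j))
          (fun n => x (CurX b i n)) (fun n => x (CurX b j n))].

Definition Splus (A : algType C) (x : cur_gen r -> A) (i : 'I_r) (y : A) : A :=
  x (CurX false i 0) * y
  - x (CurK false i) * y * x (CurK true i) * x (CurX false i 0).
Definition Sminus (A : algType C) (x : cur_gen r -> A) (i : 'I_r) (y : A) : A :=
  y * x (CurX true i 0)
  - x (CurX true i 0) * x (CurK false i) * y * x (CurK true i).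

(* U with its Chevalley generators and its current generators.  The sequence
   qa_is = [:: i_1; ...; i_n] and qa_j are the indices in the formulas for
   e_{+-alpha_0}; that qa_lambda and qa_mu fit the relation for
   [e_{alpha_0}, e_{-alpha_0}] is part of qa_djP. *)
Record quantum_affine (U : algType C) := QuantumAffine {
  qa_dj : dj_gen r -> U;
  qa_cur : cur_gen r -> U;
  qa_is : seq 'I_r;
  qa_j : 'I_r;
  qa_lambda : C;
  qa_mu : C;
  qa_djP : presents dj_rel qa_dj;
  qa_curP : presents cur_rel qa_cur;
  qa_k : forall b i, qa_dj (DJk b (lift ord0 i)) = qa_cur (CurK b i);
  qa_e : forall b i, qa_dj (DJe b (lift ord0 i)) = qa_cur (CurX b i 0);
  qa_k0 : qa_dj (DJk false ord0) =
            \prod_i qa_cur (CurK true i) ^+ sl_n g (lift ord0 i);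
  qa_isP : let x := foldr (fun i => sl_br (sl_e g i)) (sl_e g qa_j) qa_is in
    x != 0 /\ in_root_space (@sl_br C r g) (sl_cartan g) (@sl_h C r g)
                (sl_theta g) x;
  qa_lambda_neq0 : qa_lambda != 0;
  qa_mu_neq0 : qa_mu != 0;
  qa_e0 : qa_dj (DJe false ord0) =
    qa_mu *: (foldr (Sminus qa_cur) (qa_cur (CurX true qa_j 1)) qa_is
              * qa_dj (DJk false ord0));
  qa_f0 : qa_dj (DJe true ord0) =
    qa_lambda *: (qa_dj (DJk true ord0) *
                  foldr (Splus qa_cur) (qa_cur (CurX false qa_j (-1))) qa_is) }.

Variables (U : algType C) (X : quantum_affine U).

Definition in_n_minus : U -> Prop :=
  subalg (fun x => exists i, x = qa_dj X (DJe true i)).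
Definition in_b_plus : U -> Prop :=
  subalg (fun x => (exists i, x = qa_dj X (DJe false i)) \/
                   (exists b i, x = qa_dj X (DJk b i))).
Definition in_UF : U -> Prop :=
  subalg (fun x => [\/ exists b i, x = qa_dj X (DJk b i),
                       exists i n, x = qa_cur X (CurX true i n)
                     | exists i (m : nat), (0 < m)%N /\
                         x = qa_cur X (CurH i m%:Z)]).
Definition in_Uf_minus (x : U) : Prop := in_UF x /\ in_n_minus x.
Definition in_UF_plus (x : U) : Prop := in_UF x /\ in_b_plus x.

(* For linear subspaces S, T, D of U: the product of U induces a bijection from
   the tensor product of S and T onto D.  The last clause is the injectivity
   (a tensor is a sum of a_k (x) b_k with the a_k linearly independent). *)
Definition product_iso (S T D : U -> Prop) : Prop :=
  [/\ forall a b, S a -> T b -> D (a * b),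
      forall x, D x -> exists m (a b : 'I_m -> U),
        [/\ forall i, S (a i), forall i, T (b i) & x = \sum_i a i * b i]
    & forall m (a b : 'I_m -> U), (forall i, S (a i)) -> (forall i, T (b i)) ->
        (forall c : 'I_m -> C, \sum_i c i *: a i = 0 -> forall i, c i = 0) ->
        \sum_i a i * b i = 0 -> forall i, b i = 0].

Definition is_counit (eps : U -> C) : Prop :=
  (forall b i, eps (qa_dj X (DJe b i)) = 0) /\
  (forall b i, eps (qa_dj X (DJk b i)) = 1).

(* P is only meaningful on U_F. *)
Definition is_projection (eps : U -> C) (P : U -> U) : Prop :=
  (forall a x y, in_UF x -> in_UF y -> P (a *: x + y) = a *: P x + P y) /\
  (forall x y, in_Uf_minus x -> in_UF_plus y -> P (x * y) = eps x *: y).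

End QuantumAffine.

(* A formal series \sum_k s_k t^k in t_1, ..., t_n with coefficients in E is
   the function s : {ffun 'I_n -> int} -> E. *)
Section Series.
Variables (C : fieldType) (n : nat).

Definition is_laurent (E : nmodType) (s : {ffun 'I_n -> int} -> E) : Prop :=
  exists a : 'I_n -> {ffun 'I_n -> int} -> int,
    (forall (i : 'I_n) (k k' : {ffun 'I_n -> int}),
       (forall j : 'I_n, (j < i)%N -> k j = k' j) -> a i k = a i k') /\
    (forall (i : 'I_n) (k : {ffun 'I_n -> int}), (a i k < k i)%O -> s k = 0).

Definition mulser (E : lmodType C) (p : {mpoly C[n]})
    (s : {ffun 'I_n -> int} -> E) (k : {ffun 'I_n -> int}) : E :=
  \sum_(m <- msupp p) p@_m *: s (k - [ffun i => (m i)%:Z]).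

Definition one_ser (A : algType C) (k : {ffun 'I_n -> int}) : A := (k == 0)%:R.

Definition ratfun : fieldType := {fraction {mpoly C[n]}}.
Definition rconst (c : C) : ratfun := tofrac (c%:MP : {mpoly C[n]}).
Definition rvar (i : 'I_n) : ratfun := tofrac ('X_i : {mpoly C[n]}).
Definition rfrac (p d : {mpoly C[n]}) : ratfun := tofrac p / tofrac d.

(* The Laurent series form a torsion-free module over polynomials, so the
   expansion s of p / d is characterized by d s = p. *)
Definition expands (s : {ffun 'I_n -> int} -> C) (G : ratfun) : Prop :=
  is_laurent s /\
  exists p d, [/\ d != 0, G = rfrac p d &
    mulser d (s : _ -> C^o) =1 mulser p (one_ser C^o)].

(* V-valued rational functions are given by their coordinates in the basis
   vbasis fullv of V. *)
Definition vratfun (V : vectType C) := 'rV[ratfun]_(\dim (fullv : {vspace V})).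
Definition vexpands (V : vectType C) (s : {ffun 'I_n -> int} -> V)
    (G : vratfun V) : Prop :=
  forall j, expands (fun k => coord (vbasis fullv) j (s k)) (G 0 j).

(* G is regular at x, with value c *)
Definition has_value (G : ratfun) (x : 'I_n -> C) (c : C) : Prop :=
  exists p d, [/\ d.@[x] != 0, G = rfrac p d & c = p.@[x] / d.@[x]].

End Series.

(* G (h_1, ..., h_N); meaningful if the denominator of G does not vanish at h,
   as is the case when the h_i are algebraically independent. *)
Definition rsubst (C : fieldType) N n (h : 'I_N -> ratfun C n)
    (G : ratfun C N) : ratfun C n :=
  let rep := generic_quotient.repr (G : {fraction {mpoly C[N]}}) in
  mmap (@rconst C n) h (frac rep).1 / mmap (@rconst C n) h (frac rep).2.

(* An ordered Pi-multiset is taken with I = 'I_n in its natural order; it is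
   then the map iota : 'I_n -> 'I_r. *)
Section Weight.
Variables (C : fieldType) (q : C) (r : nat) (g : simple_lie C r).
Variables (U : algType C) (X : quantum_affine q g U) (P : U -> U).

Section Multiset.
Variables (n : nat) (iota : 'I_n -> 'I_r).

Definition weight_fun (k : {ffun 'I_n -> int}) : U :=
  P (\prod_i qa_cur X (CurX true (iota i) (- k i))).

(* inl (a, c, i) stands for f^+_a(q^c t_i) and inr a for f_a[0]; a word for the
   product of its letters.  As f^+_a(z) only involves negative powers of z, a
   word only involves nonpositive powers of t_i, so that the sum over all m > 0
   reduces to m <= |k_i|. *)
Definition letter : Type := 'I_r * int * 'I_n + 'I_r.
Fixpoint word_ser (w : seq letter) (k : {ffun 'I_n -> int}) : U :=
  match w with
  | [::] => one_ser U k
  | inl (a, c, i) :: w' =>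
      \sum_(1 <= m < `|k i|%N.+1) q ^ (- (c * m%:Z)) *:
        (qa_cur X (CurX true a m%:Z) *
         word_ser w' [ffun j => k j + if j == i then m%:Z else 0])
  | inr a :: w' => qa_cur X (CurX true a 0) * word_ser w' k
  end.

Definition weight_den : {mpoly C[n]} :=
  \prod_(i < n) \prod_(j < n | (i < j)%N)
    ('X_i - (q ^ (- sl_form g (iota i) (iota j))) *: 'X_j).

(* msize Q = 1 + total degree of Q *)
Definition weight_property_at : Prop :=
  is_laurent weight_fun /\
  exists l : seq ({mpoly C[n]} * seq letter),
    all (fun c => msize c.1 == (n * n.-1)./2.+1) l /\
    (forall k, mulser weight_den weight_fun k =
               \sum_(c <- l) mulser c.1 (word_ser c.2) k).

(* I_s, enumerated increasingly by enum_val *)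
Definition block (s : 'I_r) : {set 'I_n} := [set i | iota i == s].

Definition shuffle_seq : seq 'I_n :=
  flatten [seq enum (block s) | s <- enum 'I_r].

Lemma shuffle_seq_perm : perm_eq shuffle_seq (enum 'I_n).
Proof.
apply/allP => i _ /=; apply/eqP.
rewrite [RHS]count_uniq_mem ?enum_uniq // mem_enum /= count_flatten -!map_comp.
rewrite sumnE big_map -enumT big_enum /= (bigD1 (iota i)) //=.
rewrite count_uniq_mem ?enum_uniq // mem_enum inE eqxx big1 // => s ns.
by rewrite count_uniq_mem ?enum_uniq // mem_enum inE eq_sym (negPf ns).
Qed.

Lemma shuffle_inj : injective (fun p : 'I_n => nth p shuffle_seq p).
Proof.
move=> p p' /=.
have sz : size shuffle_seq = n by rewrite (perm_size shuffle_seq_perm) size_enum_ord.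
rewrite (set_nth_default p) ?sz // => /eqP; rewrite nth_uniq ?sz //.
  by move=> /eqP/val_inj.
by rewrite (perm_uniq shuffle_seq_perm) enum_uniq.
Qed.

Definition shuffle : 'S_n := perm shuffle_inj.

Definition prefactor : ratfun C n :=
  ((-1) ^+ shuffle *
   \prod_(s < r) \prod_(i in block s) \prod_(j in block s | (i < j)%N)
     ((rvar C i)^-1 - (rvar C j)^-1)) /
  (\prod_i rvar C i *
   \prod_(i < n) \prod_(j < n | (i < j)%N)
     ((rvar C i)^-1
      - rconst n (q ^ (sl_form g (iota i) (iota j))) * (rvar C j)^-1)).

End Multiset.

Definition weight_property : Prop :=
  forall n (iota : 'I_n -> 'I_r), weight_property_at iota.

End Weight.

(* Index (s, j) of the variable u^(s)_j; it is numbered by enum_rank. *)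
Definition gvar r (nn : 'I_r -> nat) : finType := {s : 'I_r & 'I_(nn s)}.
Definition mkvar r (nn : 'I_r -> nat) s (j : 'I_(nn s)) : gvar nn :=
  Tagged (fun s => 'I_(nn s)) j.
Definition gratfun (C : fieldType) (V : vectType C) r (nn : 'I_r -> nat) :=
  vratfun #|{: gvar nn}| V.
Definition at_var (A : Type) r (nn : 'I_r -> nat) (x : gvar nn -> A)
    (i : 'I_#|{: gvar nn}|) : A := x (enum_val i).

(* Substitution of u^(s)_j by (t_i)^-1, i the j-th element of I_s. *)
Definition inv_vars (C : fieldType) r n (iota : 'I_n -> 'I_r) :
    gvar (fun s => #|block iota s|) -> ratfun C n :=
  fun x => (rvar C (enum_val (tagged x)))^-1.

Definition gsymmetric (C : fieldType) (V : vectType C) r (nn : 'I_r -> nat)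
    (G : gratfun V nn) : Prop :=
  forall tau : forall s, 'S_(nn s),
    map_mx (rsubst (at_var (fun x : gvar nn =>
      rvar C (enum_rank (mkvar (tau (tag x) (tagged x))))))) G = G.

Definition poles_in (C : fieldType) (V : vectType C) r (nn : 'I_r -> nat)
    (G : gratfun V nn) (S : 'I_r -> seq C) : Prop :=
  forall u : gvar nn -> C,
    (exists i, ~ exists c, has_value (G 0 i) (at_var u) c) ->
    exists s (j : 'I_(nn s)), u (mkvar j) \in S s.

(* The space H^{st}_{(k_1..k_m),l}; note (alpha_s, alpha_s) / 2 = d_s. *)
Definition in_H (C : fieldType) (q : C) r (g : simple_lie C r)
    (nn : 'I_r -> nat) (s t : 'I_r) m (k : 'I_m -> 'I_(nn s)) (l : 'I_(nn t))
    (u : gvar nn -> C) : Prop :=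
  forall i : 'I_m, u (mkvar l) =
    q ^ (- ((m%:Z - 1 - 2 * i%:Z) * (sl_d g (lift ord0 s))%:Z)) * u (mkvar (k i)).

Definition vanishes_on (C : fieldType) (V : vectType C) r (nn : 'I_r -> nat)
    (G : gratfun V nn) (H : (gvar nn -> C) -> Prop) : Prop :=
  forall u, H u -> forall i c, has_value (G 0 i) (at_var u) c -> c = 0.

Definition is_repr (C : fieldType) (U : algType C) (V : vectType C)
    (rho : {linear U -> 'End(V)}) : Prop :=
  rho 1 = \1%VF /\ forall x y, rho (x * y) = (rho x \o rho y)%VF.

Definition singular_generator (C : fieldType) (q : C) r (g : simple_lie C r)
    (U : algType C) (X : quantum_affine q g U) (V : vectType C)
    (rho : U -> 'End(V)) (v : V) : Prop :=
  [/\ forall i (n : nat), rho (qa_cur X (CurX false i n%:Z)) v = 0,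
      exists lambda : 'I_r -> nat -> C, forall i,
        lambda i 0%N != 0 /\
        forall n : nat, rho (psi q g (qa_cur X) false i n%:Z) v = lambda i n *: v
    & forall x : V, exists y : U, x = rho y v].

(* Main.v *)
Require Import Defs.
From HB Require Import structures.
From mathcomp Require Import all_boot all_order all_algebra all_fingroup.
From mathcomp Require Import fraction mpoly complex reals.
From mathcomp Require Import ssrcomplements zify ring.
From Stdlib Require Import Classical IndefiniteDescription FunctionalExtensionality.

Set Implicit Arguments.
Unset Strict Implicit.
Unset Printing Implicit Defensive.

Import GRing.Theory.
Local Open Scope ring_scope.

(** In the variables u_i = 1 / t_i, each order s of the variables gives a series
    w_s(k) = rho (P (f_{c x}[k_x] f_{c y}[k_y] ...)) v, with the product taken
    over the list s and c the map to the simple roots ([wser]).  Rational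
    functions are handled as series that a polynomial multiplies into a finite
    sum; [mulser] is the action of polynomials on series.

    Symmetry.  The exchange relation of the currents gives
    (u_x - q^(c x, c y) u_y) w_{..xy..} = - (u_y - q^(c x, c y) u_x) w_{..yx..},
    so that the product A_s of w_s by the forms u_x - q^(c x, c y) u_y, for x
    before y in s, changes sign when two neighbours are exchanged ([numer]).

    Support.  The kernel of P is a right ideal of U_F ([P_ker_mul]) and P
    kills f_a[m] for m <= 0, for m < 0 by the case n = 1 of the hypothesis.
    Hence only positive powers of the first variable of s occur in w_s, and by
    the symmetry only positive powers of all variables occur in A_s.

    Rationality.  By the hypothesis A_s is, up to a monomial, a combination of
    words in the f^+_a(q^k t_i) and f_a[0], with polynomial coefficients in the t_i.
    In End(V) the sequence f_a[m], m > 0, satisfies a linear recurrence, since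
    f_a[m + 1] is the image of f_a[m] under one linear map.  Hence there is a
    polynomial d in one variable, with d(0) = 1, such that the product of A_s
    and all d(u_i) is a polynomial ([wser_rational]).  It is divisible by every
    u_i, and by u_x - u_y if x and y have the same colour, because exchanging
    the labels x and y changes its sign.  The quotient N by these factors does
    not depend on s ([numer_factor]) and is determined by the series, hence it
    is symmetric, and compatible with every labelling of the variables.  The
    function in the theorem is N / \prod_i d(u_i), and its poles have some u_i
    among the roots of d.  Since k_a acts on w_s by a scalar that depends on the
    numbers n_b of variables of each colour, has finitely many eigenvalues, and
    the Cartan matrix is invertible, w_s vanishes unless all n_b are bounded
    ([weight_bound]): only finitely many d are needed.

    Zeros.  Let the nodes 0, ..., m - 1 be variables of colour s, and the node m
    one of colour t.  The Serre relation for the currents is a linear relation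
    between the w for the orders of the nodes, each followed by the remaining
    variables.  Multiply it by the d(u_i), by the forms of the pairs with a
    variable that is not a node, and by the forms u_a - q^(..) u_b of all
    ordered pairs of nodes but the cyclic pairs (i, i + 1) and (m, 0): these are
    the pairs whose form vanishes on the subspace H.  The term of an order now
    becomes a polynomial when multiplied by the forms of the cyclic pairs
    compatible with this order.  In every order but 0, ..., m, some i + 1 comes
    before i, hence no remaining pair leads out of {0, ..., i}, and the degree
    of the term in these variables is bounded ([zs_other]).  So the term of the order
    0, ..., m vanishes as soon as its degrees in {0}, {0, 1}, ..., {0, .., m - 1}
    are all large.  But it is the quotient of a polynomial p by the forms of the
    pairs (0, 1), ..., (m - 1, m), and far inside this cone the coefficients of
    such a quotient are those of a geometric series whose factor is the
    restriction of p to the common zeros of these forms ([cone_vanish]).  Hence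
    p vanishes on H, and so does N, as the other factors of p do not
    ([serre_vanish]). *)

(** * Polynomials and substitutions *)

Lemma mpoly_ring_ind (C : nzRingType) n (Q : {mpoly C[n]} -> Prop) :
  (forall c, Q c%:MP) -> (forall i, Q 'X_i) ->
  (forall p p', Q p -> Q p' -> Q (p + p')) ->
  (forall p p', Q p -> Q p' -> Q (p * p')) -> forall p, Q p.
Proof.
move=> QC QX QD QM p; elim/mpolyind: p => [|c m p _ _ IH].
  by rewrite -mpolyC0; apply: QC.
apply: (QD) => //; rewrite -mul_mpolyC; apply: (QM) => //.
rewrite mpolyXE_id; apply: (big_ind Q) => //; first by rewrite -mpolyC1; apply: QC.
move=> i _; elim: (m i) => [|e IHe]; first by rewrite expr0 -mpolyC1; apply: QC.
by rewrite exprS; apply: QM.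
Qed.

Definition msub (C : fieldType) n k (h : 'I_n -> {mpoly C[k]}) :
  {mpoly C[n]} -> {mpoly C[k]} := mmap (@mpolyC k C) h.

HB.instance Definition _ (C : fieldType) n k (h : 'I_n -> {mpoly C[k]}) :=
  GRing.RMorphism.copy (msub h) (mmap (@mpolyC k C) h).

Section Substitution.
Variables (C : fieldType).

Lemma msubC n k (h : 'I_n -> {mpoly C[k]}) c : msub h c%:MP = c%:MP.
Proof. by rewrite /msub mmapC. Qed.
Lemma msubX n k (h : 'I_n -> {mpoly C[k]}) i : msub h 'X_i = h i.
Proof. by rewrite /msub mmapX mmap1U. Qed.
Lemma msubZ n k (h : 'I_n -> {mpoly C[k]}) c p : msub h (c *: p) = c *: msub h p.
Proof. by rewrite /msub mmapZ mul_mpolyC. Qed.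

Lemma msub_comp n k l (h : 'I_n -> {mpoly C[k]}) (h' : 'I_k -> {mpoly C[l]}) p :
  msub h' (msub h p) = msub (fun i => msub h' (h i)) p.
Proof.
elim/mpoly_ring_ind: p => [c|i|p p' e e'|p p' e e'].
- by rewrite !msubC.
- by rewrite !msubX.
- by rewrite !rmorphD /= e e'.
- by rewrite !rmorphM /= e e'.
Qed.

Lemma eq_msub n k (h h' : 'I_n -> {mpoly C[k]}) : h =1 h' -> msub h =1 msub h'.
Proof.
move=> hh'; elim/mpoly_ring_ind => [c|i|p p' e e'|p p' e e'].
- by rewrite !msubC.
- by rewrite !msubX.
- by rewrite !rmorphD /= e e'.
- by rewrite !rmorphM /= e e'.
Qed.

Lemma meval_msub n k (h : 'I_n -> {mpoly C[k]}) p u : (msub h p).@[u] = p.@[fun i => (h i).@[u]].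
Proof.
elim/mpoly_ring_ind: p => [c|i|p p' e e'|p p' e e'].
- by rewrite !msubC !mevalC.
- by rewrite !msubX mevalXU.
- by rewrite !rmorphD /= e e'.
- by rewrite !rmorphM /= e e'.
Qed.

End Substitution.

Section Variables.
Variables (C : fieldType) (n : nat).

Lemma mX_neq0 (x : 'I_n) : 'X_x != 0 :> {mpoly C[n]}.
Proof. by rewrite -msize_poly_eq0 mmeasureX. Qed.

Lemma ZX_neq0 (a a' : C) (x y : 'I_n) : a != 0 -> x != y -> a *: 'X_x - a' *: 'X_y != 0 :> {mpoly C[n]}.
Proof.
move=> a0 nxy; apply/eqP => /(congr1 (mcoeff U_(x)%MM)) /eqP.
by rewrite mcoeffB !mcoeffZ !mcoeffXU eqxx (eq_sym y x) (negPf nxy) mulr1 mulr0 subr0 mcoeff0 (negPf a0).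
Qed.

Lemma mXB_neq0 (x y : 'I_n) : x != y -> 'X_x - 'X_y != 0 :> {mpoly C[n]}.
Proof. by move=> /(ZX_neq0 1 (oner_neq0 _)); rewrite !scale1r. Qed.

End Variables.

(** * Formal series and the action of polynomials on them *)

Notation ser n E := ({ffun 'I_n -> int} -> E).

(* These restate ffunE with all exponents at the type int, as lia expects. *)
Section Exponents.
Variables (n : nat).
Implicit Types (k l : {ffun 'I_n -> int}).
Lemma kaddE k l i : (k + l) i = k i + l i. Proof. by rewrite ffunE. Qed.
Lemma koppE k i : (- k) i = - k i. Proof. by rewrite ffunE. Qed.
Lemma kzeroE i : (0 : {ffun 'I_n -> int}) i = 0. Proof. by rewrite ffunE. Qed.
Lemma kfunE (f : 'I_n -> int) i : [ffun j => f j] i = f i. Proof. by rewrite ffunE. Qed.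
Definition mexp (m : 'X_{1..n}) : {ffun 'I_n -> int} := [ffun i => (m i)%:Z].
Definition uexp (i : 'I_n) : {ffun 'I_n -> int} := [ffun j => (j == i)%:Z].
Lemma mexpE m i : mexp m i = (m i)%:Z. Proof. by rewrite ffunE. Qed.
Lemma uexpE i j : uexp i j = (j == i)%:Z. Proof. by rewrite ffunE. Qed.
Lemma kextP k l : (forall i, k i = l i) <-> k = l.
Proof. by split=> [e|->//]; apply/ffunP => i; apply: e. Qed.
Definition kE := (kaddE, koppE, kzeroE, mexpE, uexpE, kfunE).
End Exponents.

Section Action.
Variables (C : fieldType) (n : nat).
Implicit Types (p : {mpoly C[n]}) (k : {ffun 'I_n -> int}).

Lemma mexpD (m m' : 'X_{1..n}) : mexp (m + m') = mexp m + mexp m'.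
Proof. by apply/kextP=> i; rewrite !kE mnmDE PoszD. Qed.
Lemma mexp0 : mexp (0%MM : 'X_{1..n}) = 0.
Proof. by apply/kextP=> i; rewrite !kE mnm0E. Qed.
Lemma mexpU (i : 'I_n) : mexp U_(i)%MM = uexp i.
Proof. by apply/kextP=> j; rewrite !kE mnm1E eq_sym. Qed.
Lemma mexp_inj : injective (@mexp n).
Proof.
move=> m m' /kextP e; apply/mnmP => i; move: (e i); rewrite !kE.
by case.
Qed.

Section Module.
Variable E : lmodType C.
Implicit Types s : ser n E.

(** A range of summation independent of p shows that the action is linear in p. *)
Lemma mulserwE K p s k : (msize p <= K)%N ->
  mulser p s k = \sum_(m : 'X_{1..n < K}) p@_m *: s (k - mexp m).
Proof.
move=> lepK; rewrite /mulser; pose I : subFinType _ := 'X_{1..n < K}.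
rewrite (big_mksub I) //=; last 2 first.
  - by rewrite msupp_uniq.
  - by move=> x /msize_mdeg_lt /leq_trans; apply.
by rewrite big_rmcond //= => i; move/memN_msupp_eq0 ->; rewrite scale0r.
Qed.

Lemma mulser_lin a p p' s k :
  mulser (a *: p + p') s k = a *: mulser p s k + mulser p' s k.
Proof.
pose K := maxn (msize (a *: p + p')) (maxn (msize p) (msize p')).
rewrite !(@mulserwE K) ?leq_max ?leqnn ?orbT // scaler_sumr -big_split /=.
by apply: eq_bigr => m _; rewrite mcoeffD mcoeffZ scalerDl scalerA.
Qed.

Lemma mulserDp p p' s k : mulser (p + p') s k = mulser p s k + mulser p' s k.
Proof. by rewrite -[p in LHS]scale1r mulser_lin scale1r. Qed.

Lemma mulserXm m s k : mulser 'X_[m] s k = s (k - mexp m).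
Proof. by rewrite /mulser msuppX big_seq1 mcoeffX eqxx scale1r. Qed.

Lemma mulser0p s k : mulser 0 s k = 0.
Proof. by rewrite /mulser msupp0 big_nil. Qed.

Lemma mulserZp a p s k : mulser (a *: p) s k = a *: mulser p s k.
Proof. by rewrite -[a *: p]addr0 mulser_lin mulser0p addr0. Qed.

Lemma mulserNp p s k : mulser (- p) s k = - mulser p s k.
Proof. by rewrite -!scaleN1r mulserZp. Qed.

Lemma mulserCp c s k : mulser c%:MP s k = c *: s k.
Proof.
by rewrite -[c%:MP]mulr1 mul_mpolyC mulserZp -mpolyX0 mulserXm mexp0 subr0.
Qed.

Lemma mulser1p s k : mulser 1 s k = s k.
Proof. by rewrite -mpolyC1 mulserCp scale1r. Qed.

Lemma mulserX i s k : mulser 'X_i s k = s (k - uexp i).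
Proof. by rewrite mulserXm mexpU. Qed.

Lemma eq_mulser p s s' : s =1 s' -> mulser p s =1 mulser p s'.
Proof. by move=> e k; apply: eq_bigr => m _; rewrite e. Qed.

Lemma mulser0s p s k : (forall k, s k = 0) -> mulser p s k = 0.
Proof. by move=> s0; rewrite /mulser big1 // => m _; rewrite s0 scaler0. Qed.

Lemma mulserZs a p s k : mulser p (fun k => a *: s k) k = a *: mulser p s k.
Proof.
by rewrite /mulser scaler_sumr; apply: eq_bigr => m _; rewrite !scalerA mulrC.
Qed.

Lemma mulserDs p s s' k :
  mulser p (fun k => s k + s' k) k = mulser p s k + mulser p s' k.
Proof.
by rewrite /mulser -big_split; apply: eq_bigr => m _; rewrite scalerDr.
Qed.

Lemma mulserNs p s k : mulser p (fun k => - s k) k = - mulser p s k.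
Proof.
by rewrite -scaleN1r -mulserZs; apply: eq_mulser => l; rewrite scaleN1r.
Qed.

Lemma mulser_sum I (r : seq I) (a : I -> C) (s : I -> ser n E) p k :
  mulser p (fun k => \sum_(i <- r) a i *: s i k) k =
  \sum_(i <- r) a i *: mulser p (s i) k.
Proof.
rewrite /mulser; under eq_bigr do rewrite scaler_sumr.
rewrite exchange_big; apply: eq_bigr => i _ /=; rewrite scaler_sumr.
by apply: eq_bigr => m _; rewrite !scalerA mulrC.
Qed.

Lemma mulser_shift p s l k :
  mulser p (fun k => s (k + l)) k = mulser p s (k + l).
Proof. by apply: eq_bigr => m _; rewrite addrAC. Qed.

Lemma mulserM p p' s k : mulser (p * p') s k = mulser p (mulser p' s) k.
Proof.
elim/mpolyind: p k => [|c m p _ _ IH] k; first by rewrite mul0r !mulser0p.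
rewrite mulrDl mulserDp -scalerAl mulserZp mulser_lin IH; congr (_ *: _ + _).
rewrite mulserXm; elim/mpolyind: p' {IH} k => [|c' m' p' _ _ IH] k.
  by rewrite mulr0 !mulser0p.
rewrite mulrDr mulserDp -scalerAr mulserZp mulser_lin IH -mpolyXD !mulserXm.
by rewrite mexpD opprD addrA.
Qed.

End Module.

Lemma mulser_map (E E' : lmodType C) (f : E -> E') p (s : ser n E) k :
  (forall a x y, f (a *: x + y) = a *: f x + f y) ->
  mulser p (fun k => f (s k)) k = f (mulser p s k).
Proof.
move=> flin.
have f0 : f 0 = 0.
  by have := flin (-1) 0 0; rewrite scaler0 addr0 scaleN1r addNr.
have fD x y : f (x + y) = f x + f y by have := flin 1 x y; rewrite !scale1r.
have fZ a x : f (a *: x) = a *: f x.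
  by have := flin a x 0; rewrite !addr0 f0 addr0.
by rewrite /mulser (big_morph f fD f0); apply: eq_bigr => m _; rewrite fZ.
Qed.

(** ** Finitely supported series *)

Definition toser p : ser n C^o := mulser p (one_ser C^o).

Lemma toserE p m : toser p (mexp m) = p@_m.
Proof.
rewrite /toser; elim/mpolyind: p => [|c m' p _ _ IH].
  by rewrite mulser0p mcoeff0.
rewrite mulser_lin IH mcoeffD mcoeffZ mcoeffX mulserXm /one_ser subr_eq0.
by rewrite (inj_eq mexp_inj) eq_sym.
Qed.

Lemma toser_neg p k i : (k i < 0)%O -> toser p k = 0.
Proof.
move=> ki; rewrite /toser /mulser big1 // => m _.
rewrite /one_ser; case: eqP => [/kextP/(_ i)|]; last by rewrite scaler0.
rewrite !kE => e; move: ki; lia.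
Qed.

Lemma toser_inj p p' : toser p =1 toser p' -> p = p'.
Proof. by move=> e; apply/mpolyP => m; rewrite -!toserE. Qed.

Lemma toserM p p' : toser (p * p') =1 mulser p (toser p').
Proof. exact: mulserM. Qed.

(** In other words, s has finitely many terms. *)
Definition bounded (E : nmodType) (s : ser n E) :=
  exists b : nat, forall k i, (b < `|k i|)%N -> s k = 0.

Lemma bounded_toser p : bounded (toser p).
Proof.
exists (msize p) => k i ki; rewrite /toser /mulser big_seq big1 // => m mp.
rewrite /one_ser; case: eqP => [/kextP/(_ i)|]; last by rewrite scaler0.
have := msize_mdeg_lt mp; rewrite mdegE (bigD1 i) //= !kE => lt e.
by move: ki lt; lia.
Qed.

Lemma bounded_shift (E : nmodType) (s : ser n E) l :
  bounded s -> bounded (fun k => s (k + l)).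
Proof.
case=> b bs; exists (b + \sum_i `|l i|)%N => k i; rewrite (bigD1 i) //= => h.
by apply: (bs _ i); rewrite kE; lia.
Qed.

Lemma bounded_comb (E : lmodType C) I (r : seq I) (a : I -> C) (s : I -> ser n E) :
  (forall i, bounded (s i)) -> bounded (fun k => \sum_(i <- r) a i *: s i k).
Proof.
move=> bs; elim: r => [|i r [b IH]]; first by exists 0%N => k i; rewrite big_nil.
case: (bs i) => b' b'P; exists (maxn b b') => k j; rewrite gtn_max => /andP[lt lt'].
by rewrite big_cons (IH _ j) // (b'P _ j) // scaler0 addr0.
Qed.

Lemma eq_bounded (E : nmodType) (s s' : ser n E) : s =1 s' -> bounded s -> bounded s'.
Proof. by move=> e [b bP]; exists b => k i h; rewrite -e (bP _ i). Qed.

Lemma bounded_mulser (E : lmodType C) p (s : ser n E) : bounded s -> bounded (mulser p s).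
Proof.
by move=> bs; apply: bounded_comb => m; apply: bounded_shift.
Qed.

Lemma bounded_poly (s : ser n C^o) :
  bounded s -> (forall k i, (k i < 0)%O -> s k = 0) -> exists p, s =1 toser p.
Proof.
move=> [b bP] sneg; pose K := (n * b).+1.
exists (\sum_(m : 'X_{1..n < K}) (s (mexp m) : C) *: 'X_[m]) => k.
have [/existsP[i ki]|/existsPn kp] := boolP [exists i, (k i < 0)%O].
  by rewrite (toser_neg _ ki) (sneg _ i).
pose m := [multinom `|k i|%N | i < n].
have km : k = mexp m.
  apply/kextP => i; rewrite kE mnmE; move: (kp i); lia.
rewrite km toserE.
have [mK|mK] := ltnP (mdeg m) K; first by rewrite (@mcoeff_mpoly _ _ (fun m => s (mexp m))).
have [i hi] : exists i, (b < m i)%N.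
  have [/existsP//|/existsPn h] := boolP [exists i, (b < m i)%N]; exfalso; move: mK; rewrite /K ltnNge mdegE.
  have -> : (\sum_i m i <= n * b)%N.
    rewrite -[X in (X * _)%N]card_ord -sum_nat_const; apply: leq_sum => i _.
    by rewrite leqNgt h.
  by [].
rewrite (bP _ i) ?kE ?absz_nat // raddf_sum big1 // => m' _ /=.
rewrite mcoeffZ mcoeffX; case: eqP => [e|]; last by rewrite mulr0.
by move: (bmdeg m'); rewrite e ltnNge mK.
Qed.

End Action.

(** ** Renaming the variables *)

Section Rename.
Variables (C : fieldType) (n n' : nat) (f : 'I_n -> 'I_n').

Definition rename : {mpoly C[n]} -> {mpoly C[n']} := msub (fun i => 'X_(f i)).

HB.instance Definition _ := GRing.RMorphism.copy rename (msub (fun i => 'X_(f i))).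

Lemma renameX i : rename 'X_i = 'X_(f i).
Proof. exact: msubX. Qed.
Lemma renameZ c p : rename (c *: p) = c *: rename p.
Proof. exact: msubZ. Qed.

Definition kcomp (k : {ffun 'I_n' -> int}) : {ffun 'I_n -> int} := [ffun i => k (f i)].

Lemma mulser_rename (E : lmodType C) p (s : ser n E) (s' : ser n' E) :
  injective f -> (forall k, s' k = s (kcomp k)) ->
  forall k, mulser (rename p) s' k = mulser p s (kcomp k).
Proof.
move=> finj; elim/mpoly_ring_ind: p s s' => [c|i|p p' IH IH'|p p' IH IH'] s s' ss' k.
- by rewrite /rename msubC !mulserCp ss'.
- rewrite renameX !mulserX ss'; congr s; apply/kextP => j.
  by rewrite !kE (inj_eq finj).
- by rewrite rmorphD !mulserDp; congr (_ + _); [apply: IH | apply: IH'].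
- rewrite rmorphM !mulserM; apply: IH => k'; exact: IH'.
Qed.

End Rename.

Lemma toser_rename (C : fieldType) n n' (f : 'I_n -> 'I_n') (p : {mpoly C[n]}) :
  bijective f -> forall k, toser (rename f p) k = toser p (kcomp f k).
Proof.
move=> fb; apply: mulser_rename; first exact: bij_inj.
move=> k; rewrite /one_ser; congr (_%:R : C); congr (_ : nat); congr nat_of_bool.
case: fb => h fK hK; apply/eqP/eqP => [->|/kextP e].
  by apply/kextP => i; rewrite !kE.
by apply/kextP => i; have := e (h i); rewrite !kE hK.
Qed.

(** * Products over the ordered pairs of a list, and alternating functions *)

Section PairProd.
Variables (T : eqType) (R : comNzRingType) (l : T -> T -> R).

Fixpoint pairprod (s : seq T) : R :=
  if s is x :: s' then (\prod_(y <- s') l x y) * pairprod s' else 1.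

Lemma pairprod_cat s1 s2 :
  pairprod (s1 ++ s2) = pairprod s1 * pairprod s2 * \prod_(x <- s1) \prod_(y <- s2) l x y.
Proof.
elim: s1 => [|x s1 IH] /=; first by rewrite big_nil mul1r mulr1.
by rewrite IH big_cons big_cat /=; ring.
Qed.

(** Every other pair stands in the same order in both lists. *)
Lemma pairprod_swap s1 x y s2 : exists p,
  pairprod (s1 ++ x :: y :: s2) = p * l x y /\ pairprod (s1 ++ y :: x :: s2) = p * l y x.
Proof.
have inner a b : \prod_(i <- s1) \prod_(j <- a :: b :: s2) l i j =
    \prod_(i <- s1) (l i a * (l i b * \prod_(j <- s2) l i j)).
  by apply: eq_bigr => i _; rewrite !big_cons.
rewrite !pairprod_cat !inner /= !big_cons.
exists (pairprod s1 * (\prod_(j <- s2) l x j) * (\prod_(j <- s2) l y j) * pairprod s2 *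
  \prod_(i <- s1) (l i x * (l i y * \prod_(j <- s2) l i j))).
split; first by ring.
have -> : \prod_(i <- s1) (l i y * (l i x * \prod_(j <- s2) l i j)) =
    \prod_(i <- s1) (l i x * (l i y * \prod_(j <- s2) l i j)).
  by apply: eq_bigr => i _; ring.
by ring.
Qed.

Lemma pairprod_index s : uniq s ->
  pairprod s = \prod_(x <- s) \prod_(y <- s | (index x s < index y s)%N) l x y.
Proof.
elim: s => [|x s IH] /=; first by rewrite big_nil.
move=> /andP[xs us]; rewrite !big_cons /= eqxx /=; congr (_ * _).
  rewrite big_seq [RHS]big_seq_cond; apply: eq_bigl => y.
  by case: (boolP (y \in s)) => //= ys; case: eqP xs => // ->; rewrite ys.
rewrite IH // big_seq [RHS]big_seq; apply: eq_bigr => y ys.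
rewrite big_cons /= eqxx /= ?ltn0.
have /negPf-> : x != y by apply: contraNneq xs => ->.
rewrite big_seq_cond [RHS]big_seq_cond; apply: eq_bigl => z.
have [zs|//] := boolP (z \in s); have /negPf-> : x != z by apply: contraNneq xs => ->.
by rewrite ltnS.
Qed.

End PairProd.

Lemma pairprod_map (T T' : eqType) (R : comNzRingType) (f : T -> T') l s :
  pairprod l (map f s) = pairprod (fun x y => l (f x) (f y)) s :> R.
Proof. by elim: s => //= x s ->; rewrite big_map. Qed.

Lemma rmorph_pairprod (T : eqType) (R R' : comNzRingType) (f : {rmorphism R -> R'}) l s :
  f (pairprod l s) = pairprod (fun x y : T => f (l x y)) s.
Proof. by elim: s => [|x s IH] /=; rewrite ?rmorph1 // rmorphM rmorph_prod IH. Qed.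

Lemma eq_pairprod (T : eqType) (R : comNzRingType) (l l' : T -> T -> R) s :
  (forall x y, l x y = l' x y) -> pairprod l s = pairprod l' s.
Proof.
by move=> e; elim: s => //= x s ->; congr (_ * _); apply: eq_bigr => y _.
Qed.

Lemma pairprod_enum (R : comNzRingType) n (l : 'I_n -> 'I_n -> R) :
  pairprod l (enum 'I_n) = \prod_(i < n) \prod_(j < n | (i < j)%N) l i j.
Proof.
rewrite pairprod_index ?enum_uniq // big_enum; apply: eq_bigr => i _.
by rewrite big_enum_cond; apply: eq_bigl => j; rewrite !index_enum_ord.
Qed.

Lemma pairprod_neq0 (T : eqType) (R : idomainType) (l : T -> T -> R) (z : seq T) :
  uniq z -> (forall x y, x != y -> l x y != 0) -> pairprod l z != 0.
Proof.
move=> + h; elim: z => [|x z IH] /=; first by rewrite oner_eq0.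
move=> /andP[xz /IH]; rewrite mulf_eq0 negb_or => ->; rewrite andbT prodf_seq_neq0.
by apply/allP => y yz /=; apply: h; apply: contraNneq xz => ->.
Qed.

(** Exchanges of neighbours generate all permutations. *)
Lemma swap_ind (T : eqType) (Q : seq T -> Prop) :
  (forall s1 x y s2, Q (s1 ++ x :: y :: s2) -> Q (s1 ++ y :: x :: s2)) ->
  forall s s', perm_eq s s' -> Q s -> Q s'.
Proof.
move=> swp; suff H s0 s s' : perm_eq s s' -> Q (s0 ++ s) -> Q (s0 ++ s').
  exact: (H [::]).
elim: s s' s0 => [|x s IH] s' s0; first by rewrite perm_sym => /perm_nilP->.
move=> e; have xs' : x \in s' by rewrite -(perm_mem e) mem_head.
case/splitPr: xs' e => a b e; have {}e : perm_eq s (a ++ b).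
  by apply/seq.permP => p; have /seq.permP/(_ p) := e; rewrite !count_cat /=; lia.
rewrite -cat_rcons => /(IH _ _ e); rewrite cat_rcons.
elim/last_ind: a b {e} => // a y IHa b; rewrite -cats1 -!catA /= => h.
by rewrite catA; apply: swp; rewrite -catA; apply: IHa.
Qed.

Section Alternating.
Variables (T : finType) (R : pzRingType) (F : seq T -> R).
Hypothesis Falt : forall s1 x y s2, uniq (s1 ++ x :: y :: s2) ->
  F (s1 ++ x :: y :: s2) = - F (s1 ++ y :: x :: s2).

(** With m of length l, this takes 2 l + 1 exchanges of neighbours. *)
Lemma alt_far s1 x m y s2 : uniq (s1 ++ x :: m ++ y :: s2) ->
  F (s1 ++ x :: m ++ y :: s2) = - F (s1 ++ y :: m ++ x :: s2).
Proof.
elim: m s1 x => [|z m IH] s1 x /= u; first by rewrite Falt.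
have p1 : perm_eq (s1 ++ [:: x, z & m ++ y :: s2]) (s1 ++ [:: z, x & m ++ y :: s2]).
  by apply/seq.permP => p; rewrite !count_cat /= ; lia.
have p2 : perm_eq (s1 ++ [:: x, z & m ++ y :: s2]) (s1 ++ [:: z, y & m ++ x :: s2]).
  by apply/seq.permP => p; rewrite !count_cat /= !count_cat /=; lia.
rewrite Falt // -[z :: x :: _]/([:: z] ++ x :: m ++ y :: s2) catA IH; last first.
  by rewrite -catA /= -(perm_uniq p1).
by rewrite -catA /= opprK Falt // -(perm_uniq p2).
Qed.

Lemma alt_tperm x y s : x != y -> uniq s -> x \in s -> y \in s ->
  F (map (tperm x y) s) = - F s.
Proof.
move=> nxy us; wlog : x y nxy / (index x s < index y s)%N.
  move=> H xs ys; case: (ltngtP (index x s) (index y s)) => h; first exact: H.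
    by rewrite tpermC H // eq_sym.
  by have := nxy; rewrite -(nth_index x xs) h nth_index // eqxx.
move=> lxy xs; case/splitPr: xs us lxy => s1 s2 us lxy ys.
have xs1 : x \notin s1 by move: us; rewrite cat_uniq /= => /and3P[_ /norP[]].
have ys1 : y \notin s1.
  apply: contraTN lxy => ys1; rewrite !index_cat ys1 (negPf xs1) -leqNgt.
  by rewrite (leq_trans (index_size _ _)) // leq_addr.
move: ys; rewrite mem_cat (negPf ys1) inE eq_sym (negPf nxy) /= => ys2.
case/splitPr: ys2 us {lxy} => m s2' us.
have xyr z : z \in s1 ++ m ++ s2' -> tperm x y z = z.
  have : uniq (x :: y :: s1 ++ m ++ s2').
    by rewrite -(perm_uniq (s1 := s1 ++ x :: m ++ y :: s2')) //;
       apply/seq.permP => P; rewrite /= !count_cat /= !count_cat /=; lia.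
  rewrite /= inE => /and3P[/norP[_ h1] h2 _] zs.
  by rewrite tpermD //; [apply: contraNneq h1 => -> | apply: contraNneq h2 => ->].
have id3 t : {subset t <= s1 ++ m ++ s2'} -> map (tperm x y) t = t.
  by move=> ts; rewrite -[RHS]map_id; apply/eq_in_map => z /ts/xyr.
rewrite map_cat /= map_cat /= tpermL tpermR !id3; first by rewrite [in RHS]alt_far // opprK.
- by move=> z zs; rewrite !mem_cat zs !orbT.
- by move=> z zs; rewrite !mem_cat zs !orbT.
- by move=> z zs; rewrite !mem_cat zs.
Qed.

Lemma alt_perm (sg : {perm T}) s : uniq s -> (forall x, x \in s) ->
  F (map sg s) = (-1) ^+ sg * F s.
Proof.
have [ts -> /allP dts] := prod_tpermP sg.
elim: ts dts s => [|t ts IH] dts s us fs.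
  by rewrite big_nil odd_perm1 mul1r (eq_map (g := id)) ?map_id // => x; rewrite perm1.
have /= dt : dpair t by apply: dts; rewrite mem_head.
rewrite big_cons odd_permM odd_tperm dt signr_addb -mulrA.
rewrite (eq_map (g := (\prod_(t0 <- ts) tperm t0.1 t0.2)%g \o tperm t.1 t.2)); last first.
  by move=> x; rewrite /= permM.
rewrite map_comp IH.
- by rewrite alt_tperm // mulrN expr1 mulN1r.
- by move=> t' t'ts; apply: dts; rewrite inE t'ts orbT.
- by rewrite map_inj_uniq //; apply: perm_inj.
- by move=> x; rewrite -[x](permKV (tperm t.1 t.2)) map_f.
Qed.

End Alternating.

(** * Divisibility by linear forms *)

Section Elim.
Variables (C : fieldType) (n : nat).
Implicit Types (p f : {mpoly C[n]}).

Definition elim1 (x : 'I_n) f : {mpoly C[n]} -> {mpoly C[n]} :=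
  msub (fun i => if i == x then f else 'X_i).

Lemma elim1X x f y : elim1 x f 'X_y = if y == x then f else 'X_y.
Proof. exact: msubX. Qed.

Lemma sub_elim1 x f p : exists p', p - elim1 x f p = ('X_x - f) * p'.
Proof.
elim/mpoly_ring_ind: p => [c|i|p p' [e E] [e' E']|p p' [e E] [e' E']].
- by exists 0; rewrite /elim1 msubC subrr mulr0.
- rewrite elim1X; case: eqP => [->|_]; first by exists 1; rewrite mulr1.
  by exists 0; rewrite subrr mulr0.
- by exists (e + e'); rewrite mulrDr -E -E' /elim1 rmorphD /=; ring.
- exists (p * e' + elim1 x f p' * e).
  rewrite mulrDr !(mulrCA ('X_x - f)) -E -E' /elim1 rmorphM /=; ring.
Qed.

Lemma dvd_elim1 x f p : elim1 x f p = 0 -> exists p', p = ('X_x - f) * p'.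
Proof. by move=> e; have [p' E] := sub_elim1 x f p; exists p'; rewrite -E e subr0. Qed.

(** A factor 'X_(x i) - f i that divides p still divides the quotient of p by the
    other factors, because it divides none of them. *)
Lemma dvd_prod_elim1 (I : eqType) (s : seq I) (x : I -> 'I_n) (f : I -> {mpoly C[n]}) p :
  uniq s ->
  {in s &, forall i j, i != j -> elim1 (x i) (f i) ('X_(x j) - f j) != 0} ->
  {in s, forall i, elim1 (x i) (f i) p = 0} ->
  exists p', p = (\prod_(i <- s) ('X_(x i) - f i)) * p'.
Proof.
elim: s => [|i s IH] /=; first by exists p; rewrite big_nil mul1r.
move=> /andP[is_ us] nz pz; have [p' pE] : exists p', p = (\prod_(i <- s) ('X_(x i) - f i)) * p'.
  apply: IH => // [j k js ks|j js]; first by apply: nz; rewrite inE ?js ?ks orbT.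
  by apply: pz; rewrite inE js orbT.
have /eqP := pz i (mem_head _ _).
rewrite pE /elim1 rmorphM rmorph_prod mulf_eq0 => /orP[|/eqP/dvd_elim1[p'' ->]].
  rewrite prodf_seq_eq0 => /hasP[j js] /=; rewrite (negPf (nz i j _ _ _)) ?mem_head //.
    by rewrite inE js orbT.
  by apply: contraNneq is_ => ->.
by exists p''; rewrite big_cons; ring.
Qed.

End Elim.

(** * Directional finiteness *)

Section Fin.
Variables (C : fieldType) (n : nat).
Implicit Types (p : {mpoly C[n]}) (s : ser n C^o) (k : {ffun 'I_n -> int}).

(** This holds for expansions in powers of X_x / X_y, and makes the product with
    X_x - c X_y injective. *)
Definition dirfin (x y : 'I_n) s :=
  forall k, exists N, forall j, (N <= j)%N -> s (k + (uexp y - uexp x) *+ j) = 0.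

Lemma dirfin_shift x y s l : dirfin x y s -> dirfin x y (fun k => s (k + l)).
Proof. by move=> h k; have [N hN] := h (k + l); exists N => j jN; rewrite addrAC hN. Qed.

Lemma dirfinZ x y s a : dirfin x y s -> dirfin x y (fun k => a * s k).
Proof. by move=> h k; have [N hN] := h k; exists N => j jN; rewrite hN ?mulr0. Qed.

Lemma dirfinB x y s s' : dirfin x y s -> dirfin x y s' -> dirfin x y (fun k => s k - s' k).
Proof.
move=> h h' k; have [N hN] := h k; have [N' hN'] := h' k.
exists (maxn N N') => j; rewrite geq_max => /andP[jN jN'].
by rewrite hN // hN' // subrr.
Qed.

Lemma dirfin_mulser x y p s : dirfin x y s -> dirfin x y (mulser p s).
Proof.
move=> h k; rewrite /mulser; elim: (msupp p) => [|m r [N hN]].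
  by exists 0%N => j _; rewrite big_nil.
have [N' hN'] := h (k - mexp m); exists (maxn N N') => j; rewrite geq_max => /andP[jN jN'].
by rewrite big_cons hN // addr0 addrAC hN' // scaler0.
Qed.

Lemma raisE x y j i :
  ((uexp y - uexp x) *+ j : {ffun 'I_n -> int}) i = ((i == y)%:Z - (i == x)%:Z) * j%:Z.
Proof. by rewrite ffunMnE kaddE koppE !uexpE pmulrn mulrzz. Qed.

Lemma dirfin_bounded x y s : x != y -> bounded s -> dirfin x y s.
Proof.
move=> nxy [b bs] k; exists (b + `|k x| + 1)%N => j hj; apply: (bs _ x).
by rewrite kaddE raisE eqxx (negPf nxy) /=; lia.
Qed.

Definition linform (t : 'I_n * 'I_n * C) : {mpoly C[n]} := 'X_t.1.1 - t.2 *: 'X_t.1.2.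

Lemma mulser_linform (E : lmodType C) x y c (s : ser n E) k :
  mulser (linform (x, y, c)) s k = s (k - uexp x) - c *: s (k - uexp y).
Proof. by rewrite mulserDp mulserNp mulserZp !mulserX. Qed.

(** Each coefficient of s on a ray in Z determines the one before it, and those
    far out vanish. *)
Lemma peel_zero x y c s (Z : {ffun 'I_n -> int} -> Prop) : c != 0 -> dirfin x y s ->
  (forall k, Z k -> Z (k + (uexp y - uexp x))) ->
  (forall k, Z k -> mulser (linform (x, y, c)) s (k + uexp y) = 0) ->
  forall k, Z k -> s k = 0.
Proof.
move=> c0 fs Zv Z0 k Zk; have [N hN] := fs k; have := hN N (leqnn N).
clear hN; elim: N k Zk => [|N IH] k Zk; first by rewrite mulr0n addr0.
rewrite mulrS addrA => /(IH _ (Zv _ Zk)) e; have /eqP := Z0 k Zk.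
rewrite mulser_linform addrK -addrA e sub0r oppr_eq0 scaler_eq0 (negPf c0) /=.
by move/eqP.
Qed.

Definition degin (K : {pred 'I_n}) k : int := \sum_(i in K) k i.

Lemma deginD K k l : degin K (k + l) = degin K k + degin K l.
Proof. by rewrite /degin -big_split; apply: eq_bigr => i _; rewrite kaddE. Qed.
Lemma deginN K k : degin K (- k) = - degin K k.
Proof. by rewrite /degin -sumrN; apply: eq_bigr => i _; rewrite koppE. Qed.
Lemma deginU K i : degin K (uexp i) = (i \in K)%:Z.
Proof.
rewrite /degin; have [iK|iK] := boolP (i \in K).
  rewrite (bigD1 i) //= uexpE eqxx big1 ?addr0 // => j /andP[_ /negPf ji].
  by rewrite uexpE ji.
by rewrite big1 // => j jK; rewrite uexpE; case: eqP jK iK => // -> ->.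
Qed.

Lemma bounded_degin K s : bounded s -> exists B : int, forall k, (B < degin K k)%O -> s k = 0.
Proof.
move=> [b bs]; exists (n * b)%:Z => k hk; have [i hi] : exists i, (b < `|k i|)%N; last exact: bs hi.
have [/existsP//|/existsPn h] := boolP [exists i, (b < `|k i|)%N]; exfalso.
move: hk; rewrite /degin => hk.
have h1 : (\sum_(i in K) k i <= \sum_(i in K) b%:Z)%R.
  by apply: Num.Theory.ler_sum => i _; move: (h i); lia.
have := max_card K; rewrite card_ord; move: h1; rewrite sumr_const -mulr_natr natz => h1 /(leq_mul (leqnn b)).
by move: hk h1; set S := \sum_(i in K) _; rewrite -PoszM; lia.
Qed.

(** The quotient by X_x - c X_y is a series in X_x / X_y, so that the division
    does not raise the degree in K if X_y is in K whenever X_x is. *)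
Lemma peel_list (ts : seq ('I_n * 'I_n * C)) (K : {pred 'I_n}) B s :
  (forall t, t \in ts -> [/\ t.2 != 0, dirfin t.1.1 t.1.2 s & (t.1.1 \in K -> t.1.2 \in K)]) ->
  (forall k, (B < degin K k)%O -> mulser (\prod_(t <- ts) linform t) s k = 0) ->
  forall k, (B < degin K k)%O -> s k = 0.
Proof.
elim: ts => [|[[x y] c] ts IH] hts hs; first by move=> k hk; rewrite -(hs k hk) big_nil mulser1p.
have [|c0 fs xyK] := hts (x, y, c); first by rewrite mem_head.
apply: IH => [t tts|]; first by apply: hts; rewrite inE tts orbT.
apply: (@peel_zero x y c _ (fun k => (B < degin K k)%O)) => //.
- exact: dirfin_mulser.
- move=> k; rewrite !deginD deginN !deginU; move: xyK => /=.
  by case: (x \in K) (y \in K) => -[] // => [_|/(_ isT)//|_|_]; lia.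
- move=> k hk; rewrite -mulserM; move: (hs (k + uexp y)); rewrite big_cons; apply.
  by move: hk; rewrite deginD deginU; case: (y \in K); lia.
Qed.

(** ** Vanishing in the cone forces vanishing on the subspace *)

Lemma toser_elim1 x y c p k : x != y -> k x != 0 -> toser (elim1 x (c *: 'X_y) p) k = 0.
Proof.
move=> nxy; rewrite /toser.
have o0 k' : k' x != 0 -> one_ser C^o k' = 0 :> C.
  by rewrite /one_ser; case: (k' =P 0) => [->|_ _]; rewrite ?kzeroE ?eqxx.
elim/mpoly_ring_ind: p (one_ser C^o) o0 k => [a|i|p p' e e'|p p' e e'] s s0 k kx.
- by rewrite /elim1 msubC mulserCp s0 ?scaler0.
- rewrite elim1X; case: eqP => [_|/eqP ix].
    by rewrite mulserZp mulserX s0 ?scaler0 // !kE (negPf nxy) subr0.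
  by rewrite mulserX s0 // !kE (eq_sym x i) (negPf ix) subr0.
- by rewrite /elim1 rmorphD mulserDp e // e' // addr0.
- by rewrite /elim1 rmorphM mulserM e // => k' k'x; apply: e'.
Qed.

(** The coefficients of r / (X_x - c X_y) in the direction of X_x / X_y form a
    geometric progression, since r does not involve X_x. *)
Lemma line_solve x y c s r : x != y -> c != 0 -> dirfin x y s ->
  mulser (linform (x, y, c)) s =1 r -> (forall k, k x != 0 -> r k = 0) ->
  forall j k, k x = 0 -> s (k + (uexp x - uexp y) *+ j - uexp y) = - (c ^- j.+1 * r k).
Proof.
move=> nxy c0 fs e r0; elim=> [|j IH] k kx.
  have := e k; rewrite mulser_linform mulr0n addr0 (_ : s (k - uexp x) = 0).
    by move=> <-; rewrite expr1 sub0r mulrN opprK /GRing.scale /= mulKf.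
  apply: (@peel_zero x y c _ (fun k => (k x < 0)%O)) => //.
  - by move=> k'; rewrite !kE eqxx (negPf nxy); lia.
  - by move=> k' h; rewrite e r0 // !kE (negPf nxy); lia.
  - by rewrite !kE eqxx kx.
have := e (k + (uexp x - uexp y) *+ j.+1); rewrite mulser_linform r0; last first.
  by rewrite kaddE raisE eqxx (negPf nxy) kx; lia.
move/eqP; rewrite subr_eq0 => /eqP h.
rewrite /GRing.scale /= in h; apply: (mulfI c0); rewrite -h mulrN exprS invfM -mulrA mulVKf //.
rewrite -(IH k kx); congr s.
by rewrite mulrSr -!addrA; congr (_ + (_ + _)); rewrite addrC subrK.
Qed.

Fixpoint links (x : 'I_n) (ps : seq ('I_n * C)) : seq ('I_n * 'I_n * C) :=
  if ps is (y, c) :: ps' then (x, y, c) :: links y ps' else [::].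

(** The cone of the exponents whose degrees in all the proper initial parts of the
    chain exceed B; a is the degree already accumulated before x. *)
Fixpoint deep (B a : int) (x : 'I_n) (ps : seq ('I_n * C)) k : bool :=
  if ps is (y, _) :: ps' then (B < a + k x)%O && deep B (a + k x) y ps' k else true.

Definition slice x s k : C^o := if k x == 0 then s k else 0.

Lemma mulser_slice x ts s : (forall t, t \in ts -> t.1.1 != x /\ t.1.2 != x) ->
  mulser (\prod_(t <- ts) linform t) (slice x s) =1
  slice x (mulser (\prod_(t <- ts) linform t) s).
Proof.
elim: ts => [|[[a b] c] ts IH] h k.
  by rewrite big_nil /slice !mulser1p.
have [|ax bx] := h (a, b, c); first by rewrite mem_head.
have {}IH := IH (fun t tts => h t (mem_behead (s := _ :: _) tts)).
rewrite big_cons mulserM (eq_mulser _ IH) {IH} mulser_linform /slice.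
rewrite mulserM mulser_linform !kE (eq_sym x a) (negPf ax) (eq_sym x b) (negPf bx) !subr0.
by case: ifP => // _; rewrite scaler0 subr0.
Qed.

Lemma deep_eq B B' a a' x ps k k' : a' + k' x - B' = a + k x - B ->
  (forall y, y \in unzip1 ps -> k' y = k y) -> deep B a x ps k -> deep B' a' x ps k'.
Proof.
elim: ps x a a' => //= -[y c] ps IH x a a' e ey /andP[h1 h2]; apply/andP; split.
  by move: e h1; lia.
apply: IH h2 => [|z zps]; last by apply: ey; rewrite inE zps orbT.
by rewrite (ey y) ?mem_head //; move: e; lia.
Qed.

(** In the directions X_x / X_x1, X_x1 / X_x2, ... of the chain, the coefficients
    of the quotient of p by all the links are eventually those of a geometric
    series, multiplied by the restriction of p to the common zeros of the links.
    The proof treats the variables one at a time: substituting c X_y for X_x in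
    p gives the polynomial that belongs to the rest of the chain, and the
    series that belongs to it is a slice of s far out in the first direction. *)
Lemma cone_vanish x ps s p B :
  uniq (x :: unzip1 ps) ->
  (forall t, t \in links x ps -> t.2 != 0 /\ dirfin t.1.1 t.1.2 s) ->
  mulser (\prod_(t <- links x ps) linform t) s =1 toser p ->
  (forall k, deep B 0 x ps k -> s k = 0) ->
  forall h : 'I_n -> {mpoly C[n]},
  (forall t, t \in links x ps -> h t.1.1 = t.2 *: h t.1.2) -> msub h p = 0.
Proof.
elim: ps x s p B => [|[y c] ps IH] x s p B /= us hs e hd h hh.
  have -> : p = 0; last by rewrite rmorph0.
  apply: toser_inj => k; rewrite -e big_nil mulser1p hd // /toser mulser0p //.
have nxy : x != y by move: us; rewrite inE; case: eqP.
have xps : x \notin y :: unzip1 ps by case/andP: us.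
have [/= c0 fs] := hs _ (mem_head _ _).
have hxy : h x = c *: h y := hh _ (mem_head _ _).
set p1 := elim1 x (c *: 'X_y) p.
have -> : msub h p = msub h p1.
  rewrite /p1 /elim1 msub_comp; apply: eq_msub => i.
  by case: eqP => [->|]; rewrite ?msubZ msubX.
have nlinks t : t \in links y ps -> t.1.1 != x /\ t.1.2 != x.
  elim: ps (y) xps {us hs e hd IH hh} => //= -[z d] ps IH y'.
  rewrite !inE !negb_or => /and3P[xy' xz xps] /predU1P[->/=|]; first by rewrite ![_ == x]eq_sym.
  by apply: IH; rewrite inE negb_or xz.
have [p2 pE] := sub_elim1 x (c *: 'X_y) p; rewrite -/p1 in pE.
have [b hb] := bounded_toser p2.
pose Q := \prod_(t <- links y ps) linform t.
(* Beyond the exponent b in X_x the quotients of p and p1 agree, and beyond B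
   the slice lies in the cone of x. *)
pose M := (b + `|B| + 1)%N.
pose s2 := slice x (fun k => - c ^+ M.+1 * s (k + ((uexp x - uexp y) *+ M - uexp y))).
apply: (IH y s2 _ (B + 1)).
- by case/andP: us.
- move=> t tl; have [t0 ft] := hs t (mem_behead (s := _ :: _) tl); split=> //.
  have [tx ty] := nlinks t tl.
  have := dirfinZ (- c ^+ M.+1) (dirfin_shift ((uexp x - uexp y) *+ M - uexp y) ft).
  move=> + k => /(_ k)[N hN]; exists N => j jN; rewrite /s2 /slice.
  by rewrite kaddE raisE (eq_sym x t.1.2) (negPf ty) (eq_sym x t.1.1) (negPf tx) mul0r addr0 hN // if_same.
- move=> k; rewrite (mulser_slice _ nlinks) {1}/slice; case: eqP => [kx|/eqP kx]; last first.
    by rewrite toser_elim1.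
  rewrite (mulserZs (- c ^+ M.+1)) mulser_shift.
  have fs' : dirfin x y (fun k => mulser Q s k - toser p2 k).
    apply: dirfinB; first exact: dirfin_mulser.
    exact: dirfin_bounded (bounded_toser p2).
  have e' : mulser (linform (x, y, c)) (fun k => mulser Q s k - toser p2 k) =1 toser p1.
    move=> k'; rewrite mulserDs mulserNs -mulserM -/Q.
    move: (e k'); rewrite big_cons -/Q => ->; apply/eqP; rewrite subr_eq; apply/eqP.
    by rewrite -mulserM -pE /toser -mulserDp addrC subrK.
  have := line_solve nxy c0 fs' e' (fun k => @toser_elim1 x y c p k nxy) M kx.
  rewrite (hb _ x) ?subr0; last first.
    by rewrite !kE raisE eqxx (negPf nxy) kx /M /=; lia.
  rewrite -addrA => ->; rewrite /GRing.scale /= mulrN mulNr opprK mulVKf //.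
  by rewrite expf_neq0.
- move=> k hk; rewrite /s2 /slice; case: eqP => // kx; rewrite hd ?mulr0 //.
  have k'x : (k + ((uexp x - uexp y) *+ M - uexp y)) x = M.
    by rewrite !kE raisE eqxx (negPf nxy) kx /=; lia.
  rewrite /= k'x; apply/andP; split; first by rewrite /M; lia.
  apply: deep_eq hk => [|z zps].
    by rewrite !kE raisE eqxx eq_sym (negPf nxy) /=; lia.
  have [zx zy] : z != x /\ z != y.
    by split; apply: contraTneq zps => ->; [apply: contra xps; rewrite inE orbC => -> | case/and3P: us].
  by rewrite !kE raisE (negPf zx) (negPf zy) /=; lia.
- by move=> t tl; apply: hh; rewrite inE tl orbT.
Qed.

End Fin.

(** * Eigenvalues and the Cartan matrix *)

(** Otherwise the first \dim + 1 vectors would be linearly independent. *)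
Lemma linear_dependence (C : fieldType) (W : vectType C) (x : nat -> W) :
  exists J (a : 'I_J -> C), x J = \sum_j a j *: x j.
Proof.
pose X J := [seq x i | i <- rev (iota 0 J)].
have XS J : X J.+1 = x J :: X J by rewrite /X -addn1 iotaD cats1 rev_rcons.
suff [J xJ] : exists J, x J \in <<X J>>%VS.
  exists J, (fun j => coord [tuple of mkseq x J] j (x J)).
  have {}xJ : x J \in <<[tuple of mkseq x J]>>%VS.
    rewrite (eq_span (Y := X J)) // => y.
    by apply/mapP/mapP => -[i ij ->]; exists i => //; rewrite ?mem_rev // -mem_rev.
  rewrite {1}(coord_span xJ); apply: eq_bigr => j _; congr (_ *: _).
  by rewrite /= nth_mkseq.
apply: NNPP => h.
have fX J : free (X J).
  elim: J => [|J IH]; first by rewrite /X nil_free.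
  by rewrite XS free_cons IH andbT; apply/negP => xJ; apply: h; exists J.
have := fX (\dim {:W}).+1; rewrite /free => /eqP e.
have := dimvS (subvf <<X (\dim {:W}).+1>>%VS).
by rewrite e /X size_map size_rev size_iota ltnn.
Qed.

(** The powers of T are linearly dependent. *)
Lemma annihilator (C : fieldType) (W : vectType C) (T : W -> W) :
  (forall a x y, T (a *: x + y) = a *: T x + T y) ->
  exists2 p : {poly C}, p != 0 & forall m x, T x = m *: x -> x != 0 -> root p m.
Proof.
move=> Tlin; pose T' : {linear W -> W} := HB.pack T (GRing.isLinear.Build C W W *:%R T Tlin).
pose t := linfun T'.
pose pw := fix pw j : 'End(W) := if j is j'.+1 then (t \o pw j')%VF else \1%VF.
have [J [a e]] := linear_dependence pw.
exists ('X^J - \poly_(j < J) (if insub j is Some i then a i else 0)).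
  apply: contraTneq isT => /(congr1 (fun p : {poly C} => p`_J)).
  by rewrite coefB coefXn eqxx coef_poly ltnn subr0 coef0 => /eqP; rewrite oner_eq0.
move=> m x Tx x0.
have pwx j : pw j x = m ^+ j *: x.
  elim: j => [|j IH] /=; first by rewrite id_lfunE scale1r.
  by rewrite comp_lfunE IH linearZ /= lfunE /= Tx scalerA -exprSr.
have := congr1 (fun u : 'End(W) => u x) e; rewrite /= sum_lfunE pwx.
under eq_bigr do rewrite scale_lfunE pwx scalerA.
rewrite -scaler_suml => /eqP; rewrite -subr_eq0 -scalerBl scaler_eq0 (negPf x0) orbF.
rewrite /root hornerD hornerN hornerXn horner_poly; congr (_ - _ == 0).
by apply: eq_bigr => j _; rewrite valK.
Qed.

Lemma eigen_finite (C : fieldType) (W : vectType C) (T : W -> W) (m : nat -> C) (x : nat -> W) :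
  (forall a x y, T (a *: x + y) = a *: T x + T y) -> injective m ->
  (forall n, T (x n) = m n *: x n) -> exists n, x n = 0.
Proof.
move=> Tlin minj Tx; have [p p0 hp] := annihilator Tlin.
apply: NNPP => h; have x0 n : x n != 0 by apply/eqP => e; apply: h; exists n.
have := @max_poly_roots _ p (mkseq m (size p)) p0.
rewrite size_mkseq ltnn => H; suff : false by []; apply: H.
  by apply/allP => _ /mapP[n _ ->]; apply: hp (Tx n) (x0 n).
by rewrite map_inj_uniq ?iota_uniq.
Qed.

Lemma roots_bounded (C : fieldType) (p : {poly C}) (m : int -> C) :
  p != 0 -> injective m -> exists M, forall e, root p (m e) -> (`|e| <= M)%N.
Proof.
move=> + minj; move: {2}(size p) (leqnn (size p)) => n; elim: n p => [|n IH] p.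
  by rewrite leqn0 size_poly_eq0 => ->.
move=> sp p0; case: (classic (exists e, root p (m e))) => [[e re]|h]; last first.
  by exists 0%N => e re; case: h; exists e.
have [p' pE] := factor_theorem _ _ re.
have p'0 : p' != 0 by apply: contraNneq p0 => p'0; rewrite pE p'0 mul0r.
have [|//|M hM] := IH p'.
  by move: sp; rewrite pE size_Mmonic ?monicXsubC // size_XsubC addn2.
exists (maxn `|e| M) => e'; rewrite pE rootM root_XsubC (inj_eq minj).
by case/orP => [/hM h|/eqP->]; rewrite leq_max ?h ?leqnn ?orbT.
Qed.

Section CartanMatrix.
Variables (C : fieldType) (r : nat) (g : simple_lie C r).
Hypothesis C0 : [pchar C] =i pred0.

Lemma intr_inj0 : injective (fun a : int => a%:~R : C).
Proof.
have n0 : forall a : int, a%:~R = 0 :> C -> a = 0.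
  by case=> n; rewrite ?NegzE ?rmorphN /= => /eqP; rewrite ?oppr_eq0 -pmulrn
    ((pcharf0P _).1 C0) => /eqP; lia.
by move=> a b e; apply/eqP; rewrite -subr_eq0; apply/eqP/n0; rewrite rmorphB /= e subrr.
Qed.

Notation br := (@sl_br C r g).
Notation e := (@sl_e C r g).
Notation f := (@sl_f C r g).
Notation h := (@sl_h C r g).
Notation A := (sl_cartan g).

Lemma brDl x y z : br (x + y) z = br x z + br y z.
Proof. by case: (sl_lieP g) => H _ _ _; have := H 1 x y z; rewrite !scale1r. Qed.
Lemma brDr x y z : br z (x + y) = br z x + br z y.
Proof. by case: (sl_lieP g) => _ H _ _; have := H 1 x y z; rewrite !scale1r. Qed.
Lemma br0r x : br x 0 = 0.
Proof. by apply: (addrI (br x 0)); rewrite -brDr !addr0. Qed.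
Lemma br0l x : br 0 x = 0.
Proof. by apply: (addrI (br 0 x)); rewrite -brDl !addr0. Qed.
Lemma brZl a x z : br (a *: x) z = a *: br x z.
Proof. by case: (sl_lieP g) => H _ _ _; have := H a x 0 z; rewrite br0l !addr0. Qed.
Lemma brZr a x z : br z (a *: x) = a *: br z x.
Proof. by case: (sl_lieP g) => _ H _ _; have := H a x 0 z; rewrite br0r !addr0. Qed.
Lemma brxx x : br x x = 0. Proof. by case: (sl_lieP g). Qed.
Lemma brC x y : br x y = - br y x.
Proof.
apply/eqP; rewrite -addr_eq0; have := brxx (x + y).
by rewrite brDl !brDr !brxx add0r addr0 addrC => ->.
Qed.
Lemma jacobi x y z : br x (br y z) = br (br x y) z + br y (br x z).
Proof.
case: (sl_lieP g) => _ _ _ /(_ x y z); rewrite (brC z (br x y)) (brC z x) -[- br x z]scaleN1r brZr scaleN1r.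
by move/eqP; rewrite subr_eq0 subr_eq => /eqP.
Qed.

(** The vectors x n = (ad f_i)^n f_j have different weights for h_i, so that one
    of them vanishes.  Applying e_i to the first x n.+1 that vanishes gives
    - A i j = n. *)
Lemma cartan_le0 i j : i != j -> (A i j <= 0)%R.
Proof.
move=> ij; case: (sl_chevalleyP g) => fh hh hef ef [Aii _].
have h0 k : h k != 0.
  by apply: (free_not0 fh); rewrite map_f ?mem_enum.
have f0 : f j != 0.
  by apply: contraNneq (h0 j) => f0; have := ef j j; rewrite f0 br0r eqxx => <-.
pose x n := iter n (br (f i)) (f j).
have hx n : br (h i) (x n) = (- A i j - n%:Z * 2)%:~R *: x n.
  elim: n => [|n IH] /=; first by rewrite (hef i j).2 mul0r subr0 rmorphN.
  rewrite jacobi (hef i i).2 IH brZl brZr -scalerDl -rmorphN -rmorphD /=.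
  by rewrite Aii intS; congr (_%:~R *: _); ring.
have ex n : br (e i) (x n.+1) = (n.+1%:Z * (- A i j - n%:Z))%:~R *: x n.
  elim: n => [|n IH].
    by rewrite /= jacobi !ef eqxx (negPf ij) br0r addr0 (hx 0%N); congr (_%:~R *: _); ring.
  rewrite -[x n.+2]/(br (f i) (x n.+1)) jacobi ef eqxx IH brZr hx -scalerDl -rmorphD /=.
  by congr (_%:~R *: _); rewrite !intS; ring.
have [|||N xN0] := eigen_finite (T := br (h i)) (m := fun n => (- A i j - n%:Z * 2)%:~R) (x := x).
- by move=> a u v; rewrite brDr brZr.
- by move=> m n /intr_inj0; lia.
- exact: hx.
have exN : exists N, x N == 0 by exists N; apply/eqP.
case: (ex_minnP exN) => -[|N'] /eqP xN' mN'; first by move: f0; rewrite -[f j]/(x 0%N) xN' eqxx.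
have := ex N'; rewrite xN' br0r => /eqP; rewrite eq_sym scaler_eq0 => /orP[/eqP|/mN']; last by rewrite ltnn.
by rewrite -[0]/(0%:~R) => /intr_inj0; lia.
Qed.

(** A combination of the h_i killed by all the roots is central, and a simple Lie
    algebra has no center. *)
Lemma cartan_nondegenerate : \det (map_mx (fun a : int => a%:~R : C) A) != 0.
Proof.
case: (sl_chevalleyP g) => fh hh hef ef [Aii gen].
apply/negP => /det0P[b b0 bA].
pose z := \sum_i b 0 i *: h i.
have zx : forall x, br z x = 0.
  pose brz := linfun (HB.pack (br z) (GRing.isLinear.Build C (sl_car g) (sl_car g) *:%R (br z)
     (fun a x y => etrans (brDr _ _ _) (congr1 (fun u => u + br z y) (brZr a x z)))) : {linear sl_car g -> sl_car g}).
  have kz x : (x \in lker brz) = (br z x == 0) by rewrite memv_ker lfunE.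
  have zA j : \sum_i b 0 i * (A i j)%:~R = 0.
    have := congr1 (fun m : 'rV_r => m 0 j) bA; rewrite mxE [RHS]mxE => e.
    by rewrite -[RHS]e; apply: eq_bigr => i _; rewrite [in RHS]mxE.
  have bs x : br z x = \sum_i b 0 i *: br (h i) x.
    rewrite /z (big_morph (fun u => br u x) (fun u v => brDl u v x) (br0l x)).
    by apply: eq_bigr => i _; rewrite brZl.
  suff K : lker brz = fullv by move=> x; apply/eqP; rewrite -kz K memvf.
  apply: gen => [i|x y]; last first.
    by rewrite !kz jacobi => /eqP-> /eqP->; rewrite br0l br0r addr0.
  rewrite !kz !bs; split.
    rewrite (eq_bigr (fun k => (b 0 k * (A k i)%:~R) *: e i)) => [|k _]; last by rewrite (hef k i).1 scalerA.
    by rewrite -scaler_suml zA scale0r.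
  rewrite (eq_bigr (fun k => - (b 0 k * (A k i)%:~R) *: f i)) => [|k _]; last by rewrite (hef k i).2 scalerA mulrN.
  by rewrite -scaler_suml sumrN zA oppr0 scale0r.
have [[x [y xy]] /(_ <[z]>%VS) simple] := sl_simpleP g.
have [|z0|zf] := simple.
- by move=> u w /vlineP[a ->]; rewrite brZr brC zx oppr0 scaler0 mem0v.
- have {}z0 : z = 0 by apply/eqP; rewrite -memv0 -z0 memv_line.
  case/eqP: b0; apply/rowP => i; rewrite mxE.
  pose hs := [tuple h i | i < r].
  have /freeP fhs : free hs by exact: fh.
  have := fhs (fun i => b 0 i); apply; rewrite -[RHS]z0 /z.
  by apply: eq_bigr => k _; rewrite (nth_map k) ?size_enum_ord // nth_ord_enum.
- case: xy; have /vlineP[a ->] : x \in <[z]>%VS by rewrite zf memvf.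
  by rewrite brZl zx scaler0.
Qed.

End CartanMatrix.

(** * One-variable recurrences *)

Section Recurrence.
Variables (C : fieldType) (n : nat) (V : vectType C).

Definition atX (i : 'I_n) (e : {poly C}) : {mpoly C[n]} := (map_poly (@mpolyC n C) e).['X_i].
Definition allX (e : {poly C}) : {mpoly C[n]} := \prod_i atX i e.

Lemma atXM i e e' : atX i (e * e') = atX i e * atX i e'.
Proof. by rewrite /atX rmorphM hornerM. Qed.
Lemma allXM e e' : allX (e * e') = allX e * allX e'.
Proof. by rewrite /allX -big_split; apply: eq_bigr => i _; rewrite atXM. Qed.
Lemma allX1 : allX 1 = 1.
Proof. by rewrite /allX big1 // => i _; rewrite /atX rmorph1 hornerC. Qed.

Lemma atXE i e : atX i e = \sum_(j < size e) e`_j *: 'X_i ^+ j.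
Proof.
rewrite /atX (horner_coef_wide _ (size_poly _ _)); apply: eq_bigr => j _.
by rewrite coef_map /= mul_mpolyC.
Qed.

Lemma mulser_sump (E : lmodType C) I (r : seq I) (p : I -> {mpoly C[n]}) (s : ser n E) k :
  mulser (\sum_(i <- r) p i) s k = \sum_(i <- r) mulser (p i) s k.
Proof.
elim: r => [|i r IH]; first by rewrite !big_nil mulser0p.
by rewrite !big_cons mulserDp IH.
Qed.

Lemma mulser_atX (E : lmodType C) i e (s : ser n E) k :
  mulser (atX i e) s k = \sum_(j < size e) e`_j *: s (k - uexp i *+ j).
Proof.
rewrite atXE mulser_sump; apply: eq_bigr => j _; rewrite mulserZp; congr (_ *: _).
elim: (j : nat) k => [|j' IH] k; first by rewrite expr0 mulser1p mulr0n subr0.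
by rewrite exprS mulserM mulserX IH mulrS opprD addrA.
Qed.

(** The value f 0 is dropped, as the sums over f[m] start with m = 1. *)
Definition extz (W : zmodType) (f : nat -> W) (z : int) : W :=
  if z is Posz m.+1 then f m.+1 else 0.

(** For large indices only, so that e times the generating series of f is a
    polynomial. *)
Definition recurrent (W : lmodType C) (f : nat -> W) (e : {poly C}) :=
  exists B : nat, forall z, (B%:Z <= z)%O -> \sum_(j < size e) e`_j *: extz f (z - j%:Z) = 0.

Definition setk (i : 'I_n) (p : int) (k : {ffun 'I_n -> int}) : {ffun 'I_n -> int} :=
  [ffun j => if j == i then p else k j].

(** The polynomial e annihilates all but finitely many terms of the sequence f,
    and H involves only finitely many translates of it. *)
Lemma conv_bounded (f : nat -> 'End(V)) e i (G H : ser n V) N :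
  recurrent f e -> bounded G ->
  (forall k, H k = \sum_(p < N) extz f (k i - p%:Z) (G (setk i p%:Z k))) ->
  bounded (mulser (atX i e) H).
Proof.
move=> [B hB] [b hb] HE.
have E k : mulser (atX i e) H k =
    \sum_(p < N) (\sum_(j < size e) e`_j *: extz f (k i - p%:Z - j%:Z)) (G (setk i p%:Z k)).
  rewrite mulser_atX; under eq_bigr do rewrite HE scaler_sumr.
  rewrite exchange_big; apply: eq_bigr => p _ /=; rewrite sum_lfunE.
  apply: eq_bigr => j _; rewrite scale_lfunE.
  have uj l : (uexp i *+ j : {ffun 'I_n -> int}) l = (l == i)%:Z * j%:Z.
    by rewrite ffunMnE uexpE pmulrn mulrzz.
  congr (_ *: fun_of_lfun (extz f _) (G _)).
    by rewrite !kE uj eqxx; lia.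
  by apply/kextP => l; rewrite !kE uj; case: eqP => // _; rewrite mul0r subr0.
exists (b + N + B)%N => k l kl; rewrite E big1 // => p _.
have [li|li] := eqVneq l i; last first.
  rewrite (hb _ l) ?linear0 // kE (negPf li); lia.
subst l; case: (Num.Theory.lerP 0 (k i)) => ki.
  by rewrite hB ?zero_lfunE //; have := ltn_ord p; lia.
rewrite big1 ?zero_lfunE // => j _.
by rewrite /extz; case E': (k i - p%:Z - j%:Z) => [[|m]|m]; rewrite ?scaler0 //; lia.
Qed.

Lemma sum_trunc (W : zmodType) (f : nat -> W) a b : (forall p, (a <= p)%N -> f p = 0) ->
  (forall p, (b <= p)%N -> f p = 0) -> \sum_(p < a) f p = \sum_(p < b) f p.
Proof.
move=> fa fb; wlog ab : a b fa fb / (a <= b)%N.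
  by move=> H; case: (leqP a b) => [|/ltnW] h; [|symmetry]; apply: H.
rewrite -!(big_mkord xpredT) (big_cat_nat (n := a) (p := b)) //=.
by rewrite [X in _ + X]big_nat_cond [X in _ + X]big1 ?addr0 // => p /andP[/andP[/fa->]].
Qed.

(** H is the product of G by the series \sum_(m > 0) f m X_i^m, and D G has finitely
    many terms. *)
Lemma conv_mulser (f : nat -> 'End(V)) i (D : {mpoly C[n]}) (G H : ser n V) :
  (forall (k : {ffun 'I_n -> int}) l, (k l < 0)%O -> G k = 0) ->
  (forall k : {ffun 'I_n -> int}, (k i < 0)%O -> H k = 0) ->
  (forall k : {ffun 'I_n -> int}, (0 <= k i)%O -> H k = \sum_(1 <= m < `|k i|%N.+1) f m (G (k - uexp i *+ m))) ->
  bounded (mulser D G) ->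
  exists N, forall k, mulser D H k = \sum_(p < N) extz f (k i - p%:Z) (mulser D G (setk i p%:Z k)).
Proof.
move=> G0 H0 HE [b hb].
have ui m l : (uexp i *+ m : {ffun 'I_n -> int}) l = (l == i)%:Z * m%:Z.
  by rewrite ffunMnE uexpE pmulrn mulrzz.
have HN N (k : {ffun 'I_n -> int}) : (k i < N%:Z)%O -> H k = \sum_(1 <= m < N) f m (G (k - uexp i *+ m)).
  move=> kN; case: (Num.Theory.lerP 0 (k i)) => ki; last first.
    rewrite H0 // big_nat_cond big1 // => m /andP[/andP[m1 _] _].
    by rewrite (G0 _ i) ?linear0 // !kE ui eqxx; lia.
  rewrite HE // [RHS](big_cat_nat (n := `|k i|%N.+1)) //=; last by lia.
  rewrite [X in _ + X]big_nat_cond [X in _ + X]big1 ?addr0 // => m /andP[/andP[m1 _] _].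
  by rewrite (G0 _ i) ?linear0 // !kE ui eqxx; lia.
have DG0 (k : {ffun 'I_n -> int}) l : (k l < 0)%O -> mulser D G k = 0.
  move=> kl; rewrite /mulser big1 // => m _; rewrite (G0 _ l) ?scaler0 // !kE; lia.
have DHN N (k : {ffun 'I_n -> int}) : (k i < N%:Z)%O ->
    mulser D H k = \sum_(1 <= m < N) f m (mulser D G (k - uexp i *+ m)).
  move=> kN; rewrite /mulser.
  under [RHS]eq_bigr do rewrite linear_sum.
  rewrite exchange_big; apply: eq_bigr => m _ /=; rewrite (HN N); last by rewrite !kE; lia.
  rewrite scaler_sumr; apply: eq_bigr => l _; rewrite linearZ /=; congr (_ *: f l (G _)).
  by rewrite addrAC.
exists b.+1 => k; case: (Num.Theory.lerP 0 (k i)) => ki; last first.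
  rewrite (DHN 0%N) ?big_geq // big1 // => p _.
  by rewrite /extz; case E: (k i - p%:Z) => [[|m]|m]; rewrite ?zero_lfunE //; lia.
case E: (k i) ki => [K|//] _; rewrite (DHN K.+1) ?E; last by lia.
transitivity (\sum_(p < K) extz f (K%:Z - p%:Z) (mulser D G (setk i p%:Z k))).
  rewrite big_add1 /= big_mkord (reindex_inj rev_ord_inj) /=; apply: eq_bigr => p _.
  have pK := ltn_ord p; rewrite /extz subzn; last by lia.
  case e: (K - p)%N => [|m]; first by lia.
  have -> : (K - p.+1).+1 = m.+1 by lia.
  congr (f _ (mulser D G _)); apply/kextP => l; rewrite !kE ui.
  by case: eqP => [->|_]; lia.
apply: (@sum_trunc _ (fun p => extz f (K%:Z - p%:Z) (mulser D G (setk i p%:Z k)))) => p hp.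
  by rewrite /extz; case e: (K%:Z - p%:Z) => [[|m]|m]; rewrite ?zero_lfunE //; lia.
by rewrite (hb _ i) ?linear0 // kE eqxx.
Qed.

End Recurrence.

(** * The weight functions of a representation *)

Section Weight.
Variables (C : fieldType) (q : C) (r : nat) (g : simple_lie C r).
Variables (U : algType C) (X : quantum_affine q g U).
Variables (eps : {lrmorphism U -> C^o}) (P : U -> U).
Hypothesis q0 : q != 0.
Hypothesis q_not_root : forall n : nat, (0 < n)%N -> q ^+ n != 1.
Hypothesis eps_counit : is_counit X eps.
Hypothesis prod_iso : product_iso (in_Uf_minus X) (in_UF_plus X) (in_UF X).
Hypothesis P_proj : is_projection X eps P.
Hypothesis conj_W : weight_property X P.

Notation UF := (in_UF X).
Notation F i m := (qa_cur X (CurX true i m)).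
Notation K i := (qa_cur X (CurK false i)).
Notation KV i := (qa_cur X (CurK true i)).
Notation form := (sl_form g).

Lemma form_sym i j : form i j = form j i.
Proof. by rewrite /sl_form /sl_cartan !mxE; apply: sl_sym. Qed.

(** ** The subalgebra U_F and the projection *)

Lemma UF_F i m : UF (F i m). Proof. by apply: subalg_gen; apply: Or32; exists i, m. Qed.
Lemma UF_K b i : UF (qa_cur X (CurK b i)).
Proof. by apply: subalg_gen; apply: Or31; exists b, (lift ord0 i); rewrite qa_k. Qed.
Lemma UF1 : UF 1. Proof. exact: subalg_one. Qed.
Lemma UFM x y : UF x -> UF y -> UF (x * y). Proof. exact: subalg_mul. Qed.
Lemma UFlin a x y : UF x -> UF y -> UF (a *: x + y). Proof. exact: subalg_lin. Qed.
Lemma UFD x y : UF x -> UF y -> UF (x + y).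
Proof. by rewrite -[x in UF (x + _)]scale1r; apply: UFlin. Qed.
Lemma UF0 : UF 0.
Proof. by rewrite -(addNr (1 : U)) -scaleN1r; apply: UFlin; apply: UF1. Qed.
Lemma UFZ a x : UF x -> UF (a *: x).
Proof. by move=> ux; rewrite -[_ *: _]addr0; apply: UFlin => //; apply: UF0. Qed.
Lemma UF_sum I (s : seq I) (f : I -> U) : (forall i, UF (f i)) -> UF (\sum_(i <- s) f i).
Proof. by move=> h; apply: (big_ind UF) => //; [apply: UF0 | apply: UFD]. Qed.
Lemma UF_prod I (s : seq I) (f : I -> U) : (forall i, UF (f i)) -> UF (\prod_(i <- s) f i).
Proof. by move=> h; apply: (big_ind UF) => //; [apply: UF1 | apply: UFM]. Qed.

Lemma P_lin a x y : UF x -> UF y -> P (a *: x + y) = a *: P x + P y.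
Proof. by case: P_proj => H _; apply: H. Qed.
Lemma P_0 : P 0 = 0.
Proof. by have := P_lin (-1) UF0 UF0; rewrite scaler0 addr0 scaleN1r addNr. Qed.
Lemma P_D x y : UF x -> UF y -> P (x + y) = P x + P y.
Proof. by move=> ux uy; have := P_lin 1 ux uy; rewrite !scale1r. Qed.
Lemma P_Z a x : UF x -> P (a *: x) = a *: P x.
Proof. by move=> ux; have := P_lin a ux UF0; rewrite P_0 !addr0. Qed.
Lemma P_sum I (s : seq I) (f : I -> U) : (forall i, UF (f i)) ->
  P (\sum_(i <- s) f i) = \sum_(i <- s) P (f i).
Proof.
move=> h; elim: s => [|i s IH]; first by rewrite !big_nil P_0.
by rewrite !big_cons P_D // ?IH //; apply: UF_sum.
Qed.
Lemma P_mul x y : in_Uf_minus X x -> UF y -> P (x * y) = eps x *: P y.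
Proof.
move=> hx; have [h1 h2 _] := prod_iso => /h2[m [a [b [ha hb ->]]]].
have ua i : UF (a i) by case: (ha i).
have ub i : UF (b i) by case: (hb i).
have [_ Pm] := P_proj.
rewrite mulr_sumr !P_sum; last 2 [by move=> i; apply: UFM].
  rewrite scaler_sumr; apply: eq_bigr => i _.
  rewrite mulrA !Pm // ?rmorphM ?scalerA //; case: hx => ux nx; case: (ha i) => _ na.
  by split; [apply: UFM | apply: subalg_mul].
by move=> i; apply: UFM => //; [case: hx | apply: UFM].
Qed.

(** The kernel is spanned by the products of an element of U_f^- of counit 0 with
    an element of U_F. *)
Lemma P_ker_mul x y : UF x -> UF y -> P x = 0 -> P (x * y) = 0.
Proof.
have [_ h2 _] := prod_iso => /h2[m [a [b [ha hb ->]]]] uy.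
have ua i : UF (a i) by case: (ha i).
have ub i : UF (b i) by case: (hb i).
have [_ Pm] := P_proj.
rewrite P_sum => [e|i]; last exact: UFM.
have e' : \sum_i eps (a i) *: b i = 0 by rewrite -[RHS]e; apply: eq_bigr => i _; rewrite Pm.
rewrite mulr_suml P_sum; last by move=> i; apply: UFM => //; apply: UFM.
rewrite (eq_bigr (fun i => P ((eps (a i) *: b i) * y))) => [|i _].
  rewrite -P_sum; last by move=> i; apply: UFM => //; apply: UFZ.
  by rewrite -mulr_suml e' mul0r P_0.
rewrite -mulrA P_mul //; last exact: UFM.
by rewrite -P_Z ?scalerAl //; apply: UFM.
Qed.

Lemma word_ser_pos n (w : seq (letter r n)) (k : {ffun 'I_n -> int}) i :
  (0 < k i)%O -> word_ser X w k = 0.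
Proof.
elim: w k => [|[[[a c] j]|a] w IH] k ki /=.
- by rewrite /one_ser; case: eqP ki => // ->; rewrite kzeroE.
- rewrite big1 // => m _; rewrite IH ?mulr0 ?scaler0 // kE.
  by case: ifP => _; lia.
- by rewrite IH // mulr0.
Qed.

(** f_a[0] has counit 0.  For m < 0 this is the hypothesis for one variable: the
    coefficients of the words are then constants, and words contain no positive
    power of t. *)
Lemma P_F_le0 i m : (m <= 0)%O -> P (F i m) = 0.
Proof.
rewrite Order.POrderTheory.le_eqVlt => /predU1P[->|m0].
  have e0 : eps (F i 0) = 0 by rewrite -qa_e; case: eps_counit.
  rewrite -[F i 0]mulr1 P_mul ?e0 ?scale0r //; last exact: UF1.
  split; first exact: UF_F.
  by apply: subalg_gen; exists (lift ord0 i); rewrite qa_e.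
have [_ [l [/allP lc /(_ [ffun=> - m])]]] := conj_W (fun _ : 'I_1 => i).
rewrite /weight_den big_ord1 big_pred0 => [|j]; last by rewrite (ord1 j).
rewrite mulser1p /weight_fun big_ord1 kE opprK => ->.
rewrite big_seq big1 // => c /lc; rewrite muln0 => /msize_poly1P[a _ ->].
by rewrite mulserCp (@word_ser_pos _ _ _ ord0) ?scaler0 // kE; lia.
Qed.

Definition prodF n (c : 'I_n -> 'I_r) (s : seq 'I_n) (k : {ffun 'I_n -> int}) : U :=
  \prod_(x <- s) F (c x) (k x).

Lemma UF_prodF n (c : 'I_n -> 'I_r) s k : UF (prodF c s k).
Proof. by apply: UF_prod => x; apply: UF_F. Qed.

Lemma prodF_cat n (c : 'I_n -> 'I_r) s1 s2 k : prodF c (s1 ++ s2) k = prodF c s1 k * prodF c s2 k.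
Proof. by rewrite /prodF big_cat. Qed.
Lemma prodF_cons n (c : 'I_n -> 'I_r) x s k : prodF c (x :: s) k = F (c x) (k x) * prodF c s k.
Proof. by rewrite /prodF big_cons. Qed.

Lemma prodF_notin n (c : 'I_n -> 'I_r) x s k : x \notin s -> prodF c s (k - uexp x) = prodF c s k.
Proof.
move=> xs; rewrite /prodF big_seq [RHS]big_seq; apply: eq_bigr => y ys.
by rewrite !kE; case: eqP ys xs => [->->//|_ _ _]; rewrite subr0.
Qed.

(** ** Vectors of the representation *)

Variables (V : vectType C) (rho : {linear U -> 'End(V)}) (v : V).
Hypothesis rho_repr : is_repr rho.
Hypothesis v_sing : singular_generator X rho v.

Definition wact (u : U) : V := rho (P u) v.

Lemma wact_lin a x y : UF x -> UF y -> wact (a *: x + y) = a *: wact x + wact y.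
Proof. by move=> ux uy; rewrite /wact P_lin // linearP /= add_lfunE scale_lfunE. Qed.
Lemma wact0 : wact 0 = 0.
Proof. by rewrite /wact P_0 linear0 zero_lfunE. Qed.
Lemma wactZ a x : UF x -> wact (a *: x) = a *: wact x.
Proof. by move=> ux; have := wact_lin a ux UF0; rewrite wact0 !addr0. Qed.
Lemma wactD x y : UF x -> UF y -> wact (x + y) = wact x + wact y.
Proof. by move=> ux uy; have := wact_lin 1 ux uy; rewrite !scale1r. Qed.
Lemma wactBZ a x y : UF x -> UF y -> wact (x - a *: y) = wact x - a *: wact y.
Proof. by move=> ux uy; rewrite -!scaleNr addrC wact_lin // addrC. Qed.
Lemma wactZB a x y : UF x -> UF y -> wact (a *: x - y) = a *: wact x - wact y.
Proof. by move=> ux uy; rewrite -!scaleN1r wact_lin ?wactZ //; apply: UFZ. Qed.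
Lemma wact_sum I (s : seq I) (f : I -> U) : (forall i, UF (f i)) ->
  wact (\sum_(i <- s) f i) = \sum_(i <- s) wact (f i).
Proof.
move=> h; elim: s => [|i s IH]; first by rewrite !big_nil wact0.
by rewrite !big_cons wactD // ?IH //; apply: UF_sum.
Qed.

(** The exponents are the indices of the currents, hence k stands for u^k with
    u = 1 / t. *)
Definition wser n (c : 'I_n -> 'I_r) (s : seq 'I_n) (k : {ffun 'I_n -> int}) : V :=
  wact (prodF c s k).

Definition qform n (c : 'I_n -> 'I_r) (x y : 'I_n) : C := q ^ form (c x) (c y).

Lemma qform_neq0 n (c : 'I_n -> 'I_r) x y : qform c x y != 0.
Proof. by rewrite /qform expfz_neq0. Qed.

Lemma F_exchange i j a b : q ^ form i j *: (F i (a + 1) * F j b) - F i a * F j (b + 1) =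
  F j b * F i (a + 1) - q ^ form i j *: (F j (b + 1) * F i a).
Proof.
have [_ _ ff _ _] : cur_rel q g (qa_cur X) by case: (qa_curP X).
have := congr1 (fun u => q ^ form i j *: u) (ff true i j a b).
by rewrite /sgnz !scalerBr !scalerA -!expfzDr // subrr expr0z !scale1r.
Qed.

Lemma wser_exchange n (c : 'I_n -> 'I_r) s1 x y s2 k : uniq (s1 ++ x :: y :: s2) ->
  mulser (linform (x, y, qform c x y)) (wser c (s1 ++ x :: y :: s2)) k =
  - mulser (linform (y, x, qform c y x)) (wser c (s1 ++ y :: x :: s2)) k.
Proof.
rewrite cat_uniq /= => /and3P[_ /norP[xs1 /norP[ys1 _]] /andP[]].
rewrite inE negb_or => /andP[nxy xs2] /andP[ys2 _].
have yx : (y == x) = false by rewrite eq_sym (negPf nxy).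
rewrite !mulser_linform /wser !prodF_cat !prodF_cons !prodF_notin //.
rewrite !kE !eqxx (negPf nxy) yx !subr0 [qform c y x]/(q ^ _) form_sym -/(qform c x y).
set L := prodF c s1 k; set R := prodF c s2 k.
have uL : UF L by apply: UF_prodF. have uR : UF R by apply: UF_prodF.
have uFF a b i j : UF (L * (F i a * (F j b * R))).
  by do 3 (apply: UFM => //; first [apply: UF_F | idtac]).
have := congr1 (fun u => wact (L * (u * R))) (F_exchange (c x) (c y) (k x - 1) (k y - 1)).
rewrite !subrK !mulrBl !mulrBr -!scalerAl -!scalerAr -!mulrA.
rewrite wactZB // wactBZ // => e.
by rewrite -[in RHS]e opprB.
Qed.

Lemma wser_first n (c : 'I_n -> 'I_r) x s (k : {ffun 'I_n -> int}) : (k x <= 0)%O -> wser c (x :: s) k = 0.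
Proof.
move=> kx; rewrite /wser prodF_cons /wact P_ker_mul ?linear0 ?zero_lfunE //.
- exact: UF_F.
- exact: UF_prodF.
- exact: P_F_le0.
Qed.

Lemma wser_map n n' (f : 'I_n -> 'I_n') (c : 'I_n' -> 'I_r) s k :
  wser c (map f s) k = wser (c \o f) s (kcomp f k).
Proof.
by rewrite /wser /prodF big_map; congr wact; apply: eq_bigr => x _; rewrite kE.
Qed.

Lemma wser_weight_fun n (c : 'I_n -> 'I_r) k :
  wser c (enum 'I_n) k = rho (weight_fun X P c (- k)) v.
Proof.
rewrite /wser /wact /weight_fun /prodF [index_enum _]unlock -enumT; congr (rho (P _) v).
by apply: eq_bigr => x _; rewrite kE opprK.
Qed.

Lemma seq_as_map n (s : seq 'I_n) : perm_eq s (enum 'I_n) ->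
  exists f : 'I_n -> 'I_n, [/\ bijective f, s = map f (enum 'I_n) &
    forall i, index (f i) s = i].
Proof.
move=> ps; have sz : size s = n by rewrite (perm_size ps) size_enum_ord.
have us : uniq s by rewrite (perm_uniq ps) enum_uniq.
pose f p := nth p s p; have fn p p0 : f p = nth p0 s p by apply: set_nth_default; rewrite sz.
have fi p : index (f p) s = p by rewrite /f index_uniq ?sz.
exists f; split=> //; first by apply: injF_bij => p p' e; apply: val_inj; rewrite /= -(fi p) e fi.
case: n s ps sz us f fn fi => [|n] s ps sz us f fn fi.
  by rewrite (size0nil sz) enum_ord0.
apply: (@eq_from_nth _ ord0); first by rewrite size_map size_enum_ord.
move=> i; rewrite sz => ilt; rewrite (nth_map ord0) ?size_enum_ord // (fn _ ord0).
by rewrite nth_enum_ord.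
Qed.

(** A Laurent series has bounded exponents in t_x when those of the earlier
    variables are fixed. *)
Lemma wser_dirfin n (c : 'I_n -> 'I_r) s x y (phi : V -> C^o) :
  phi 0 = 0 -> perm_eq s (enum 'I_n) -> (index x s < index y s)%N ->
  dirfin x y (fun k => phi (wser c s k)).
Proof.
move=> phi0 /seq_as_map[f [bf -> fi]] xy k; have finj := bij_inj bf.
have [h fK hK] := bf; rewrite -(hK x) -(hK y) !fi in xy.
have [[a [ha1 ha2]] _] := conj_W (c \o f).
exists (absz (a (h x) (- kcomp f k) + k x + 1)) => j hj.
rewrite wser_map wser_weight_fun (ha2 (h x)) ?linear0 ?zero_lfunE //.
have -> : a (h x) (- kcomp f (k + (uexp y - uexp x) *+ j)) = a (h x) (- kcomp f k).
  apply: ha1 => i ix; rewrite !kE raisE.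
  have /negPf-> : f i != y by apply: contraTneq ix => e; rewrite -(fK i) e -leqNgt ltnW.
  have /negPf-> : f i != x by apply: contraTneq ix => e; rewrite -(fK i) e ltnn.
  by rewrite mul0r addr0.
rewrite !kE raisE hK eqxx.
have /negPf-> : x != y by apply: contraTneq xy => ->; rewrite ltnn.
by lia.
Qed.

(** ** The Serre relations *)

Definition serre_list n m (x : 'I_m -> 'I_n) (y : 'I_n) (p : nat) (sg : 'S_m) : seq 'I_n :=
  [seq x (sg i) | i : 'I_m <- enum 'I_m & (i < p)%N] ++ y :: [seq x (sg i) | i : 'I_m <- enum 'I_m & (p <= i)%N].

Lemma wser_serre n (c : 'I_n -> 'I_r) s t (x : 'I_(serre_len (sl_cartan g s t)) -> 'I_n) y rest k :
  s != t -> (forall i, c (x i) = s) -> c y = t ->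
  \sum_(p < (serre_len (sl_cartan g s t)).+1)
    ((-1) ^+ p * qbinom (qfin q g s) (serre_len (sl_cartan g s t)) p) *:
      \sum_sg wser c (serre_list x y p sg ++ rest) k = 0.
Proof.
move=> st cx cy.
have [_ _ _ _ se] : cur_rel q g (qa_cur X) by case: (qa_curP X).
have := congr1 (fun u => wact (u * prodF c rest k)) (se true s t st (fun i => k (x i)) (k y)).
rewrite mul0r wact0 mulr_suml => e; rewrite -[RHS]e {e}.
have uR : UF (prodF c rest k) by apply: UF_prodF.
have uS p (sg : 'S_(serre_len (sl_cartan g s t))) :
  UF (\prod_(i < serre_len (sl_cartan g s t) | (i < p)%N) F s (k (x (sg i))) * F t (k y) *
      \prod_(i < serre_len (sl_cartan g s t) | (p <= i)%N) F s (k (x (sg i)))).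
  apply: UFM; first apply: UFM.
  - by rewrite -big_filter; apply: UF_prod => i; apply: UF_F.
  - exact: UF_F.
  - by rewrite -big_filter; apply: UF_prod => i; apply: UF_F.
rewrite wact_sum => [|p]; last by apply: UFM => //; apply: UFZ; apply: UF_sum.
apply: eq_bigr => p _; rewrite -scalerAl wactZ; last by apply: UFM => //; apply: UF_sum.
congr (_ *: _); rewrite mulr_suml wact_sum => [|sg]; last by apply: UFM.
apply: eq_bigr => sg _; rewrite /wser /serre_list prodF_cat prodF_cat prodF_cons mulrA.
congr (wact (_ * _ * _ * _)); last 1 first.
- rewrite /prodF big_map big_filter [index_enum _]unlock -enumT.
  by apply: eq_bigr => i _; rewrite cx.
- rewrite /prodF big_map big_filter [index_enum _]unlock -enumT.
  by apply: eq_bigr => i _; rewrite cx.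
- by rewrite cy.
Qed.

(** ** Weights *)

Lemma psi0 i : psi q g (qa_cur X) false i 0 = K i.
Proof.
rewrite /psi /= /exp_coef big_ord1 /= fact0 invr1 scale1r mulr1 //.
Qed.

Lemma psi_neg i : psi q g (qa_cur X) false i (-1) = 0.
Proof. by []. Qed.

Lemma KKV i : K i * KV i = 1.
Proof. by have [/(_ i)[]] : cur_rel q g (qa_cur X) by case: (qa_curP X). Qed.
Lemma KVK i : KV i * K i = 1.
Proof. by have [/(_ i)[]] : cur_rel q g (qa_cur X) by case: (qa_curP X). Qed.

Lemma K_F i j m : K i * F j m = q ^ (- form i j) *: (F j m * K i).
Proof.
have [_ [_ kf] _ _ _] : cur_rel q g (qa_cur X) by case: (qa_curP X).
have := kf false true i j (-1) m; rewrite addNr psi0 psi_neg mul0r mulr0 scaler0 !subr0.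
by [].
Qed.

Lemma K_prodF i n (c : 'I_n -> 'I_r) s k :
  K i * prodF c s k = q ^ (- \sum_(x <- s) form i (c x)) *: (prodF c s k * K i).
Proof.
elim: s => [|x s IH]; first by rewrite /prodF !big_nil oppr0 expr0z scale1r mulr1 mul1r.
rewrite prodF_cons big_cons mulrA K_F -scalerAl -[_ * K i * _]mulrA IH -scalerAr scalerA mulrA.
by rewrite opprD expfzDr.
Qed.

Lemma subalg_conj (S : U -> Prop) i :
  (forall x, S x -> subalg S (K i * x * KV i)) ->
  forall x, subalg S x -> subalg S (K i * x * KV i).
Proof.
move=> h x; elim=> {x} [x /h //||a x y _ hx _ hy|x y _ hx _ hy].
- by rewrite mulr1 KKV; apply: subalg_one.
- by rewrite mulrDr mulrDl -scalerAr -scalerAl; apply: subalg_lin.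
- rewrite (_ : _ * _ = (K i * x * KV i) * (K i * y * KV i)); first exact: subalg_mul.
  by rewrite -!mulrA (mulrA (KV i)) KVK mul1r.
Qed.

Lemma K_dj i b j : exists a, K i * qa_dj X (DJe b j) * KV i = a *: qa_dj X (DJe b j).
Proof.
have [_ kx _ _] : dj_rel q g (qa_dj X) by case: (qa_djP X).
by eexists; have := kx b (lift ord0 i) j; rewrite !qa_k => ->.
Qed.

Lemma subalgZ (S : U -> Prop) a x : subalg S x -> subalg S (a *: x).
Proof.
move=> h; have s0 : subalg S 0.
  by rewrite -(addNr (1 : U)) -scaleN1r; apply: subalg_lin; apply: subalg_one.
by rewrite -[_ *: _]addr0; apply: subalg_lin.
Qed.

(** Conjugation by k_i preserves U_f^-, U_F^+ and the counit. *)
Lemma P_conj i u : UF u -> P (K i * u * KV i) = K i * P u * KV i.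
Proof.
have [_ h2 _] := prod_iso => /h2[m [a [b [ha hb ->]]]].
have ua j : UF (a j) by case: (ha j).
have ub j : UF (b j) by case: (hb j).
have uc x : UF x -> UF (K i * x * KV i).
  by move=> ux; apply: UFM; [apply: UFM => //|]; apply: UF_K.
have [_ Pm] := P_proj.
rewrite [P (\sum_j _)]P_sum => [|j]; last exact: UFM.
rewrite !mulr_sumr !mulr_suml P_sum => [|j]; last by apply: uc; apply: UFM.
apply: eq_bigr => j _; rewrite (Pm (a j) (b j)) //.
have -> : K i * (a j * b j) * KV i = (K i * a j * KV i) * (K i * b j * KV i).
  by rewrite -!mulrA (mulrA (KV i)) KVK mul1r.
have eK : eps (K i) = 1 by rewrite -qa_k; case: eps_counit.
have eKV : eps (KV i) = 1 by rewrite -qa_k; case: eps_counit.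
rewrite Pm.
- by rewrite !rmorphM /= eK eKV mul1r mulr1 -scalerAr -scalerAl.
- split; first exact: uc; case: (ha j) => _; apply: subalg_conj => _ [l ->].
  by have [z ->] := K_dj i true l; apply: subalgZ; apply: subalg_gen; exists l.
- split; first exact: uc; case: (hb j) => _; apply: subalg_conj => _ [[l ->]|[b' [l ->]]].
    by have [z ->] := K_dj i false l; apply: subalgZ; apply: subalg_gen; left; exists l.
  apply: subalg_mul; last by apply: subalg_gen; right; exists true, (lift ord0 i); rewrite qa_k.
  apply: subalg_mul; last by apply: subalg_gen; right; exists b', l.
  by apply: subalg_gen; right; exists false, (lift ord0 i); rewrite qa_k.
Qed.

Lemma rhoM x y w : rho (x * y) w = rho x (rho y w).
Proof. by case: rho_repr => _ ->; rewrite comp_lfunE. Qed.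

Lemma wser_weight i n (c : 'I_n -> 'I_r) s k a : rho (K i) v = a *: v ->
  rho (K i) (wser c s k) = (a * q ^ (- \sum_(x <- s) form i (c x))) *: wser c s k.
Proof.
move=> Kv; set z := q ^ _; rewrite /wser /wact -rhoM.
have e : K i * P (prodF c s k) * KV i = z *: P (prodF c s k).
  rewrite -P_conj; last exact: UF_prodF.
  rewrite K_prodF -scalerAl -mulrA KKV mulr1 P_Z //; exact: UF_prodF.
have -> : K i * P (prodF c s k) = z *: (P (prodF c s k) * K i).
  by rewrite -[LHS]mulr1 -(KVK i) mulrA e scalerAl.
by rewrite linearZ /= scale_lfunE rhoM Kv linearZ /= scalerA mulrC.
Qed.

Lemma expfz_inj : injective (fun e : int => q ^ e).
Proof.
have h : forall e : int, q ^ e = 1 -> e = 0.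
  case=> [[//|n] /eqP|n /eqP]; first by rewrite -exprnP (negPf (q_not_root _)).
  by rewrite NegzE -exprnN invr_eq1 (negPf (q_not_root _)).
move=> e e' eq; apply/eqP; rewrite -subr_eq0; apply/eqP/h.
by rewrite expfzDr // eq -expfzDr // subrr.
Qed.

Hypothesis C0 : [pchar C] =i pred0.

(** On a nonzero value of a weight function k_i has the eigenvalue
    lam_i q^(- \sum_x (alpha_i, c x)).  It has finitely many eigenvalues, which
    bounds these sums, and the Cartan matrix is invertible. *)
Lemma weight_bound : exists B, forall n (c : 'I_n -> 'I_r) s k, wser c s k != 0 ->
  forall i, (count (fun x => c x == i) s <= B)%N.
Proof.
have [_ [lam hlam] _] := v_sing.
have Kv i : rho (K i) v = lam i 0%N *: v by have := (hlam i).2 0%N; rewrite psi0.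
have hM0 i : exists M, forall n (c : 'I_n -> 'I_r) s k, wser c s k != 0 ->
    (absz (\sum_(x <- s) form i (c x))%R <= M)%N.
  have [p p0 hp] := annihilator (T := rho (K i)) (fun a x y => linearP _ _ _ _).
  have [|M hM] := roots_bounded (m := fun e => lam i 0%N * q ^ (- e)) p0.
    by move=> e e' /(mulfI (hlam i).1)/expfz_inj/oppr_inj.
  exists M => n c s k w0; apply: hM; apply: hp w0; exact: wser_weight.
have [M hM] := fin_all_exists hM0.
pose A := sl_cartan g.
have detA : \det A != 0.
  apply/eqP => e; have /negP := cartan_nondegenerate g; apply.
  by rewrite (det_map_mx (intmul 1)) e rmorph0.
exists (\sum_s \sum_i `|\adj A s i| * M i)%N => n c s k w0 i.
pose nn j := count (fun x => c x == j) s.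
have Enn j : \sum_(x <- s) form j (c x) = (sl_d g (lift ord0 j))%:Z * \sum_l A j l * (nn l)%:Z.
  rewrite /nn; elim: s {w0 nn} => [|x s IH].
    by rewrite big_nil big1 ?mulr0 // => l _; rewrite mulr0.
  rewrite big_cons IH /= -[in RHS](eq_bigr _ (fun l _ => erefl)).
  rewrite [in RHS](eq_bigr (fun l => A j l * (c x == l)%:Z + A j l * (count (fun x => c x == l) s)%:Z)) => [|l _].
    rewrite big_split mulrDr /=; congr (_ + _); rewrite /sl_form; congr (_ * _).
    rewrite (bigD1 (c x)) //= eqxx mulr1 big1 ?addr0 // => l /negPf.
    by rewrite eq_sym => ->; rewrite mulr0.
  by rewrite PoszD mulrDr.
have y_le j : (absz (\sum_l A j l * (nn l)%:Z)%R <= M j)%N.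
  apply: leq_trans (hM j _ c s k w0); rewrite Enn abszM leq_pmull //.
  by have := sl_d123 g (lift ord0 j); rewrite !inE => /or3P[] /eqP->.
have : \det A * (nn i)%:Z = \sum_j \adj A i j * \sum_l A j l * (nn l)%:Z.
  transitivity (((\adj A *m A) *m \col_l (nn l)%:Z) i 0).
    by rewrite mul_adj_mx mul_scalar_mx !mxE.
  rewrite -mulmxA mxE; apply: eq_bigr => j _; congr (_ * _).
  by rewrite mxE; apply: eq_bigr => l _; rewrite [X in _ * X]mxE.
move=> /(congr1 absz); rewrite abszM => e.
apply: (@leq_trans (`|\det A| * nn i)%N); first by rewrite leq_pmull // absz_gt0.
rewrite e [X in (_ <= X)%N](bigD1 i) //=; apply: leq_trans (leq_addr _ _).
apply: (big_ind2 (fun a b => absz a <= b)%N) => [//|a b a' b' h h'|j _]; first by lia.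
by rewrite abszM leq_mul.
Qed.

(** ** Rationality *)

Lemma psi_form_neq0 a : q ^ (- form a a) - q ^ form a a != 0.
Proof.
rewrite subr_eq0; apply/negP => /eqP/expfz_inj.
rewrite /sl_form; case: (sl_chevalleyP g) => _ _ _ _ [-> _].
by have := sl_d123 g (lift ord0 a); rewrite !inE => /or3P[] /eqP->.
Qed.

(** The relation between psi^+_a[1] and f_a[m], solved for f_a[m + 1]. *)
Definition raiseF a (u : 'End(V)) : 'End(V) :=
  (q ^ (- form a a) - q ^ form a a)^-1 *:
  (rho (KV a) \o (rho (psi q g (qa_cur X) false a 1) \o u -
     q ^ (- form a a) *: (u \o rho (psi q g (qa_cur X) false a 1))))%VF.

Lemma rho_mul x y : rho (x * y) = (rho x \o rho y)%VF.
Proof. by case: rho_repr => _ ->. Qed.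

Lemma raiseF_F a m : raiseF a (rho (F a m)) = rho (F a (m + 1)).
Proof.
rewrite /raiseF -!rho_mul -linearZ -linearB -rho_mul -linearZ /=; congr (rho _).
have [_ [_ kf] _ _ _] : cur_rel q g (qa_cur X) by case: (qa_curP X).
have := kf false true a a 0 m; rewrite psi0 add0r /sgnz => e.
set c := q ^ _ in e *.
have e1 : c *: (F a (m + 1) * K a) = K a * F a (m + 1) by rewrite K_F.
have e2 : F a (m + 1) * K a = q ^ form a a *: (K a * F a (m + 1)).
  by rewrite -e1 scalerA -expfzDr // subrr expr0z scale1r.
have -> : psi q g (qa_cur X) false a 1 * F a m - c *: (F a m * psi q g (qa_cur X) false a 1) =
    (c - q ^ form a a) *: (K a * F a (m + 1)).
  move/eqP: e; rewrite subr_eq => /eqP->; rewrite e2 addrAC [c *: _ - _ + _]addrAC subrr add0r addrC.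
  by rewrite -scalerBl.
by rewrite -scalerAr scalerA mulVf ?psi_form_neq0 // scale1r mulrA KVK mul1r.
Qed.

Lemma raiseF_lin a b x y : raiseF a (b *: x + y) = b *: raiseF a x + raiseF a y.
Proof.
rewrite /raiseF; set p := rho (psi _ _ _ _ _ _); set z := q ^ (- _).
rewrite [(p \o (_ + _))%VF]comp_lfunDr -[(p \o (_ *: _))%VF]comp_lfunZr.
rewrite [((_ + _) \o p)%VF]comp_lfunDl -[((_ *: _) \o p)%VF]comp_lfunZl.
have -> : b *: (p \o x)%VF + (p \o y)%VF - z *: (b *: (x \o p)%VF + (y \o p)%VF) =
    b *: ((p \o x)%VF - z *: (x \o p)%VF) + ((p \o y)%VF - z *: (y \o p)%VF).
  by rewrite scalerDr opprD addrACA scalerBr !scalerA [z * b]mulrC.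
rewrite [(_ \o (b *: _ + _))%VF]comp_lfunDr -[(_ \o (b *: _))%VF]comp_lfunZr.
by rewrite scalerDr !scalerA mulrC.
Qed.

(** Applying [raiseF] to a linear relation between finitely many f_a[m] shifts it.
    The powers of z account for the arguments q^c t of the currents. *)
Lemma F_recurrent a (z : C) : z != 0 ->
  exists2 e : {poly C}, e`_0 = 1 & recurrent (fun m => z ^+ m *: rho (F a m%:Z)) e.
Proof.
move=> z0; have [J [b0 hJ]] := linear_dependence (fun j => rho (F a j.+1%:Z)).
pose b j := if insub j is Some i then b0 i else 0.
have hb m : rho (F a (J + m).+1%:Z) = \sum_(j < J) b j *: rho (F a (j + m).+1%:Z).
  elim: m => [|m IH].
    by rewrite addn0 hJ; apply: eq_bigr => j _; rewrite /b valK addn0.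
  have rF j : rho (F a (j + m.+1).+1%:Z) = raiseF a (rho (F a (j + m).+1%:Z)).
    by rewrite raiseF_F addnS; congr (rho (F a _)); lia.
  have rf0 : raiseF a 0 = 0.
    by have := raiseF_lin a (-1) 0 0; rewrite scaler0 addr0 scaleN1r addNr.
  rewrite rF IH; elim/big_rec2: _ => [//|j x y _ <-].
  by rewrite raiseF_lin -rF.
exists (\poly_(i < J.+1) (if i is i'.+1 then - (b (J - i)%N * z ^+ i) else 1)).
  by rewrite coef_poly.
exists J.+1 => Z hZ; set e := \poly_(i < _) _.
rewrite (@sum_trunc _ (fun j => e`_j *: extz (fun m => z ^+ m *: rho (F a m%:Z)) (Z - j%:Z)) _ J.+1).
- have [m Zm] : exists m, Z = (J + m).+1%:Z by exists (`|Z| - J.+1)%N; lia.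
  rewrite big_ord_recl coef_poly /= scale1r subr0 Zm [X in X + _]/=.
  apply/eqP; rewrite addrC addr_eq0 hb scaler_sumr -sumrN; apply/eqP.
  rewrite (reindex_inj rev_ord_inj) /=; apply: eq_bigr => j _.
  have jJ := ltn_ord j; rewrite coef_poly /= /bump leq0n add1n ltnS.
  have -> : ((J - j.+1).+1 <= J)%N by lia.
  have -> : (J - (J - j.+1).+1 = j)%N by lia.
  have -> : (J + m).+1%:Z - (J - j.+1).+1%:Z = (j + m).+1%:Z by lia.
  rewrite /= scaleNr !scalerA; congr (- (_ *: _)); rewrite -mulrA -exprD mulrC.
  by congr (_ ^+ _ * _); lia.
- by move=> j hj; rewrite nth_default ?scale0r.
- by move=> j hj; rewrite coef_poly ltnNge hj scale0r.
Qed.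

Definition wordv n (w : seq (letter r n)) (k : {ffun 'I_n -> int}) : V :=
  rho (word_ser X w (- k)) v.

(** The first letter of a word contributes the polynomial of its recurrence, at its
    own variable; it is put at all the variables to keep the same d for all. *)
Lemma word_rational n (w : seq (letter r n)) :
  exists2 d : {poly C}, d`_0 = 1 & bounded (mulser (allX n d) (wordv w)).
Proof.
elim: w => [|[[[a z] i]|a] w [d d0 IH]].
- exists 1; first by rewrite coefC.
  rewrite allX1; exists 0%N => k i ki; rewrite mulser1p /wordv /= /one_ser.
  case: eqP => [/kextP/(_ i)|]; last by rewrite linear0 zero_lfunE.
  by rewrite !kE; lia.
- have [e e0 re] := F_recurrent a (z := q ^ (- z)) (expfz_neq0 _ q0).
  exists (e * d); first by rewrite coef0M e0 d0 mulr1.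
  have [|||N HN] := conv_mulser (f := fun m => (q ^ (- z)) ^+ m *: rho (F a m%:Z)) (i := i)
      (D := allX n d) (G := wordv w) (H := wordv (inl (a, z, i) :: w)) _ _ _ IH.
  + by move=> k l kl; rewrite /wordv (word_ser_pos _ (i := l)) ?linear0 ?zero_lfunE // kE; lia.
  + by move=> k kl; rewrite /wordv (word_ser_pos _ (i := i)) ?linear0 ?zero_lfunE // kE; lia.
  + move=> k ki; rewrite /wordv /= linear_sum sum_lfunE kE abszN.
    apply: eq_bigr => m _; rewrite linearZ /= !scale_lfunE rhoM (exprnP (q ^ (- z)) m) exprz_exp mulNr.
    congr (_ *: _); congr (rho _ _); congr (rho (word_ser X w _) v); apply/kextP => l.
    rewrite !kE ffunMnE uexpE pmulrn mulrzz; case: eqP => _; lia.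
  rewrite allXM {1}/allX (bigD1 i) //= [atX i e * _]mulrC -mulrA.
  apply: (@eq_bounded _ _ (mulser (\prod_(j < n | j != i) atX j e)
    (mulser (atX i e) (mulser (allX n d) (wordv (inl (a, z, i) :: w)))))).
    by move=> k; rewrite [RHS]mulserM; apply: eq_mulser => l; rewrite [RHS]mulserM.
  by apply: bounded_mulser; apply: conv_bounded re IH HN.
- exists d => //; have [b hb] := IH; exists b => k i ki.
  transitivity (rho (F a 0) (mulser (allX n d) (wordv w) k)); last by rewrite (hb _ i) ?linear0.
  rewrite -(mulser_map (f := rho (F a 0))) => [|c x y]; last exact: linearP.
  by apply: eq_mulser => l; rewrite /wordv /= rhoM.
Qed.

Definition qlinform n (c : 'I_n -> 'I_r) (x y : 'I_n) : {mpoly C[n]} := linform (x, y, qform c x y).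

(** Up to a scalar and a monomial, the forms in the u_i = 1 / t_i are forms in the
    t_i. *)
Lemma pair_inv n (c : 'I_n -> 'I_r) : exists M a, forall (s : ser n V) k,
  mulser (pairprod (qlinform c) (enum 'I_n)) (fun k => s (- k)) k =
  a *: mulser (weight_den q g c) s (M - k).
Proof.
pose Q (p p' : {mpoly C[n]}) := exists M a, forall (s : ser n V) k,
  mulser p (fun k => s (- k)) k = a *: mulser p' s (M - k).
rewrite pairprod_enum /weight_den -[exists M, _]/(Q _ _).
have Q1 : Q 1 1 by exists 0, 1 => s k; rewrite !mulser1p scale1r add0r.
have QM p1 p1' p2 p2' : Q p1 p1' -> Q p2 p2' -> Q (p1 * p2) (p1' * p2').
  move=> [M1 [a1 h1]] [M2 [a2 h2]]; exists (M1 + M2), (a2 * a1) => s k.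
  rewrite mulserM (eq_mulser _ (h2 s)) mulserZs -scalerA; congr (_ *: _).
  rewrite (eq_mulser _ (s' := fun k => (fun l => mulser p2' s (l + M2)) (- k))) => [|l]; last by rewrite addrC.
  by rewrite (h1 (fun l => mulser p2' s (l + M2))) mulser_shift -mulserM addrAC.
apply: (big_ind2 Q) => // i _; apply: (big_ind2 Q) => // j _.
exists (uexp i + uexp j), (- qform c i j) => s k.
rewrite mulser_linform mulserDp mulserNp mulserZp !mulserX -invr_expz -/(qform c i j).
have -> : uexp i + uexp j - k - uexp i = - (k - uexp j).
  by rewrite addrAC [_ + uexp j]addrC addrK opprB.
have -> : uexp i + uexp j - k - uexp j = - (k - uexp i) by rewrite addrAC addrK opprB.
by rewrite scalerBr scalerA mulNr divff ?qform_neq0 // scaleN1r opprK scaleNr [RHS]addrC.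
Qed.

(** The translation by M is the monomial that relates forms in t and in u. *)
Lemma words_rational n (l : seq ({mpoly C[n]} * seq (letter r n))) :
  exists2 d : {poly C}, d`_0 = 1 &
    forall M, bounded (mulser (allX n d) (fun k => \sum_(c <- l) mulser c.1 (fun k => rho (word_ser X c.2 k) v) (M - k))).
Proof.
elim: l => [|[Q w] l [d d0 IH]].
  exists 1; first by rewrite coefC.
  by move=> M; exists 0%N => k i _; rewrite mulser0s // => ?; rewrite big_nil.
have [e e0 hw] := word_rational w.
exists (e * d) => [|M]; first by rewrite coef0M e0 d0 mulr1.
apply: (@eq_bounded _ _ (fun k =>
    mulser (allX n d) (mulser (allX n e) (fun k => mulser Q (fun k => rho (word_ser X w k) v) (M - k))) k +
    mulser (allX n e) (mulser (allX n d) (fun k => \sum_(c <- l) mulser c.1 (fun k => rho (word_ser X c.2 k) v) (M - k))) k)).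
  move=> k; rewrite allXM -!mulserM [allX n d * _]mulrC -mulserDs; apply: eq_mulser => k'.
  by rewrite big_cons.
have b1 : bounded (mulser (allX n e) (fun k => mulser Q (fun k => rho (word_ser X w k) v) (M - k))).
  apply: (@eq_bounded _ _ (fun k => \sum_(m <- msupp Q) Q@_m *: mulser (allX n e) (wordv w) (k + (mexp m - M)))).
    move=> k; under eq_bigr do rewrite -mulser_shift.
    rewrite -mulser_sum; apply: eq_mulser => k'; apply: eq_bigr => m _.
    by rewrite /wordv opprD opprB addrCA addrA.
  by apply: bounded_comb => m; apply: bounded_shift.
have [b hb] := bounded_mulser (allX n d) b1.
have [b' hb'] := bounded_mulser (allX n e) (IH M).
exists (maxn b b') => k i; rewrite gtn_max => /andP[ki ki'].
by rewrite (hb _ i) // (hb' _ i) // addr0.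
Qed.

Lemma wser_rational n (c : 'I_n -> 'I_r) : exists2 d : {poly C}, d`_0 = 1 &
  bounded (mulser (allX n d) (mulser (pairprod (qlinform c) (enum 'I_n)) (wser c (enum 'I_n)))).
Proof.
have [_ [l [_ hl]]] := conj_W c; have [M [a hM]] := pair_inv c.
have [d d0 hd] := words_rational l; exists d => //.
have [b hb] := hd M; exists b => k i ki.
rewrite (eq_mulser _ (s' := fun k => a *: \sum_(c <- l) mulser c.1 (fun k => rho (word_ser X c.2 k) v) (M - k))).
  by rewrite mulserZs (hb _ i) ?scaler0.
move=> k'; rewrite (eq_mulser _ (s' := fun k => (fun k => rho (weight_fun X P c k) v) (- k))); last exact: wser_weight_fun.
rewrite (hM (fun k => rho (weight_fun X P c k) v)); congr (_ *: _).
rewrite (mulser_map (f := fun u => rho u v)) => [|z x y]; last by rewrite linearP /= add_lfunE scale_lfunE.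
rewrite hl linear_sum sum_lfunE; apply: eq_bigr => x _.
by rewrite (mulser_map (f := fun u => rho u v)) // => z x' y; rewrite linearP /= add_lfunE scale_lfunE.
Qed.

End Weight.

(** * The symmetric numerators *)

Section Numerators.
Variables (C : fieldType) (r : nat) (qc : 'I_r -> 'I_r -> C).
Hypothesis two0 : 2%:R != 0 :> C.
Variable w : forall n, ('I_n -> 'I_r) -> seq 'I_n -> ser n C^o.

Definition cform n (c : 'I_n -> 'I_r) (x y : 'I_n) : {mpoly C[n]} :=
  linform (x, y, qc (c x) (c y)).

Hypothesis w_exchange : forall n (c : 'I_n -> 'I_r) s1 x y s2 k, uniq (s1 ++ x :: y :: s2) ->
  mulser (cform c x y) (w c (s1 ++ x :: y :: s2)) k =
  - mulser (cform c y x) (w c (s1 ++ y :: x :: s2)) k.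
Hypothesis w_first : forall n (c : 'I_n -> 'I_r) x s (k : {ffun 'I_n -> int}),
  (k x <= 0)%O -> w c (x :: s) k = 0.
Hypothesis w_map : forall n n' (f : 'I_n -> 'I_n') (c : 'I_n' -> 'I_r) c' s k,
  (forall x, c' x = c (f x)) -> w c (map f s) k = w c' s (kcomp f k).

(** These forms turn the exchange relations into changes of sign. *)
Definition numer n (c : 'I_n -> 'I_r) s : ser n C^o := mulser (pairprod (cform c) s) (w c s).

Lemma numer_swap n (c : 'I_n -> 'I_r) s1 x y s2 k : uniq (s1 ++ x :: y :: s2) ->
  numer c (s1 ++ x :: y :: s2) k = - numer c (s1 ++ y :: x :: s2) k.
Proof.
move=> us; rewrite /numer.
have [p [-> ->]] := pairprod_swap (cform c) s1 x y s2.
rewrite !mulserM -mulserNs; apply: eq_mulser => l; exact: w_exchange.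
Qed.

Lemma rename_pairprod n n' (f : 'I_n -> 'I_n') (c : 'I_n' -> 'I_r) c' s :
  (forall x, c' x = c (f x)) ->
  pairprod (cform c) (map f s) = rename f (pairprod (cform c') s).
Proof.
move=> cc; rewrite pairprod_map [RHS]rmorph_pairprod; apply: eq_pairprod => x y.
by rewrite /cform /linform /= cc cc rmorphB /= renameZ !renameX.
Qed.

Lemma numer_map n n' (f : 'I_n -> 'I_n') (c : 'I_n' -> 'I_r) c' s k :
  injective f -> (forall x, c' x = c (f x)) -> numer c (map f s) k = numer c' s (kcomp f k).
Proof.
move=> finj cc; rewrite /numer (rename_pairprod _ cc).
by apply: mulser_rename => // l; apply: w_map.
Qed.

Lemma perm_swap n s1 (x y : 'I_n) s2 s :
  perm_eq (s1 ++ x :: y :: s2) s -> perm_eq (s1 ++ y :: x :: s2) s.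
Proof.
by move=> /seq.permP e; apply/seq.permP => p; rewrite -e !count_cat /=; lia.
Qed.

Lemma order_ind n (Q : seq 'I_n -> Prop) :
  (forall s1 x y s2, uniq (s1 ++ x :: y :: s2) -> Q (s1 ++ x :: y :: s2) -> Q (s1 ++ y :: x :: s2)) ->
  forall s s', perm_eq s (enum 'I_n) -> perm_eq s' (enum 'I_n) -> Q s -> Q s'.
Proof.
move=> H s s' ps ps' qs.
have ss' : perm_eq s s' by rewrite (perm_trans ps) // perm_sym.
have [//|_ //] := swap_ind (Q := fun s => Q s /\ perm_eq s (enum 'I_n)) _ ss' (conj qs ps).
move=> s1 x y s2 [q p]; split; last exact: perm_swap.
by apply: H => //; rewrite (perm_uniq p) enum_uniq.
Qed.

Lemma perm_front n (x : 'I_n) : perm_eq (x :: rem x (enum 'I_n)) (enum 'I_n).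
Proof. by rewrite perm_sym perm_to_rem // mem_enum. Qed.

(** Up to sign x may be brought to the first place. *)
Lemma numer_pos n (c : 'I_n -> 'I_r) s (k : {ffun 'I_n -> int}) x :
  perm_eq s (enum 'I_n) -> (k x <= 0)%O -> numer c s k = 0.
Proof.
move=> ps; move: k; apply: (order_ind (Q := fun s => forall k : {ffun 'I_n -> int}, (k x <= 0)%O ->
  numer c s k = 0) _ (perm_front x) ps).
  move=> s1 y z s2 us h k kx; have := numer_swap c k us; rewrite h // => /eqP.
  by rewrite eq_sym oppr_eq0 => /eqP.
move=> k kx; rewrite /numer /mulser big1 // => m _.
by rewrite w_first ?scaler0 // !kE; lia.
Qed.

(** ** Divisibility by the Vandermonde factors *)

Section Fixed.
Variables (n : nat) (c : 'I_n -> 'I_r) (d : {poly C}).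
Hypothesis w_rat : bounded (mulser (allX n d) (numer c (enum 'I_n))).

Let D := allX n d.

Lemma numer_poly : exists B, mulser D (numer c (enum 'I_n)) =1 toser B.
Proof.
apply: bounded_poly => // k i ki; rewrite /mulser big1 // => m _.
by rewrite (@numer_pos _ c _ _ i) ?scaler0 // !kE; lia.
Qed.

(** The sign for different colours makes the product over all pairs change sign
    under all exchanges, as [numer] does. *)
Definition vfactor (x y : 'I_n) : {mpoly C[n]} :=
  if c x == c y then 'X_x - 'X_y else if (c x < c y)%N then 1 else -1.

Lemma vfactorC x y : vfactor x y = - vfactor y x.
Proof.
rewrite /vfactor eq_sym; case: eqP => [_|/eqP ne]; first by rewrite opprB.
by move: ne; rewrite -val_eqE /=; case: ltngtP => // _ _; rewrite ?opprK.
Qed.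

Lemma numer_sign B s : mulser D (numer c (enum 'I_n)) =1 toser B -> perm_eq s (enum 'I_n) ->
  exists b : bool, mulser D (numer c s) =1 toser ((-1) ^+ b * B).
Proof.
move=> hB ps.
apply: (order_ind (Q := fun s => exists b : bool,
  mulser D (numer c s) =1 toser ((-1) ^+ b * B)) _ (perm_refl _) ps).
  move=> s1 x y s2 us [b hb]; exists (~~ b) => k.
  rewrite -[~~ b]addTb signr_addb expr1 mulN1r mulNr [RHS]mulserNp -[mulser _ _ k in RHS]/(toser _ k) -hb.
  by rewrite -mulserNs; apply: eq_mulser => l; rewrite (numer_swap _ _ us) opprK.
by exists false => k; rewrite expr0 mul1r hB.
Qed.

Lemma rename_allX n1 n2 (f : 'I_n1 -> 'I_n2) : bijective f -> rename f (allX n1 d) = allX n2 d.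
Proof.
move=> [h fK hK]; rewrite rmorph_prod /allX [RHS](reindex f) /=; last first.
  by exists h => z _; [apply: fK | apply: hK].
apply: eq_bigr => i _; rewrite !atXE rmorph_sum /=; apply: eq_bigr => j _.
by rewrite renameZ rmorphXn /= renameX.
Qed.

(** Exchanging the labels x and y exchanges two neighbours in a suitable order,
    hence changes the sign of B. *)
Lemma numer_diag B x y : x != y -> c x = c y ->
  mulser D (numer c (enum 'I_n)) =1 toser B -> elim1 x 'X_y B = 0.
Proof.
move=> nxy cxy hB; pose rest := rem y (rem x (enum 'I_n)).
have p1 : perm_eq (x :: y :: rest) (enum 'I_n).
  have e1 := perm_front x; have e2 : perm_eq (y :: rest) (rem x (enum 'I_n)).
    by rewrite perm_sym perm_to_rem // (mem_rem_uniq _ (enum_uniq _)) // inE eq_sym nxy mem_enum.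
  by rewrite (perm_trans _ e1) // perm_cons.
have [b hb] := numer_sign hB p1.
pose t := tperm x y.
have tc z : c z = c (t z) by rewrite /t; case: tpermP => // ->.
have p2 : perm_eq (y :: x :: rest) (enum 'I_n) by exact: (perm_swap (s1 := [::])).
have u1 : uniq (x :: y :: rest) by rewrite (perm_uniq p1) enum_uniq.
have mt : map t (x :: y :: rest) = y :: x :: rest.
  rewrite /= tpermL tpermR; congr [:: _, _ & _]; rewrite -[RHS]map_id; apply/eq_in_map => z zr.
  move: u1; rewrite /= inE => /and3P[/norP[_ xr] yr _].
  by rewrite tpermD //; [apply: contraNneq xr => -> | apply: contraNneq yr => ->].
have e : rename t ((-1) ^+ b * B) = - ((-1) ^+ b * B).
  apply: toser_inj => k; rewrite toser_rename; last by exists t; apply: tpermK.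
  rewrite [RHS]mulserNp -[mulser _ _ k]/(toser _ k) -!hb.
  have tb : bijective t by exists t; apply: tpermK.
  have -> : mulser D (numer c (x :: y :: rest)) (kcomp t k) = mulser D (numer c (y :: x :: rest)) k.
    rewrite -mt /D -{2}(rename_allX tb) [RHS](mulser_rename _ (s := numer c (x :: y :: rest))) //.
      exact: perm_inj.
    by move=> l; apply: numer_map => //; apply: perm_inj.
  rewrite -mulserNs; apply: eq_mulser => l; apply: (numer_swap c l (s1 := [::])).
  by rewrite (perm_uniq p2) enum_uniq.
have {}e : rename t B = - B.
  move: e; rewrite rmorphM rmorphXn rmorphN rmorph1 -mulrN.
  by apply: mulfI; rewrite signr_eq0.
have : elim1 x 'X_y (rename t B) = elim1 x 'X_y B.
  rewrite /elim1 /rename msub_comp; apply: eq_msub => i.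
  rewrite msubX; case: (tpermP x y i) => [->|->|_ _]; rewrite ?eqxx //; by case: ifP.
rewrite e /elim1 rmorphN /= => /eqP; rewrite eq_sym -addr_eq0 -mulr2n -mulr_natl mulf_eq0.
by rewrite -mpolyC_nat mpolyC_eq0 (negPf two0) => /eqP.
Qed.

(** The pair (x, x) stands for the form X_x, and (x, y) for X_x - X_y. *)
Definition dform (t : 'I_n * 'I_n) : {mpoly C[n]} := if t.1 == t.2 then 0 else 'X_t.2.
Definition dpairs : seq ('I_n * 'I_n) :=
  [seq t : 'I_n * 'I_n <- enum {: 'I_n * 'I_n} | (t.1 == t.2) || (t.1 < t.2)%N && (c t.1 == c t.2)].

Lemma dform_elim_neq0 t t' : t \in dpairs -> t' \in dpairs -> t != t' ->
  elim1 t.1 (dform t) ('X_t'.1 - dform t') != 0.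
Proof.
case: t t' => [i j] [k l]; rewrite !mem_filter => /andP[+ _] /andP[+ _]; rewrite /dform /= xpair_eqE.
rewrite /elim1 rmorphB /= -!/(elim1 _ _ _) elim1X.
have [<-{j} _|nij /= /andP[ij _]] := eqVneq i j; have [<-{l} _|nkl /= /andP[kl _]] := eqVneq k l;
  rewrite /elim1 ?rmorph0 ?subr0 -?/(elim1 _ _ _) ?elim1X => ne.
- by case: (eqVneq k i) ne => _ ne; rewrite ?eqxx ?mX_neq0.
- case: (eqVneq k i) kl => [->|ki] kl; first by case: (eqVneq l i) kl => [->|_ _]; rewrite ?ltnn ?sub0r ?oppr_eq0 ?mX_neq0.
  by case: (eqVneq l i) => _; rewrite ?subr0 ?mX_neq0 ?mXB_neq0.
- by case: (eqVneq k i) => _; rewrite mX_neq0.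
- case: (eqVneq k i) ne kl => [->|ki] ne kl.
    rewrite /= in ne; have /negPf-> : l != i by apply: contraTneq kl => ->; rewrite ltnn.
    exact: mXB_neq0.
  case: (eqVneq l i) kl => [->|li] kl; last exact: mXB_neq0.
  by apply: mXB_neq0; apply: contraTneq (ltn_trans kl ij) => ->; rewrite ltnn.
Qed.

Definition vsame : {mpoly C[n]} :=
  \prod_(i < n) \prod_(j < n | (i < j)%N && (c i == c j)) ('X_i - 'X_j).

Lemma prod_dform : \prod_(t <- dpairs) ('X_t.1 - dform t) = (\prod_i 'X_i) * vsame.
Proof.
rewrite big_filter big_enum_cond /=.
rewrite -(pair_big_dep xpredT (fun i j : 'I_n => (i == j) || (i < j)%N && (c i == c j))
   (fun i j : 'I_n => 'X_i - dform (i, j))) /= /vsame -big_split; apply: eq_bigr => i _ /=.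
rewrite (bigD1 i) ?eqxx //= /dform /= eqxx subr0; congr (_ * _).
apply: eq_big => [j|j /andP[_ ji]]; last by rewrite eq_sym (negPf ji).
by case: eqVneq => [->|ji]; rewrite ?ltnn ?andbF // andbT.
Qed.

Definition vsign : {mpoly C[n]} :=
  \prod_(i < n) \prod_(j < n | (i < j)%N) (if (c i <= c j)%N then 1 else -1).

Lemma vfactor_enum : pairprod vfactor (enum 'I_n) = vsign * vsame.
Proof.
rewrite pairprod_enum /vsign /vsame -big_split; apply: eq_bigr => i _ /=.
rewrite [X in _ * X]big_mkcondr -big_split; apply: eq_bigr => j _ /=.
rewrite /vfactor; case: eqP => [->|/eqP]; first by rewrite leqnn mul1r.
by rewrite mulr1 ltn_neqAle -val_eqE /= => ->.
Qed.

Lemma vsign_sqr : vsign * vsign = 1.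
Proof.
rewrite /vsign -big_split big1 // => i _; rewrite /= -big_split big1 // => j _ /=.
by case: ifP; rewrite ?mulr1 // mulrNN mulr1.
Qed.

(** Both sides change sign under exchanges, so that it suffices to consider one
    order. *)
Lemma numer_factor : exists N, forall s, perm_eq s (enum 'I_n) ->
  mulser D (numer c s) =1 toser ((\prod_i 'X_i) * pairprod vfactor s * N).
Proof.
have [B hB] := numer_poly.
have [||| N0 BE] := @dvd_prod_elim1 _ _ _ dpairs (fun t => t.1) dform B.
- by rewrite filter_uniq // enum_uniq.
- by move=> t t'; apply: dform_elim_neq0.
- case=> i j; rewrite mem_filter => /andP[+ _]; rewrite /dform /=.
  have [<-{j} _|nij /= /andP[ij /eqP cij]] := eqVneq i j; last exact: numer_diag.
  rewrite /elim1 /msub /mmap big_seq big1 // => m mB.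
  have mi : m i != 0%N.
    apply: contraTneq mB => mi; rewrite mcoeff_msupp negbK -toserE -hB.
    rewrite /mulser big1 // => l _; rewrite (@numer_pos _ c _ _ i) ?scaler0 // !kE mi; lia.
  by rewrite /mmap1 (bigD1 i) //= eqxx expr0n (negPf mi) mul0r mulr0.
exists (vsign * N0) => s ps.
apply: (order_ind (Q := fun s => mulser D (numer c s) =1
  toser ((\prod_i 'X_i) * pairprod vfactor s * (vsign * N0))) _ (perm_refl _) ps).
  move=> s1 x y s2 us h k; have [p [e e']] := pairprod_swap vfactor s1 x y s2.
  transitivity (- mulser D (numer c (s1 ++ x :: y :: s2)) k).
    by rewrite -mulserNs; apply: eq_mulser => l; rewrite (numer_swap _ _ us) opprK.
  by rewrite h e e' vfactorC /toser -mulserNp; congr (mulser _ _ _); ring.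
move=> k; rewrite hB BE prod_dform vfactor_enum; congr (toser _ k).
by rewrite -[LHS]mul1r -vsign_sqr; ring.
Qed.

End Fixed.

(** ** Relabelling *)

(** The fraction N / \prod_i d(X_i) is the function \overline w of the theorem. *)
Definition numerator n (c : 'I_n -> 'I_r) (d : {poly C}) (N : {mpoly C[n]}) :=
  forall s, perm_eq s (enum 'I_n) ->
    mulser (allX n d) (numer c s) =1 toser ((\prod_i 'X_i) * pairprod (vfactor c) s * N).

Lemma numerator_rename n n' (f : 'I_n -> 'I_n') (c : 'I_n' -> 'I_r) c' d N :
  bijective f -> (forall x, c' x = c (f x)) -> numerator c' d N -> numerator c d (rename f N).
Proof.
move=> bf cc hN s ps; have [h fK hK] := bf.
have pe : perm_eq (map h s) (enum 'I_n).
  apply: uniq_perm; rewrite ?enum_uniq ?map_inj_uniq ?(perm_uniq ps) ?enum_uniq //.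
    exact: can_inj hK.
  by move=> x; rewrite mem_enum -(fK x) map_f // (perm_mem ps) mem_enum.
have sE : s = map f (map h s) by rewrite mapK.
move=> k; rewrite {1}sE -(rename_allX d bf).
rewrite (mulser_rename _ (s := numer c' (map h s))) => [||l]; last 2 first.
- exact: bij_inj.
- by apply: numer_map => //; apply: bij_inj.
rewrite hN // -toser_rename //; congr (toser _ k).
rewrite !rmorphM; congr (_ * _ * _).
  rewrite rmorph_prod [RHS](reindex f) /=; last by exists h => z _; [apply: fK | apply: hK].
  by apply: eq_bigr => i _; rewrite renameX.
rewrite rmorph_pairprod {2}sE [RHS]pairprod_map; apply: eq_pairprod => x y.
rewrite /vfactor !cc; case: ifP => _; first by rewrite rmorphB /= !renameX.
by case: ifP => _; rewrite ?rmorphN ?rmorph1.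
Qed.

Lemma vfactor_neq0 n (c : 'I_n -> 'I_r) x y : x != y -> vfactor c x y != 0.
Proof.
move=> nxy; rewrite /vfactor; case: ifP => _; first exact: mXB_neq0.
by case: ifP => _; rewrite ?oppr_eq0 oner_eq0.
Qed.

Lemma numerator_uniq n (c : 'I_n -> 'I_r) d N N' :
  numerator c d N -> numerator c d N' -> N = N'.
Proof.
move=> h h'; have p := perm_refl (enum 'I_n).
have : (\prod_i 'X_i) * pairprod (vfactor c) (enum 'I_n) * N =
       (\prod_i 'X_i) * pairprod (vfactor c) (enum 'I_n) * N'.
  by apply: toser_inj => k; rewrite -h // -h'.
apply: mulfI; rewrite mulf_neq0 //; first by apply/prodf_neq0 => i _; apply: mX_neq0.
by apply: pairprod_neq0 (enum_uniq _) _; apply: vfactor_neq0.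
Qed.

Lemma numerator_sym n (c : 'I_n -> 'I_r) d N (f : 'I_n -> 'I_n) :
  bijective f -> (forall x, c (f x) = c x) -> numerator c d N -> rename f N = N.
Proof.
by move=> bf cf hN; apply: numerator_uniq (hN); apply: numerator_rename hN => // x; rewrite cf.
Qed.

End Numerators.

(** * The Serre relations force zeros of the numerators *)

Section SerreOrders.
Variable m : nat.

(** The nodes i < m are the variables of the first colour, and ord_max is the one
    of the second colour. *)
Definition node_order (p : nat) (sg : 'S_m) : seq 'I_m.+1 :=
  serre_list (widen_ord (leqnSn m)) ord_max p sg.

Lemma map_node_order n (nd : 'I_m.+1 -> 'I_n) p sg :
  map nd (node_order p sg) = serre_list (fun i => nd (widen_ord (leqnSn m) i)) (nd ord_max) p sg.
Proof. by rewrite /node_order /serre_list map_cat /= -!map_comp. Qed.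

Lemma node_order_perm p sg : perm_eq (node_order p sg) (enum 'I_m.+1).
Proof.
have p1 : perm_eq (node_order p sg) (ord_max :: map (fun i => widen_ord (leqnSn m) (sg i)) (enum 'I_m)).
  rewrite /node_order /serre_list perm_catC /= perm_cons perm_catC -map_cat perm_map //.
  rewrite -[X in _ ++ X](eq_filter (a1 := predC (fun i : 'I_m => (i < p)%N))); first by rewrite perm_filterC.
  by move=> i; rewrite /= -leqNgt.
apply: uniq_perm; rewrite ?enum_uniq // ?(perm_uniq p1) ?(perm_mem p1) /=.
  rewrite map_inj_uniq ?enum_uniq ?andbT; last first.
    by move=> i j /(congr1 val) /= /val_inj /perm_inj.
  by apply/negP => /mapP[i _ /(congr1 val) /= e]; have := ltn_ord (sg i); rewrite -e ltnn.
move=> i; rewrite (perm_mem p1) mem_enum inE; have [//|im /=] := eqVneq i ord_max.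
have lti : (i < m)%N by have := ltn_ord i; rewrite ltnS leq_eqVlt => /predU1P[e|//]; case/eqP: im; apply: val_inj.
by apply/mapP; exists ((sg^-1)%g (Ordinal lti)); rewrite ?mem_enum // permKV; apply: val_inj.
Qed.

(** An order in which i comes before i + 1 for all i is 0, ..., m, which
    determines p and sg. *)
Lemma node_order_descent (p : 'I_m.+1) sg : (p, sg) != (ord_max, 1%g) ->
  exists2 i : nat, (i < m)%N &
    (index (inord i.+1) (node_order p sg) < index (inord i : 'I_m.+1) (node_order p sg))%N.
Proof.
move=> ne; set s := node_order p sg; have ps := node_order_perm p sg.
have us : uniq s by rewrite (perm_uniq ps) enum_uniq.
have sz : size s = m.+1 by rewrite (perm_size ps) size_enum_ord.
have ins z : z \in s by rewrite (perm_mem ps) mem_enum.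
pose f i := index (inord i : 'I_m.+1) s.
have [/existsP[i hi]|/existsPn h] := boolP [exists i : 'I_m, (f i.+1 < f i)%N]; first by exists i.
case/negP: ne; have lf i : (i < m)%N -> (f i < f i.+1)%N.
  move=> im; have := h (Ordinal im); rewrite -leqNgt leq_eqVlt => /predU1P[|//].
  rewrite /f /= => /(congr1 (nth ord0 s)); rewrite !nth_index // => /(congr1 val).
  by rewrite /= !inordK //; [lia | apply: ltnW].
have f1 i : (i <= m)%N -> (i <= f i)%N.
  by elim: i => // i IH im; have := lf i im; have := IH (ltnW im); lia.
have f2 j : (j <= m)%N -> (f (m - j) <= m - j)%N.
  elim: j => [|j IH] jm; first by rewrite subn0 -ltnS -sz index_mem.
  have := IH (ltnW jm); have := lf (m - j.+1)%N; rewrite (_ : (m - j.+1).+1 = m - j)%N; lia.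
have fi (i : 'I_m.+1) : index i s = i.
  rewrite -{1}(inord_val i) -/(f i); have := ltn_ord i; rewrite ltnS => im.
  by apply/eqP; rewrite eqn_leq f1 // andbT; have := f2 (m - i)%N (leq_subr _ _); rewrite subKn.
have s1 : size [seq widen_ord (leqnSn m) (sg i) | i : 'I_m <- enum 'I_m & (i < p)%N] = p.
  rewrite size_map size_filter -(count_map val (fun i => (i < p)%N)) val_enum_ord.
  rewrite -size_filter; have pm := ltn_ord p; rewrite ltnS in pm.
  by have := filter_iota_ltn 0 pm; rewrite add0n => ->; rewrite size_iota.
have pm : p = ord_max.
  apply: val_inj => /=; have /= := fi ord_max; rewrite /s /node_order /serre_list index_cat s1.
  case: ifP => [/mapP[i _ /(congr1 val) /= e]|_]; last by rewrite /= eqxx addn0.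
  by have := ltn_ord (sg i); rewrite -e ltnn.
apply/eqP; congr (_, _) => //; apply/permP => i; rewrite perm1; apply: val_inj => /=.
have := fi (widen_ord (leqnSn m) (sg i)); rewrite /= => e; rewrite -[LHS]e /s /node_order /serre_list.
have -> : [seq widen_ord (leqnSn m) (sg i) | i : 'I_m <- enum 'I_m & (i < p)%N] =
    map (fun i => widen_ord (leqnSn m) (sg i)) (enum 'I_m).
  by rewrite pm; congr map; apply/all_filterP/allP => j _; apply: ltn_ord.
pose F j := widen_ord (leqnSn m) (sg j); rewrite -/(F i) -[map _ _]/(map F (enum 'I_m)).
have Finj : injective F by move=> j k /(congr1 val) /= /val_inj /perm_inj.
by rewrite index_cat map_f ?mem_enum // index_map // index_enum_ord.
Qed.

Lemma node_order_id : node_order (ord_max : 'I_m.+1) 1%g = enum 'I_m.+1.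
Proof.
rewrite enum_ordSr -cats1 /node_order /serre_list.
have -> : [seq i : 'I_m <- enum 'I_m | (i < m)%N] = enum 'I_m.
  by apply/all_filterP/allP => j _; apply: ltn_ord.
rewrite (eq_filter (a2 := pred0)) => [|j]; last by rewrite leqNgt ltn_ord.
by rewrite filter_pred0; congr (_ ++ _); apply: eq_map => j; rewrite perm1.
Qed.

End SerreOrders.

Section Chain.
Variables (C : fieldType) (n : nat) (nd : nat -> 'I_n) (cc : nat -> C).
Implicit Type k : {ffun 'I_n -> int}.

Definition chain i l : seq ('I_n * C) := [seq (nd j, cc j) | j <- iota i.+1 l].

Lemma links_chain i l : links (nd i) (chain i l) = [seq (nd j, nd j.+1, cc j.+1) | j <- iota i l].
Proof. by elim: l i => //= l IH i; rewrite -IH. Qed.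

Lemma deep_chain B a i l k : deep B a (nd i) (chain i l) k ->
  forall j, (j < l)%N -> (B < a + \sum_(z <- iota i j.+1) k (nd z))%O.
Proof.
elim: l a i => // l IH a i /= /andP[h hd] j; case: j => [_|j jl]; first by rewrite /= big_seq1.
by have := IH _ _ hd j jl; rewrite [in X in _ -> X]/= big_cons addrA.
Qed.

Lemma degin_chain (l : seq nat) k : uniq (map nd l) ->
  degin (mem (map nd l)) k = \sum_(z <- l) k (nd z).
Proof. by move=> u; rewrite /degin -[RHS](big_map nd xpredT (fun z => k z)) big_uniq. Qed.

End Chain.

Section SerreVanish.
Variables (C : fieldType) (r : nat) (qc : 'I_r -> 'I_r -> C).
Hypothesis qc0 : forall s t, qc s t != 0.
Variable w : forall n, ('I_n -> 'I_r) -> seq 'I_n -> ser n C^o.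
Variables (n : nat) (c : 'I_n -> 'I_r).
Hypothesis w_dirfin : forall s x y, perm_eq s (enum 'I_n) -> (index x s < index y s)%N ->
  dirfin x y (w c s).

Variables (m : nat) (nd : 'I_m.+1 -> 'I_n) (coef : 'I_m.+1 -> C).
Hypothesis nd_inj : injective nd.
Hypothesis coef0 : coef ord_max != 0.
Hypothesis w_serre : forall rest k,
  \sum_p coef p *: \sum_sg w c (map nd (node_order p sg) ++ rest) k = 0.

(* b is q_s, for the colour s of the first m nodes. *)
Variable b : C.
Hypothesis b0 : b != 0.
Hypothesis b_inj : injective (fun e : int => b ^ e).
Variables s t : 'I_r.
Hypothesis st : s != t.
Hypothesis nd_s : forall i : 'I_m.+1, i != ord_max -> c (nd i) = s.
Hypothesis nd_t : c (nd ord_max) = t.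
Hypothesis qss : qc s s = b ^ 2.
Hypothesis qst : qc s t = b ^ (1 - m%:Z).
Hypothesis qts : qc t s = b ^ (1 - m%:Z).

Notation cf := (cform qc c).

(** On H the node i is b^(m - 1 - 2 i) times the last node. *)
Definition hratio (i : 'I_m.+1) : C := if i == ord_max then 1 else b ^ (m%:Z - 1 - 2 * i%:Z).

Definition onH (z : 'I_n) : {mpoly C[n]} :=
  if [pick i | nd i == z] is Some i then hratio i *: 'X_(nd ord_max) else 'X_z.

Lemma hratio_neq0 i : hratio i != 0.
Proof. by rewrite /hratio; case: ifP => _; rewrite ?oner_eq0 ?expfz_neq0. Qed.

Lemma onH_nd i : onH (nd i) = hratio i *: 'X_(nd ord_max).
Proof. by rewrite /onH; case: pickP => [j /eqP/nd_inj-> //|/(_ i)]; rewrite eqxx. Qed.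

Lemma onH_rest z : (forall i, nd i != z) -> onH z = 'X_z.
Proof. by move=> h; rewrite /onH; case: pickP => // i; rewrite (negPf (h i)). Qed.

(** The ordered pairs of nodes whose form vanishes on H. *)
Definition cyc (i j : 'I_m.+1) := (j == i.+1 :> nat) || (i == ord_max) && (j == ord0).

Lemma msub_cf_nd i j : msub onH (cf (nd i) (nd j)) =
  (hratio i - qc (c (nd i)) (c (nd j)) * hratio j) *: 'X_(nd ord_max).
Proof. by rewrite /cform /linform rmorphB /= msubZ !msubX !onH_nd scalerA scalerBl. Qed.

Lemma bE e e' : (b ^ e == b ^ e') = (e == e').
Proof. exact: inj_eq. Qed.

Lemma cf_onH0 (i : 'I_m.+1) (j : 'I_m.+1) : j = i.+1 :> nat ->
  onH (nd i) = qc (c (nd i)) (c (nd j)) *: onH (nd j).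
Proof.
move=> ji; rewrite !onH_nd scalerA; congr (_ *: _).
have im : i != ord_max by rewrite -val_eqE /=; have := ltn_ord j; lia.
rewrite (nd_s im) /hratio (negPf im); have [jm|jm] := eqVneq j ord_max.
  by rewrite jm nd_t qst mulr1; congr (b ^ _); have := congr1 val jm; rewrite /=; lia.
by rewrite nd_s // qss -expfzDr //; congr (b ^ _); lia.
Qed.

Lemma cf_onH_neq0 (i j : 'I_m.+1) : (j < i)%N -> ~~ cyc i j -> msub onH (cf (nd i) (nd j)) != 0.
Proof.
move=> ji; rewrite /cyc negb_or => /andP[_ nc].
rewrite msub_cf_nd scaler_eq0 negb_or mX_neq0 andbT subr_eq0.
have jm : j != ord_max by rewrite -val_eqE /=; have := ltn_ord i; lia.
rewrite (nd_s jm) /hratio (negPf jm); have [im|im] := eqVneq i ord_max.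
  rewrite im nd_t qts -expfzDr // -(expr0z b) bE.
  by move: nc; rewrite im eqxx /= -val_eqE /=; lia.
by rewrite nd_s // qss -expfzDr // bE; lia.
Qed.

Lemma onH_neq0 z : onH z != 0.
Proof.
by rewrite /onH; case: pickP => [i _|_]; rewrite ?scaler_eq0 ?negb_or ?hratio_neq0 mX_neq0.
Qed.

Lemma vfactor_onH_neq0 x y : x != y -> msub onH (vfactor C c x y) != 0.
Proof.
move=> nxy; rewrite /vfactor; have [cxy|_] := eqVneq (c x) (c y); last first.
  by case: (c x < c y)%N; rewrite ?rmorphN rmorph1 ?oppr_eq0 oner_eq0.
rewrite rmorphB /= !msubX.
have H z : (exists2 i, nd i = z & onH z = hratio i *: 'X_(nd ord_max)) \/ onH z = 1 *: 'X_z /\ forall i, nd i != z.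
  case: (pickP (fun i => nd i == z)) => [i /eqP <-|h].
    by left; exists i => //; exact: onH_nd.
  by right; split=> [|i]; rewrite ?scale1r ?h // onH_rest // => i; rewrite h.
have [[i iz ->]|[-> hx]] := H x; have [[j jz ->]|[-> hy]] := H y.
- rewrite -scalerBl scaler_eq0 negb_or mX_neq0 andbT subr_eq0.
  have ij : i != j by apply: contraNneq nxy => ij; rewrite -iz -jz ij.
  subst x y; rewrite /hratio; have [im|im] := eqVneq i ord_max.
    move: cxy; rewrite im nd_t nd_s; first by move=> e; case/eqP: st.
    by apply: contraNneq ij => ->; rewrite im.
  have [jm|jm] := eqVneq j ord_max.
    by move: cxy; rewrite jm nd_t (nd_s im) => e; case/eqP: st.
  by rewrite bE; move: ij; rewrite -val_eqE /=; lia.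
- by apply: ZX_neq0 (hy _); apply: hratio_neq0.
- by apply: ZX_neq0; rewrite ?oner_eq0 // eq_sym.
- exact: ZX_neq0 (oner_neq0 _) nxy.
Qed.

Let T : finType := ('I_m.+1 * 'S_m)%type.
Let nord (pr : T) := node_order pr.1 pr.2.
Let before (pr : T) (i j : 'I_m.+1) := (index i (nord pr) < index j (nord pr))%N.
Let rest := [seq z <- enum 'I_n | [forall i, nd i != z]].
Let full pr := map nd (nord pr) ++ rest.

Lemma full_perm pr : perm_eq (full pr) (enum 'I_n).
Proof.
have pn := node_order_perm pr.1 pr.2.
apply: uniq_perm; rewrite ?enum_uniq //.
  rewrite cat_uniq map_inj_uniq // (perm_uniq pn) enum_uniq filter_uniq ?enum_uniq // andbT /=.
  apply/hasPn => z; rewrite mem_filter => /andP[/forallP h _].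
  by apply/mapP => -[i _ zi]; have := h i; rewrite zi eqxx.
move=> z; rewrite mem_enum mem_cat mem_filter mem_enum andbT /=.
case: (pickP (fun i => nd i == z)) => [i /eqP<-|h].
  by rewrite map_f // (perm_mem pn) mem_enum.
by rewrite orbC; have -> : [forall i, nd i != z] by apply/forallP => i; rewrite h.
Qed.

Lemma full_index pr i j : before pr i j -> (index (nd i) (full pr) < index (nd j) (full pr))%N.
Proof.
have pn := node_order_perm pr.1 pr.2.
by rewrite /full !index_cat !map_f ?(perm_mem pn) ?mem_enum // !index_map.
Qed.

Lemma before_id i j : before (ord_max, 1%g) i j = (i < j)%N.
Proof. by rewrite /before /nord /= node_order_id !index_enum_ord. Qed.

Lemma pairprod_nodes pr : pairprod cf (map nd (nord pr)) =
  \prod_i \prod_(j | before pr i j) cf (nd i) (nd j).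
Proof.
have pn := node_order_perm pr.1 pr.2.
rewrite pairprod_map pairprod_index ?(perm_uniq pn) ?enum_uniq // (perm_big _ pn) big_enum /=.
by apply: eq_bigr => i _; rewrite (perm_big _ pn) big_enum_cond.
Qed.

Let nd' j := nd (inord j).
Let cc j := qc (c (nd' j.-1)) (c (nd' j)).
Let K i := mem (map nd' (iota 0 i.+1)).

Lemma nd'_uniq i : (i <= m)%N -> uniq (map nd' (iota 0 i.+1)).
Proof.
move=> im; rewrite map_inj_in_uniq ?iota_uniq // => a a'; rewrite !mem_iota !add0n !ltnS => ha ha'.
move=> /nd_inj /(congr1 val) /=.
by rewrite !inordK ?ltnS ?(leq_trans ha) ?(leq_trans ha').
Qed.

Lemma mem_K i (a : 'I_m.+1) : (i <= m)%N -> (nd a \in K i) = (a <= i)%N.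
Proof.
move=> im; apply/mapP/idP => [[j]|ai].
  rewrite mem_iota add0n ltnS => /= ji /nd_inj ->.
  by rewrite inordK // ltnS (leq_trans ji).
by exists (val a); rewrite ?mem_iota ?add0n ?ltnS // /nd' inord_val.
Qed.

Variables (d : {poly C}) (N : {mpoly C[n]}).
Hypothesis hN : numerator qc w c d N.

Let D := allX n d.
(* G0 consists of the factors common to all the orders of the nodes, g clears the
   denominators of the pairs that are not cyclic, and Q those of the cyclic pairs. *)
Let G0 := D * (pairprod cf rest * \prod_(a <- map nd (enum 'I_m.+1)) \prod_(z <- rest) cf a z).
Let g := \prod_i \prod_(j | (i != j) && ~~ cyc i j) cf (nd i) (nd j).
Let M pr := (\prod_i 'X_i) * pairprod (vfactor C c) (full pr) * N.
Let zs pr := mulser g (mulser G0 (w c (full pr))).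
Let g' pr := \prod_i \prod_(j | ((i != j) && ~~ cyc i j) && ~~ before pr i j) cf (nd i) (nd j).
Let Q pr := \prod_i \prod_(j | before pr i j && cyc i j) cf (nd i) (nd j).

Lemma full_numer pr k : mulser (pairprod cf (map nd (nord pr))) (mulser G0 (w c (full pr))) k = toser (M pr) k.
Proof.
rewrite -(hN (full_perm pr)) /numer -!mulserM; congr (mulser _ _ k).
rewrite /G0 /full pairprod_cat -(perm_big _ (perm_map nd (node_order_perm pr.1 pr.2))) /= /D.
by ring.
Qed.

Lemma zs_solve pr : mulser (Q pr) (zs pr) =1 toser (g' pr * M pr).
Proof.
move=> k; rewrite toserM -(eq_mulser _ (full_numer pr)) /zs -!mulserM.
congr (mulser (_ * _) _ k).
rewrite pairprod_nodes /Q /g /g' -!big_split; apply: eq_bigr => i _ /=.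
rewrite [X in _ * X = _](bigID (fun j => before pr i j)) /=.
rewrite [X in _ = _ * X](bigID (fun j => cyc i j)) /= mulrA mulrC; congr (_ * (_ * _)).
apply: eq_bigl => j; rewrite andbC /before; case: eqP => [->|]; by rewrite ?ltnn.
Qed.

Lemma zs_sum k : \sum_pr coef pr.1 *: zs pr k = 0.
Proof.
rewrite /zs -mulser_sum mulser0s // => k'; rewrite -mulser_sum mulser0s // => k''.
rewrite -[RHS](w_serre rest k''); rewrite -(pair_bigA _ (fun p sg => coef p *: w c (full (p, sg)) k'')) /=.
by apply: eq_bigr => p _; rewrite scaler_sumr.
Qed.

Lemma zs_dirfin pr i j : before pr i j -> dirfin (nd i) (nd j) (zs pr).
Proof.
by move=> ij; do 2 apply: dirfin_mulser; apply: w_dirfin (full_perm pr) (full_index ij).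
Qed.

(** If i + 1 comes before i, no pair in Q leads from the nodes 0, ..., i to the
    others. *)
Lemma zs_other pr : pr != (ord_max, 1%g) ->
  exists2 i, (i < m)%N & exists B, forall k, (B < degin (K i) k)%O -> zs pr k = 0.
Proof.
case: pr => p sg => /node_order_descent[i im hi]; exists i => //.
pose ts := [seq (nd ij.1, nd ij.2, qc (c (nd ij.1)) (c (nd ij.2))) |
  ij : 'I_m.+1 * 'I_m.+1 <- enum {: 'I_m.+1 * 'I_m.+1} & before (p, sg) ij.1 ij.2 && cyc ij.1 ij.2].
have QE : \prod_(t <- ts) linform t = Q (p, sg).
  rewrite /ts big_map big_filter big_enum_cond /=.
  by rewrite -(pair_big_dep xpredT (fun i j => before (p, sg) i j && cyc i j) (fun i j => cf (nd i) (nd j))).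
have [B hB] := bounded_degin (K i) (bounded_toser (g' (p, sg) * M (p, sg))).
exists B; apply: (@peel_list _ _ ts); last by move=> k hk; rewrite QE zs_solve hB.
move=> ? /mapP[[a a'] + ->]; rewrite mem_filter => /andP[/andP[/= bf cy] _].
split; [exact: qc0 | exact: zs_dirfin | rewrite -[(_ : bool) -> _]/(nd a \in K i -> nd a' \in K i)].
have im' := ltnW im; rewrite !mem_K // => ai; move: cy => /orP[/eqP a'a|/andP[/eqP am _]]; last first.
  by move: ai; rewrite am /= leqNgt im.
move: ai; rewrite leq_eqVlt => /predU1P[e|]; last by rewrite a'a.
move: bf; rewrite /before /nord /=.
have -> : a = inord i by apply: val_inj; rewrite /= inordK // ltnS ltnW.
have -> : a' = inord i.+1 by apply: val_inj; rewrite /= inordK // a'a e.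
by move=> bf; have := ltn_trans bf hi; rewrite ltnn.
Qed.

(** The Serre relation expresses this term by those of the other orders. *)
Lemma zs_deep : exists B, forall k, deep B 0 (nd' 0) (chain nd' cc 0 m) k -> zs (ord_max, 1%g) k = 0.
Proof.
have /fin_all_exists[B hB] : forall pr, exists B : int, forall k,
    (forall i, (i < m)%N -> (B < degin (K i) k)%O) -> pr != (ord_max, 1%g) -> zs pr k = 0.
  move=> pr; have [->|pr0] := eqVneq pr (ord_max, 1%g); first by exists 0.
  by have [i im [B hB]] := zs_other pr0; exists B => k /(_ i im) h _; apply: hB.
exists (\sum_pr `|B pr|) => k hd.
have dg i : (i < m)%N -> (\sum_pr `|B pr| < degin (K i) k)%O.
  by move=> im; rewrite degin_chain ?nd'_uniq 1?ltnW //; have := deep_chain hd im; rewrite add0r.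
have := zs_sum k; rewrite (bigD1 (ord_max, 1%g)) //= big1 ?addr0 => [/eqP|pr pr0].
  by rewrite scaler_eq0 (negPf coef0) => /eqP.
rewrite hB ?scaler0 // => i /dg; apply: Order.POrderTheory.le_lt_trans.
rewrite (bigD1 pr) //= (Order.POrderTheory.le_trans (Num.Theory.ler_norm _)) //.
by rewrite Num.Theory.lerDl Num.Theory.sumr_ge0.
Qed.

Lemma prod_links : \prod_(t <- links (nd' 0) (chain nd' cc 0 m)) linform t = Q (ord_max, 1%g).
Proof.
have iE : iota 0 m = index_iota 0 m by rewrite /index_iota subn0.
rewrite links_chain big_map iE big_mkord /Q big_ord_recr /=.
rewrite [X in _ = _ * X]big1 ?mulr1; last by move=> j; rewrite before_id ltnNge -ltnS ltn_ord.
apply: eq_bigr => i _; rewrite (big_pred1 (inord i.+1)) => [|j].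
  by rewrite /cform /cc /nd' /=; congr (linform (nd _, _, qc (c (nd _)) _)); apply: val_inj; rewrite /= inordK // ltnS ltnW.
rewrite before_id /cyc /= -[in RHS]val_eqE /= inordK ?ltnS //.
have -> : (widen_ord (leqnSn m) i == ord_max) = false by rewrite -val_eqE /=; have := ltn_ord i; lia.
by rewrite orbF; case: eqP => [->|]; rewrite ?ltnSn ?andbF.
Qed.

(** The forms of the chain 0, ..., m vanish on H, and the other factors of the
    polynomial in [zs_solve] do not. *)
Theorem serre_vanish : msub onH N = 0.
Proof.
have [B hB] := zs_deep.
have := cone_vanish (x := nd' 0) (ps := chain nd' cc 0 m) _ _ _ hB (h := onH).
rewrite prod_links => /(_ _ _ _ (zs_solve _)) H.
have {H} : msub onH (g' (ord_max, 1%g) * M (ord_max, 1%g)) = 0.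
  apply: H.
  - have -> : nd' 0 :: unzip1 (chain nd' cc 0 m) = map nd' (iota 0 m.+1).
      by rewrite /unzip1 /chain -map_comp.
    exact: nd'_uniq.
  - rewrite links_chain => ? /mapP[j + ->] /=; rewrite mem_iota add0n => /= jm; split; first exact: qc0.
    by apply: zs_dirfin; rewrite before_id !inordK // ltnS ltnW.
  - rewrite links_chain => ? /mapP[j + ->] /=; rewrite mem_iota add0n => /= jm.
    by apply: cf_onH0; rewrite !inordK // ltnS ltnW.
rewrite rmorphM /= => /eqP; rewrite mulf_eq0 => /orP[|].
  rewrite rmorph_prod prodf_seq_eq0 => /hasP[i _] /=; rewrite rmorph_prod prodf_seq_eq0 => /hasP[j _] /=.
  rewrite before_id => /andP[/andP[/andP[ij cij] ji]]; rewrite (negPf (cf_onH_neq0 _ cij)) //.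
  by rewrite ltn_neqAle leqNgt ji andbT eq_sym -val_eqE in ij *.
rewrite /M !rmorphM !mulf_eq0 => /orP[/orP[|]|/eqP //].
  by rewrite rmorph_prod prodf_seq_eq0 => /hasP[i _] /=; rewrite msubX (negPf (onH_neq0 i)).
rewrite rmorph_pairprod (negPf (pairprod_neq0 _ _)) // ?(perm_uniq (full_perm _)) ?enum_uniq //.
exact: vfactor_onH_neq0.
Qed.

End SerreVanish.

(** * Rational functions *)

Lemma frac_repr (R : idomainType) (G : {fraction R}) (n := generic_quotient.repr G) :
  tofrac (frac n).1 = G * tofrac (frac n).2.
Proof.
rewrite /n -[X in _ = X * _]generic_quotient.reprK; set x := generic_quotient.repr G.
rewrite /GRing.mul /= !generic_quotient.piE; apply/eqP.
rewrite generic_quotient.piE FracField.equivfE /FracField.mulf.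
by rewrite !numden_Ratio ?oner_eq0 ?mulf_neq0 ?oner_eq0 ?denom_ratioP // mulr1 mul1r mulrC.
Qed.

Section Fractions.
Variables (C : fieldType).

Definition mfrac N n (h : 'I_N -> ratfun C n) : {mpoly C[N]} -> ratfun C n := mmap (@rconst C n) h.

Lemma rconst_is_zmod n : zmod_morphism (@rconst C n).
Proof. by move=> x y; rewrite /rconst mpolyCB tofracB. Qed.
Lemma rconst_is_monoid n : monoid_morphism (@rconst C n).
Proof. by split=> [|x y]; rewrite /rconst ?mpolyC1 ?tofrac1 // mpolyCM tofracM. Qed.
HB.instance Definition _ n := GRing.isZmodMorphism.Build C (ratfun C n) (@rconst C n) (@rconst_is_zmod n).
HB.instance Definition _ n := GRing.isMonoidMorphism.Build C (ratfun C n) (@rconst C n) (@rconst_is_monoid n).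
HB.instance Definition _ N n (h : 'I_N -> ratfun C n) :=
  GRing.RMorphism.copy (mfrac h) (mmap (@rconst C n) h).

Lemma mfracX N n (h : 'I_N -> ratfun C n) i : mfrac h 'X_i = h i.
Proof. by rewrite /mfrac mmapX mmap1U. Qed.
Lemma mfracC N n (h : 'I_N -> ratfun C n) a : mfrac h a%:MP = rconst n a.
Proof. by rewrite /mfrac mmapC. Qed.

Lemma mfrac_rename N N' n (f : 'I_N -> 'I_N') (h : 'I_N' -> ratfun C n) (h' : 'I_N -> ratfun C n) p :
  (forall i, h' i = h (f i)) -> mfrac h' p = mfrac h (rename f p).
Proof.
move=> hh; elim/mpoly_ring_ind: p => [a|i|p p' e e'|p p' e e'].
- by rewrite /rename msubC !mfracC.
- by rewrite renameX !mfracX hh.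
- by rewrite !rmorphD /= e e'.
- by rewrite !rmorphM /= e e'.
Qed.

Lemma mfrac_var N p : mfrac (@rvar C N) p = tofrac p.
Proof.
elim/mpoly_ring_ind: p => [a|i|p p' e e'|p p' e e'].
- by rewrite mfracC.
- by rewrite mfracX.
- by rewrite !rmorphD /= e e'.
- by rewrite !rmorphM /= e e'.
Qed.

(** The fractions of the two representatives of G have the same image, as no
    denominator is mapped to 0. *)
Lemma rsubst_frac N n (h : 'I_N -> ratfun C n) a b :
  (forall p, p != 0 -> mfrac h p != 0) -> b != 0 ->
  rsubst h (tofrac a / tofrac b) = mfrac h a / mfrac h b.
Proof.
move=> hinj b0; set G : ratfun C N := _ / _; rewrite /rsubst -!/(mfrac h _).
have := frac_repr G; set x := generic_quotient.repr _ => e.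
have d0 : (frac x).2 != 0 by apply: denom_ratioP.
apply/eqP; rewrite eqr_div ?hinj // -!rmorphM; apply/eqP; congr (mfrac h _).
by apply/eqP; rewrite -tofrac_eq !tofracM e /G mulrAC divfK ?tofrac_eq0.
Qed.

(** ** The substitution u = 1 / t *)

Section Inverse.
Variable n : nat.

Definition invX : {mpoly C[n]} -> ratfun C n := mfrac (fun i => (rvar C i)^-1).

HB.instance Definition _ := GRing.RMorphism.copy invX (mfrac (fun i => (rvar C i)^-1)).

(** This is (t_1 ... t_n)^M p(1 / t). *)
Definition mrev (M : nat) (p : {mpoly C[n]}) : {mpoly C[n]} :=
  \sum_(m <- msupp p) p@_m *: 'X_[[multinom (M - m i)%N | i < n]].

Lemma rvar_neq0 i : rvar C (i : 'I_n) != 0.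
Proof. by rewrite /rvar tofrac_eq0 mX_neq0. Qed.

Lemma le_msize (p : {mpoly C[n]}) m i : m \in msupp p -> (m i <= msize p)%N.
Proof. by move=> /msize_mdeg_lt; rewrite mdegE (bigD1 i) //=; lia. Qed.

Lemma tofrac_mrev M (p : {mpoly C[n]}) : (msize p <= M)%N ->
  tofrac (mrev M p) = (\prod_i rvar C i) ^+ M * invX p.
Proof.
move=> pM; rewrite /mrev /invX /mfrac /mmap rmorph_sum mulr_sumr big_seq [RHS]big_seq.
apply: eq_bigr => m mp; rewrite /= -mul_mpolyC tofracM -/(rconst n _) mulrCA; congr (_ * _).
rewrite mpolyXE_id rmorph_prod /= /mmap1 -prodrXl -big_split; apply: eq_bigr => i _ /=.
rewrite tofracXn -/(rvar C i) mnmE exprVn exprB ?unitfE ?rvar_neq0 //.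
exact: leq_trans (le_msize i mp) pM.
Qed.

Lemma mrev_neq0 M (p : {mpoly C[n]}) : (msize p <= M)%N -> p != 0 -> mrev M p != 0.
Proof.
move=> pM p0; pose m := mlead p; have mp : m \in msupp p by apply: mlead_supp.
apply/eqP => /(congr1 (mcoeff [multinom (M - m i)%N | i < n])); rewrite mcoeff0 raddf_sum /=.
rewrite (bigD1_seq m) ?msupp_uniq //= mcoeffZ mcoeffX eqxx mulr1 big_seq_cond big1 ?addr0 => [/eqP|m' /andP[m'p m'm]].
  by rewrite mcoeff_eq0 mp.
rewrite mcoeffZ mcoeffX; case: eqP => [/mnmP e|]; last by rewrite mulr0.
case/eqP: m'm; apply/mnmP => i; have := e i; rewrite !mnmE.
by have := leq_trans (le_msize i m'p) pM; have := leq_trans (le_msize i mp) pM; lia.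
Qed.

Lemma invX_neq0 p : p != 0 -> invX p != 0.
Proof.
move=> p0; apply: contraNneq (mrev_neq0 (leqnn _) p0) => e.
by rewrite -tofrac_eq0 (tofrac_mrev (leqnn _)) e mulr0.
Qed.

Lemma mulser_mrev M p (s : ser n C^o) k : (msize p <= M)%N ->
  mulser (mrev M p) s k = mulser p (fun k => s (- k)) ([ffun=> M%:Z] - k).
Proof.
move=> pM; rewrite /mrev mulser_sump [RHS]/mulser big_seq [RHS]big_seq; apply: eq_bigr => m mp.
rewrite mulserZp mulserXm; congr (_ *: s _); apply/kextP => i.
by rewrite !kE mnmE; have := leq_trans (le_msize i mp) pM; lia.
Qed.

(** Multiplying the relation in u = 1 / t by a high power of t_1 ... t_n gives a
    relation between polynomials in t. *)
Lemma expands_invX (s : ser n C^o) p p' : is_laurent s -> p' != 0 ->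
  mulser p' (fun k => s (- k)) =1 toser p -> expands s (invX p / invX p').
Proof.
move=> ls p'0 e; split=> //; pose M := maxn (msize p) (msize p').
have pM : (msize p <= M)%N by rewrite leq_maxl.
have p'M : (msize p' <= M)%N by rewrite leq_maxr.
exists (mrev M p), (mrev M p'); split; first exact: mrev_neq0.
  rewrite /rfrac !tofrac_mrev // -mulf_div divff ?mul1r // expf_neq0 //.
  by apply/prodf_neq0 => i _; apply: rvar_neq0.
move=> k; apply: (etrans (mulser_mrev _ _ p'M)); rewrite e; apply: etrans (esym (mulser_mrev _ _ pM)).
by apply: eq_mulser => l; rewrite /one_ser oppr_eq0.
Qed.

End Inverse.
End Fractions.

(** ** The sign of the shuffle *)

Section Shuffle.
Variables (C : fieldType) (r n : nat) (iota : 'I_n -> 'I_r).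

Lemma pairprod_filter (T : eqType) (R : comNzRingType) (l : T -> T -> R) (a : pred T) s :
  pairprod l (filter a s) = pairprod (fun x y => if a x && a y then l x y else 1) s.
Proof.
elim: s => //= x s IH; case: ifP => ax /=; rewrite IH; last by rewrite big1 ?mul1r.
by rewrite big_filter big_mkcond.
Qed.

Definition vblocks : {mpoly C[n]} :=
  \prod_(s < r) \prod_(i in block iota s) \prod_(j in block iota s | (i < j)%N) ('X_i - 'X_j).

Lemma pairprod_block s : pairprod (vfactor C iota) (enum (block iota s)) =
  \prod_(i in block iota s) \prod_(j in block iota s | (i < j)%N) ('X_i - 'X_j).
Proof.
have -> : enum (block iota s) = filter (mem (block iota s)) (enum 'I_n) by rewrite enumT.
rewrite pairprod_filter pairprod_enum [RHS]big_mkcond; apply: eq_bigr => i _.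
case: ifP => iB; last by rewrite big1 // => j _; rewrite inE iB.
rewrite big_mkcond [RHS]big_mkcond; apply: eq_bigr => j _.
have -> : mem (block iota s) i && mem (block iota s) j = (j \in block iota s) by rewrite [mem _ i]iB.
rewrite andbC; case: (ltnP i j) => //= _; case: ifP => // jB.
by move: iB jB; rewrite /vfactor !inE => /eqP-> /eqP->; rewrite eqxx.
Qed.

(** The blocks follow each other in the order of the colours, so that pairs of
    different colours contribute 1. *)
Lemma pairprod_shuffle : pairprod (vfactor C iota) (shuffle_seq iota) = vblocks.
Proof.
have : pairwise (fun s s' : 'I_r => (s < s')%N) (enum 'I_r).
  by rewrite -(pairwise_map val ltn) val_enum_ord -sorted_pairwise ?iota_ltn_sorted //; apply: ltn_trans.
rewrite /shuffle_seq /vblocks -[RHS]big_enum; elim: (enum 'I_r) => [|s L IH] /=; first by rewrite big_nil.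
move=> /andP[sL /IH e]; rewrite pairprod_cat big_cons e pairprod_block.
rewrite [X in _ * X](_ : _ = 1) ?mulr1 // big_seq big1 // => x.
rewrite mem_enum inE => /eqP xs; rewrite big_seq big1 // => y /flatten_mapP[s' s'L].
rewrite mem_enum inE => /eqP ys; rewrite /vfactor xs ys.
have /(allP sL) ss' := s'L; case: eqP => [e'|_]; last by rewrite ss'.
by move: ss'; rewrite e' ltnn.
Qed.

Lemma pairprod_vfactor_alt s1 x y s2 :
  pairprod (vfactor C iota) (s1 ++ x :: y :: s2) = - pairprod (vfactor C iota) (s1 ++ y :: x :: s2).
Proof. by have [p [-> ->]] := pairprod_swap (vfactor C iota) s1 x y s2; rewrite vfactorC mulrN. Qed.

Lemma map_shuffle : map (shuffle iota) (enum 'I_n) = shuffle_seq iota.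
Proof.
have sz : size (shuffle_seq iota) = n by rewrite (perm_size (shuffle_seq_perm iota)) size_enum_ord.
case: (posnP n) => [n0|].
  by rewrite [RHS]size0nil ?sz //; apply: size0nil; rewrite size_map size_enum_ord.
move=> n0; apply: (@eq_from_nth _ (Ordinal n0)); first by rewrite size_map size_enum_ord.
move=> i; rewrite size_map size_enum_ord => ilt; rewrite (nth_map (Ordinal n0)) ?size_enum_ord //.
rewrite /shuffle permE nth_enum_ord // (set_nth_default (Ordinal n0)) ?sz //.
Qed.

Lemma pairprod_vfactor_enum :
  pairprod (vfactor C iota) (enum 'I_n) = (-1) ^+ shuffle iota * vblocks.
Proof.
have := alt_perm (F := pairprod (vfactor C iota)) (fun s1 x y s2 _ => pairprod_vfactor_alt s1 x y s2)
   (shuffle iota) (enum_uniq _) (fun x => mem_enum _ x).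
by rewrite map_shuffle pairprod_shuffle => ->; rewrite mulrA -signr_addb addbb mul1r.
Qed.

Lemma prefactor_invX q (g : simple_lie C r) N D : D != 0 ->
  prefactor q g iota * (invX N / invX D) =
  invX ((\prod_i 'X_i) * pairprod (vfactor C iota) (enum 'I_n) * N) /
  invX (pairprod (cform (fun s t => q ^ sl_form g s t) iota) (enum 'I_n) * D).
Proof.
move=> D0; rewrite pairprod_vfactor_enum /prefactor !rmorphM /= mulf_div.
have -> : invX vblocks = \prod_(s < r) \prod_(i in block iota s) \prod_(j in block iota s | (i < j)%N)
     ((rvar C i)^-1 - (rvar C j)^-1) :> ratfun C n.
  rewrite rmorph_prod; apply: eq_bigr => s _; rewrite rmorph_prod; apply: eq_bigr => i _.
  by rewrite rmorph_prod; apply: eq_bigr => j _; rewrite rmorphB /= /invX !mfracX.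
have -> : invX ((-1) ^+ shuffle iota) = (-1) ^+ shuffle iota :> ratfun C n by rewrite rmorphXn rmorphN rmorph1.
have -> : invX (\prod_i 'X_i) = (\prod_i rvar C i)^-1 :> ratfun C n.
  by rewrite rmorph_prod -prodfV; apply: eq_bigr => i _; rewrite /= /invX mfracX.
have -> : invX (pairprod (cform (fun s t => q ^ sl_form g s t) iota) (enum 'I_n)) =
   \prod_(i < n) \prod_(j < n | (i < j)%N)
    ((rvar C i)^-1 - rconst n (q ^ (sl_form g (iota i) (iota j))) * (rvar C j)^-1).
  rewrite pairprod_enum rmorph_prod; apply: eq_bigr => i _; rewrite rmorph_prod; apply: eq_bigr => j _.
  by rewrite /cform /linform rmorphB /= -mul_mpolyC rmorphM /= /invX !mfracX mfracC.
set a := \prod_i _; set b := \prod_(i < n) _; set c := \prod_(s < r) _; set e := _ ^+ _.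
by rewrite !invfM; move: a^-1 b^-1 (invX D)^-1 (invX N) => a' b' d' n'; ring.
Qed.

End Shuffle.

(** * The rational functions of a representation *)

Section Main.
Variables (C : fieldType) (q : C) (r : nat) (g : simple_lie C r).
Variables (U : algType C) (X : quantum_affine q g U).
Variables (eps : {lrmorphism U -> C^o}) (P : U -> U).
Hypothesis q0 : q != 0.
Hypothesis q_not_root : forall n : nat, (0 < n)%N -> q ^+ n != 1.
Hypothesis eps_counit : is_counit X eps.
Hypothesis prod_iso : product_iso (in_Uf_minus X) (in_UF_plus X) (in_UF X).
Hypothesis P_proj : is_projection X eps P.
Hypothesis conj_W : weight_property X P.
Variables (V : vectType C) (rho : {linear U -> 'End(V)}) (v : V).
Hypothesis rho_repr : is_repr rho.
Hypothesis v_sing : singular_generator X rho v.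
Hypothesis C0 : [pchar C] =i pred0.

Let dimV := \dim (fullv : {vspace V}).
Let qc (s t : 'I_r) : C := q ^ sl_form g s t.

Definition wcoord (j : 'I_dimV) n (c : 'I_n -> 'I_r) (s : seq 'I_n) : ser n C^o :=
  fun k => coord (vbasis fullv) j (wser X P rho v c s k).

Lemma coord_lin (j : 'I_dimV) a (x y : V) :
  coord (vbasis fullv) j (a *: x + y) = a * coord (vbasis fullv) j x + coord (vbasis fullv) j y.
Proof. by rewrite linearP. Qed.

Lemma mulser_coord j n p (s : ser n V) k :
  mulser p (fun k => coord (vbasis fullv) j (s k) : C^o) k = coord (vbasis fullv) (j : 'I_dimV) (mulser p s k).
Proof. exact: (mulser_map (f := fun x => coord (vbasis fullv) j x : C^o)) (coord_lin j). Qed.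

Lemma two0 : 2%:R != 0 :> C.
Proof. by rewrite ((pcharf0P _).1 C0). Qed.

Lemma wcoord_exchange j n (c : 'I_n -> 'I_r) s1 x y s2 k : uniq (s1 ++ x :: y :: s2) ->
  mulser (cform qc c x y) (wcoord j c (s1 ++ x :: y :: s2)) k =
  - mulser (cform qc c y x) (wcoord j c (s1 ++ y :: x :: s2)) k.
Proof.
move=> us; have cN z : coord (vbasis fullv) j (- z) = - coord (vbasis (fullv : {vspace V})) j z.
  by rewrite linearN.
rewrite !mulser_coord -[RHS]cN; apply: (congr1 (coord (vbasis fullv) j)).
exact: (wser_exchange q0 P_proj).
Qed.

Lemma wcoord_first j n (c : 'I_n -> 'I_r) x s (k : {ffun 'I_n -> int}) :
  (k x <= 0)%O -> wcoord j c (x :: s) k = 0.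
Proof. by move=> kx; rewrite /wcoord (wser_first q0 eps_counit prod_iso P_proj conj_W) // linear0. Qed.

Lemma wcoord_map j n n' (f : 'I_n -> 'I_n') (c : 'I_n' -> 'I_r) c' s k :
  (forall x, c' x = c (f x)) -> wcoord j c (map f s) k = wcoord j c' s (kcomp f k).
Proof.
move=> cc; rewrite /wcoord wser_map; apply: (congr1 (coord (vbasis fullv) j)).
by rewrite /wser /prodF; congr (wact _ _ _ _); apply: eq_bigr => x _; rewrite cc.
Qed.

(** If the series vanish, the denominator can be taken to be 1; this keeps the set
    of all poles finite. *)
Lemma numerators n (c : 'I_n -> 'I_r) : exists (d : {poly C}) (N : 'I_dimV -> {mpoly C[n]}),
  [/\ d`_0 = 1, forall j, numerator qc (wcoord j) c d (N j) &
      (forall k, wser X P rho v c (enum 'I_n) k = 0) -> d = 1].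
Proof.
have main d : bounded (mulser (allX n d) (mulser (pairprod (cform qc c) (enum 'I_n)) (wser X P rho v c (enum 'I_n)))) ->
    exists N : 'I_dimV -> {mpoly C[n]}, forall j, numerator qc (wcoord j) c d (N j).
  move=> [b hb]; apply: (fin_all_exists (P := fun j N => numerator qc (wcoord j) c d N)) => j.
  apply: (numer_factor two0 (@wcoord_exchange j) (@wcoord_first j) (@wcoord_map j)).
  exists b => k i ki; transitivity (coord (vbasis fullv) j (0 : V)); last by rewrite linear0.
  rewrite -(hb k i ki) -mulser_coord; apply: eq_mulser => l; rewrite -mulser_coord //.
have [w0|w0] := classic (forall k, wser X P rho v c (enum 'I_n) k = 0).
  have [|N hN] := main 1; last by exists 1, N; split=> //; rewrite coefC.
  exists 0%N => k i _; rewrite mulser0s // => l; rewrite mulser0s //.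
have [d d0 hd] := wser_rational q0 q_not_root conj_W v rho_repr c.
by have [N hN] := main d hd; exists d, N; split.
Qed.

Definition gcol (nn : 'I_r -> nat) : 'I_#|{: gvar nn}| -> 'I_r :=
  at_var (fun x : gvar nn => tag x).

Lemma count_gcol nn s : (nn s <= count (fun i => gcol (nn := nn) i == s) (enum 'I_#|{: gvar nn}|))%N.
Proof.
have finj : injective (fun j : 'I_(nn s) => enum_rank (mkvar j)).
  by move=> j j' /enum_rank_inj /eqP; rewrite -tag_eqE /tag_eq /= eqxx tagged_asE => /eqP.
have e : nn s = #|codom (fun j : 'I_(nn s) => enum_rank (mkvar j))| by rewrite card_codom // card_ord.
apply: leq_trans (eq_leq e) _; rewrite -size_filter [#|codom _|]cardE.
apply: uniq_leq_size (enum_uniq _) _ => i; rewrite mem_enum => /codomP[j ->].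
by rewrite mem_filter mem_enum andbT /gcol /at_var enum_rankK.
Qed.

(** ** Denominators and labels of the variables *)

Lemma meval_allX n (d : {poly C}) (u : 'I_n -> C) : (allX n d).@[u] = \prod_i d.[u i].
Proof.
rewrite rmorph_prod; apply: eq_bigr => i _ /=.
rewrite atXE rmorph_sum horner_coef; apply: eq_bigr => j _ /=.
by rewrite mevalZ rmorphXn /= mevalXU.
Qed.

Lemma horner_at0 (d : {poly C}) : d`_0 = 1 -> d.[0] = 1.
Proof. by rewrite horner_coef0. Qed.

Lemma allX_neq0 n (d : {poly C}) : d`_0 = 1 -> allX n d != 0.
Proof.
move=> d0; apply: contra_neq (oner_neq0 C) => e.
by have := meval_allX d (fun _ : 'I_n => 0); rewrite e meval0 big1 // => i _; apply: horner_at0.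
Qed.

Lemma root_seq (d : {poly C}) : d != 0 -> exists s : seq C, forall x, root d x = (x \in s).
Proof.
move: {2}(size d) (leqnn (size d)) => n; elim: n d => [|n IH] d.
  by rewrite leqn0 size_poly_eq0 => ->.
move=> sd d0; case: (classic (exists x, root d x)) => [[x rx]|h]; last first.
  by exists [::] => x; apply/negP => rx; apply: h; exists x.
have [d' dE] := factor_theorem _ _ rx.
have d'0 : d' != 0 by apply: contraNneq d0 => d'0; rewrite dE d'0 mul0r.
have [|//|s hs] := IH d'.
  by move: sd; rewrite dE size_Mmonic ?monicXsubC // size_XsubC addn2.
by exists (x :: s) => y; rewrite dE rootM root_XsubC hs inE orbC.
Qed.

Lemma weight_fun_laurent n (c : 'I_n -> 'I_r) (j : 'I_dimV) :
  is_laurent (fun k => coord (vbasis fullv) j (rho (weight_fun X P c k) v) : C^o).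
Proof.
have [[a [h1 h2]] _] := conj_W c; exists a; split=> // i k aik.
by rewrite (h2 i k aik) linear0 zero_lfunE linear0.
Qed.

(** The variable u^(s)_j is replaced by 1 / t_z, with z the j-th element of I_s. *)
Definition bvar n (iota : 'I_n -> 'I_r)
    (i : 'I_#|{: gvar (fun s => #|block iota s|)}|) : 'I_n :=
  enum_val (tagged (enum_val i)).

Lemma bvar_col n (iota : 'I_n -> 'I_r) i : gcol i = iota (bvar (iota := iota) i).
Proof. by have := enum_valP (tagged (enum_val i)); rewrite inE => /eqP. Qed.

Lemma bvar_bij n (iota : 'I_n -> 'I_r) : bijective (bvar (iota := iota)).
Proof.
have zb z : z \in block iota (iota z) by rewrite inE.
pose h z := enum_rank (mkvar (nn := fun s => #|block iota s|) (enum_rank_in (zb z) z)).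
have hK : cancel h (bvar (iota := iota)).
  by move=> z; rewrite /bvar /h enum_rankK /= enum_rankK_in.
have tinj (x x' : gvar (fun s => #|block iota s|)) :
    enum_val (tagged x) = enum_val (tagged x') -> x = x'.
  case: x x' => [s a] [s' a'] /= e.
  have := enum_valP a; rewrite e inE => /eqP es; have := enum_valP a'; rewrite inE es => /eqP ss.
  by subst s'; congr (existT _ _ _); apply: enum_val_inj.
by exists h => // i; apply: enum_val_inj; apply: tinj; apply: (hK (bvar i)).
Qed.

Lemma mfrac_bvar n (iota : 'I_n -> 'I_r) p :
  mfrac (at_var (@inv_vars C r n iota)) p = invX (rename (bvar (iota := iota)) p).
Proof. by apply: mfrac_rename. Qed.

Lemma rename_neq0 n n' (f : 'I_n -> 'I_n') (p : {mpoly C[n]}) : bijective f -> p != 0 -> rename f p != 0.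
Proof.
move=> bf; apply: contraNneq => e; apply/eqP/toser_inj => k; have [h fK hK] := bf.
have -> : k = kcomp f (kcomp h k) by apply/kextP => i; rewrite !kE fK.
by rewrite -toser_rename // e !/(toser _ _) /toser !mulser0p.
Qed.

(** ** Zeros on the Serre subspaces *)

Section SerreNodes.
Variables (nn : 'I_r -> nat) (s t : 'I_r) (st : s != t).
Let m := serre_len (sl_cartan g s t).
Variables (k : 'I_m -> 'I_(nn s)) (l : 'I_(nn t)).
Hypothesis k_inj : injective k.

(** The variables k_1, ..., k_m followed by l. *)
Definition serre_node (i : 'I_m.+1) : 'I_#|{: gvar nn}| :=
  enum_rank (if insub (val i) : option 'I_m is Some i' then mkvar (k i') else mkvar l).

Lemma serre_node_widen i : serre_node (widen_ord (leqnSn m) i) = enum_rank (mkvar (k i)).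
Proof. by rewrite /serre_node /= valK. Qed.

Lemma serre_node_max : serre_node ord_max = enum_rank (mkvar l).
Proof. by rewrite /serre_node insubN // -leqNgt. Qed.

Lemma serre_nodeP (i : 'I_m.+1) : i = ord_max \/ exists i', i = widen_ord (leqnSn m) i'.
Proof.
have [->|im] := eqVneq i ord_max; first by left.
have lti : (i < m)%N by have := ltn_ord i; move: im; rewrite -val_eqE /=; lia.
by right; exists (Ordinal lti); apply: val_inj.
Qed.

Lemma serre_node_col i : gcol (serre_node i) = if i == ord_max then t else s.
Proof.
rewrite /gcol /at_var; have [->|[i' ->]] := serre_nodeP i.
  by rewrite serre_node_max enum_rankK eqxx.
by rewrite serre_node_widen enum_rankK /= -val_eqE /= ltn_eqF.
Qed.

Lemma mkvar_inj (i j : 'I_(nn s)) : mkvar i = mkvar j -> i = j.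
Proof. by move=> /eqP; rewrite -tag_eqE /tag_eq /= eqxx tagged_asE => /eqP. Qed.

Lemma serre_node_inj : injective serre_node.
Proof.
move=> i j e; have := congr1 (@gcol nn) e; rewrite !serre_node_col.
case: eqP => [->|_]; case: eqP => [-> //|_] // e'; try by case/eqP: st; rewrite e'.
move: e; have [->|[i' ->]] := serre_nodeP i; have [->|[j' ->]] := serre_nodeP j => //.
- rewrite -[LHS]enum_valK -[RHS]enum_valK serre_node_max serre_node_widen !enum_rankK.
  by move=> /enum_rank_inj /(congr1 (@tag _ _)) /= ts; case/eqP: st.
- rewrite -[LHS]enum_valK -[RHS]enum_valK serre_node_max serre_node_widen !enum_rankK.
  by move=> /enum_rank_inj /(congr1 (@tag _ _)) /= ts; case/eqP: st.
by rewrite !serre_node_widen => /enum_rank_inj /mkvar_inj /k_inj ->.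
Qed.

Lemma serre_lenE : m%:Z = 1 - sl_cartan g s t.
Proof. by rewrite /m /serre_len gez0_abs //; have := cartan_le0 g C0 st; lia. Qed.

Lemma qfinE i : qfin q g i = q ^ (sl_d g (lift ord0 i))%:Z.
Proof. by []. Qed.

Lemma d_gt0 i : (0 < sl_d g i)%N.
Proof. by have := sl_d123 g i; rewrite !inE => /or3P[] /eqP->. Qed.

Lemma qfin_inj i : injective (fun e : int => qfin q g i ^ e).
Proof.
move=> e e' /=; rewrite qfinE !exprz_exp => /(expfz_inj q0 q_not_root).
by have := d_gt0 (lift ord0 i); nia.
Qed.

Lemma qfact_neq0 i p : qfact (qfin q g i) p != 0.
Proof.
have h e : (0 < e)%N -> qfin q g i ^+ e - qfin q g i ^- e != 0.
  move=> e0; rewrite subr_eq0; apply/negP => /eqP; rewrite exprnP exprnN => /(qfin_inj (i := i)); lia.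
rewrite /qfact prodf_seq_neq0; apply/allP => a; rewrite mem_index_iota => /andP[a1 _] /=.
rewrite /qnum mulf_neq0 ?h // invr_eq0; have := h 1%N isT; by rewrite expr1.
Qed.

Lemma serre_coef_neq0 : (-1) ^+ m * qbinom (qfin q g s) m m != 0.
Proof.
rewrite mulf_neq0 ?signr_eq0 // /qbinom subnn.
rewrite [qfact _ 0](_ : _ = 1) ?mulr1 ?divff ?oner_eq0 ?qfact_neq0 //.
by rewrite /qfact big_geq.
Qed.

Lemma form_diag : sl_form g s s = (sl_d g (lift ord0 s))%:Z * 2.
Proof. by rewrite /sl_form; case: (sl_chevalleyP g) => _ _ _ _ [-> _]. Qed.

Lemma numerator_serre j d N : numerator qc (wcoord j) (gcol (nn := nn)) d N ->
  msub (onH serre_node (qfin q g s)) N = 0.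
Proof.
pose coef (p : 'I_m.+1) := (-1) ^+ p * qbinom (qfin q g s) m p.
have form_st : q ^ sl_form g s t = qfin q g s ^ (1 - m%:Z).
  by rewrite qfinE exprz_exp serre_lenE /sl_form; congr (q ^ (_ * _)); lia.
apply: (@serre_vanish _ _ qc _ (wcoord j) _ (gcol (nn := nn)) _ m serre_node coef _ _ _ (qfin q g s) _ _ s t st).
- by move=> a b; apply: expfz_neq0.
- move=> z x y pz xy; apply: (wser_dirfin q0 conj_W rho v (gcol (nn := nn))
    (phi := fun x => coord (vbasis fullv) j x)) => //; by rewrite linear0.
- exact: serre_node_inj.
- exact: serre_coef_neq0.
- move=> rest e; transitivity (coord (vbasis fullv) j (0 : V)); last by rewrite linear0.
  have cx i : gcol (nn := nn) (serre_node (widen_ord (leqnSn m) i)) = s.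
    by rewrite serre_node_col -val_eqE /= ltn_eqF.
  have cy : gcol (nn := nn) (serre_node ord_max) = t by rewrite serre_node_col eqxx.
  rewrite -(wser_serre P_proj rho v rest e st cx cy) linear_sum; apply: eq_bigr => p _.
  rewrite linearZ; congr (_ * _); rewrite linear_sum; apply: eq_bigr => sg _.
  by rewrite map_node_order.
- by rewrite qfinE expfz_neq0.
- exact: qfin_inj.
- by move=> i im; rewrite serre_node_col (negPf im).
- by rewrite serre_node_col eqxx.
- by rewrite /qc form_diag qfinE exprz_exp.
- exact: form_st.
- by rewrite /qc form_sym; apply: form_st.
Qed.

End SerreNodes.

(** ** Expansion, symmetry, poles and zeros *)

Lemma cform_neq0 n (c : 'I_n -> 'I_r) x y : x != y -> cform qc c x y != 0.
Proof.
move=> nxy; rewrite /cform /linform /=.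
by have := @ZX_neq0 C n 1 (qc (c x) (c y)) x y (oner_neq0 _) nxy; rewrite scale1r.
Qed.

Lemma wcoord_expands j n (iota : 'I_n -> 'I_r) (d : {poly C})
    (N : {mpoly C[#|{: gvar (fun s => #|block iota s|)}|]}) :
  d`_0 = 1 -> numerator qc (wcoord j) (gcol (nn := fun s => #|block iota s|)) d N ->
  expands (fun k => coord (vbasis fullv) j (rho (weight_fun X P iota k) v))
    (prefactor q g iota * rsubst (at_var (@inv_vars C r n iota)) (tofrac N / tofrac (allX _ d))).
Proof.
move=> d0 hN; have bb := bvar_bij iota.
rewrite rsubst_frac ?allX_neq0 // => [|p p0]; last by rewrite mfrac_bvar invX_neq0 ?rename_neq0.
rewrite !mfrac_bvar rename_allX // prefactor_invX ?allX_neq0 //.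
apply: expands_invX; first exact: weight_fun_laurent.
  rewrite mulf_neq0 ?allX_neq0 // pairprod_neq0 ?enum_uniq // => x y; exact: cform_neq0.
have hN' := numerator_rename (@wcoord_map j) bb (@bvar_col _ iota) hN.
move=> k; rewrite -(hN' _ (perm_refl _)) /numer -mulserM [allX _ _ * _]mulrC; apply: eq_mulser => l.
by rewrite /wcoord wser_weight_fun.
Qed.

Lemma rsubst_rename n (f : 'I_n -> 'I_n) a b : bijective f -> b != 0 ->
  rsubst (fun i => rvar C (f i)) (tofrac a / tofrac b) = tofrac (rename f a) / tofrac (rename f b).
Proof.
move=> bf b0; have e p : mfrac (fun i => rvar C (f i)) p = tofrac (rename f p).
  by rewrite (mfrac_rename _ (h := @rvar C n) (f := f)) // mfrac_var.
by rewrite rsubst_frac ?e // => p p0; rewrite e tofrac_eq0 rename_neq0.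
Qed.

Lemma rfrac_eq n (a b p d : {mpoly C[n]}) : b != 0 -> d != 0 ->
  tofrac a / tofrac b = rfrac p d -> a * d = p * b.
Proof.
move=> b0 d0 /eqP; rewrite /rfrac eqr_div ?tofrac_eq0 // -!tofracM tofrac_eq => /eqP->.
by [].
Qed.

Definition num_den (nn : 'I_r -> nat) : Type :=
  {poly C} * ('I_dimV -> {mpoly C[#|{: gvar nn}|]}).

Definition numer_data nn (dN : num_den nn) : Prop :=
  dN.1`_0 = 1 /\
  forall j, numerator qc (wcoord j) (gcol (nn := nn)) dN.1 (dN.2 j).

Definition wbar (nn : 'I_r -> nat) (dN : num_den nn) : gratfun V nn :=
  \row_j (tofrac (dN.2 j) / tofrac (allX _ dN.1)).

Lemma numer_data_exists : exists B, forall nn, exists dN : num_den nn,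
  numer_data dN /\ (dN.1 = 1 \/ forall s, (nn s <= B)%N).
Proof.
have [B hB] := weight_bound q0 q_not_root eps_counit prod_iso P_proj rho_repr v_sing.
exists B => nn; have [d [N [d0 hN d1]]] := numerators (gcol (nn := nn)).
exists (d, N); split=> //=.
have [w0|w0] := classic (forall k, wser X P rho v (gcol (nn := nn)) (enum 'I_#|{: gvar nn}|) k = 0).
  by left; apply: d1.
right=> s; have [k wk] := not_all_ex_not _ _ w0; move/eqP: wk => wk.
exact: leq_trans (count_gcol nn s) (hB _ (gcol (nn := nn)) _ _ wk s).
Qed.

Section Wbar.
Variable nn : 'I_r -> nat.
Variable dN : num_den nn.
Hypothesis dNP : numer_data dN.

Lemma wbar_symmetric : gsymmetric (wbar dN).
Proof.
move=> tau; have [d0 hN] := dNP.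
pose f : 'I_#|{: gvar nn}| -> 'I_#|{: gvar nn}| :=
  at_var (fun x : gvar nn => enum_rank (mkvar (tau (tag x) (tagged x)))).
have bf : bijective f.
  apply: injF_bij => i i' /enum_rank_inj e; apply: enum_val_inj.
  case: (enum_val i) (enum_val i') e => [s a] [s' a'] /= e.
  have ss : s = s' := congr1 (@tag _ _) e; subst s'.
  by have /perm_inj-> := mkvar_inj e.
apply/rowP => j; rewrite !mxE -[at_var _]/(fun i => rvar C (f i)).
rewrite rsubst_rename ?allX_neq0 // rename_allX //.
rewrite (numerator_sym (@wcoord_map j) bf _ (hN j)) // => i.
by rewrite /gcol /at_var /f enum_rankK.
Qed.

Lemma wbar_poles (S : seq C) :
  (forall x, root dN.1 x -> x \in S) -> poles_in (wbar dN) (fun _ => S).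
Proof.
move=> hS u [j hj]; have [d0 hN] := dNP; apply: NNPP => h; apply: hj.
eexists; exists (dN.2 j), (allX _ dN.1); split; last by [].
  rewrite meval_allX; apply/prodf_neq0 => i _; apply/negP => ri; apply: h.
  exists (tag (enum_val i)), (tagged (enum_val i)); rewrite /mkvar taggedK.
  exact: hS.
by rewrite mxE.
Qed.

(** If p / d is another fraction for this function, regular at u, then p times the
    denominator of [wbar] vanishes on H, which contains 0, where this denominator
    is 1. *)
Lemma wbar_vanishes (s t : 'I_r) (k : 'I_(serre_len (sl_cartan g s t)) -> 'I_(nn s))
    (l : 'I_(nn t)) :
  s != t -> injective k -> vanishes_on (wbar dN) (in_H q g k l).
Proof.
move=> st kinj u uH j c [p [d [du e ->]]].
have [d0 hN] := dNP; rewrite mxE in e.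
have dn0 : d != 0 by apply: contraNneq du => ->; rewrite meval0.
have pE := rfrac_eq (allX_neq0 _ d0) dn0 e.
pose H := onH (serre_node k l) (qfin q g s).
have uE i : (H i).@[at_var u] = at_var u i.
  rewrite /H /onH; case: pickP => [a /eqP <-|_]; last by rewrite mevalXU.
  rewrite mevalZ mevalXU /hratio serre_node_max /at_var enum_rankK.
  have [->|[a' ->]] := serre_nodeP st a; first by rewrite eqxx mul1r serre_node_max enum_rankK.
  rewrite -val_eqE /= ltn_eqF // serre_node_widen enum_rankK (uH a') mulrA qfinE exprz_exp -expfzDr //.
  by rewrite [_ + _](_ : _ = 0) ?expr0z ?mul1r //; rewrite mulrC; lia.
have : msub H (p * allX _ dN.1) = 0.
  by rewrite -pE rmorphM /= (numerator_serre st l kinj (hN j)) mul0r.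
rewrite rmorphM /= => /eqP; rewrite mulf_eq0 => /orP[/eqP Hp|/eqP HD].
  suff -> : p.@[at_var u] = 0 by rewrite mul0r.
  by rewrite -(meval_eq _ uE) -meval_msub Hp meval0.
have := meval_msub H (allX _ dN.1) (fun _ => 0); rewrite HD meval0 meval_allX big1 => [/eqP|i _].
  by rewrite eq_sym oner_eq0.
rewrite (_ : (H i).@[_] = 0) ?horner_at0 // /H /onH.
by case: pickP => [a _|_]; rewrite ?mevalZ mevalXU ?mulr0.
Qed.

End Wbar.

Lemma wbar_expands n (iota : 'I_n -> 'I_r)
    (dN : num_den (fun s => #|block iota s|)) :
  numer_data dN ->
  vexpands (fun k => rho (weight_fun X P iota k) v)
    (prefactor q g iota *: map_mx (rsubst (at_var (@inv_vars C r n iota))) (wbar dN)).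
Proof. by move=> [d0 hN] j; rewrite !mxE; apply: wcoord_expands. Qed.

Lemma common_roots (L : seq {poly C}) : (forall d, d \in L -> d`_0 = 1) ->
  exists S : seq C, 0 \notin S /\ forall d x, d \in L -> root d x -> x \in S.
Proof.
elim: L => [|d L IH] hL; first by exists [::].
have [|S [S0 hS]] := IH; first by move=> d' d'L; apply: hL; rewrite inE d'L orbT.
have d0 := hL d (mem_head _ _).
have [|s hs] := root_seq (d := d).
  by apply: contraTneq isT => e; move: d0; rewrite e coef0 => /eqP; rewrite eq_sym oner_eq0.
exists (s ++ S); split=> [|d' x].
  by rewrite mem_cat negb_or S0 andbT -hs /root horner_at0 // oner_eq0.
rewrite inE => /predU1P[->|d'L] rx; rewrite mem_cat -?hs ?rx //.
by rewrite (hS _ _ d'L rx) orbT.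
Qed.

End Main.

Theorem proposition4p5 (R : realType) (q : R[i]) (q_neq0 : q != 0)
    (q_not_root : forall n : nat, (0 < n)%N -> q ^+ n != 1)
    (r : nat) (g : simple_lie R[i] r)
    (U : algType R[i]) (X : quantum_affine q g U)
    (eps : {lrmorphism U -> (R[i])^o}) (eps_counit : is_counit X eps)
    (prod_iso : product_iso (in_Uf_minus X) (in_UF_plus X) (in_UF X))
    (P : U -> U) (P_proj : is_projection X eps P)
    (conj_W : weight_property X P)
    (V : vectType R[i]) (rho : {linear U -> 'End(V)}) (rho_repr : is_repr rho)
    (v : V) (v_sing : singular_generator X rho v) :
  let w n (iota : 'I_n -> 'I_r) := fun k => rho (weight_fun X P iota k) v in
  (forall n (iota : 'I_n -> 'I_r), exists G : vratfun n V,
     vexpands (w n iota) G) /\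
  exists wbar : forall nn : 'I_r -> nat, gratfun V nn,
    (forall n (iota : 'I_n -> 'I_r),
       vexpands (w n iota)
         (prefactor q g iota *:
          map_mx (rsubst (at_var (@inv_vars R[i] r n iota)))
            (wbar (fun s => #|block iota s|)))) /\
    (forall nn : 'I_r -> nat, gsymmetric (wbar nn)) /\
    (exists S : 'I_r -> seq R[i], (forall s, 0 \notin S s) /\
       forall nn : 'I_r -> nat, poles_in (wbar nn) S) /\
    (forall (nn : 'I_r -> nat) (s t : 'I_r), s != t ->
       forall k : 'I_(serre_len (sl_cartan g s t)) -> 'I_(nn s), injective k ->
       forall l : 'I_(nn t), vanishes_on (wbar nn) (in_H q g k l)).
Proof.
move=> w; have C0 : [pchar R[i]] =i pred0 := Num.Theory.pchar_num _.
have [B hB] := numer_data_exists q_neq0 q_not_root eps_counit prod_iso P_proj conj_W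
  rho_repr v_sing C0.
pose sol nn := proj1_sig (constructive_indefinite_description _ (hB nn)).
have solP (nn : 'I_r -> nat) : numer_data X P rho v (sol nn) /\
    ((sol nn).1 = 1 \/ forall s, (nn s <= B)%N).
  exact: proj2_sig (constructive_indefinite_description _ (hB nn)).
have wE n (iota : 'I_n -> 'I_r) := wbar_expands conj_W
  (solP (fun s => #|block iota s|)).1.
split; first by move=> n iota; eexists; apply: wE.
exists (fun nn => wbar (sol nn)); split; first exact: wE.
split; first by move=> nn; apply: wbar_symmetric (solP nn).1.
split; last first.
  move=> nn s t st k k_inj l.
  exact: (wbar_vanishes q_neq0 q_not_root P_proj conj_W C0 (solP nn).1 st k_inj).
(* The denominators other than 1 occur for numbers of variables bounded by B. *)
pose dlist := [seq (sol (fun s => f s : nat)).1 | f : {ffun 'I_r -> 'I_B.+1}].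
have [|S [S0 hS]] := common_roots (L := dlist).
  by move=> d /mapP[f _ ->]; case: (solP (fun s => f s : nat)) => [[]].
exists (fun _ => S); split=> // nn; apply: (wbar_poles (solP nn).1) => x rx.
apply: (hS _ _ _ rx); case: (solP nn).2 => [d1|nB].
  by move: rx; rewrite d1 /root hornerC oner_eq0.
apply/mapP; exists [ffun s => inord (nn s)]; rewrite ?mem_enum //; congr (sol _).1.
by apply: functional_extensionality => s; rewrite ffunE inordK // ltnS nB.
Qed.
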